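(* Let $S[1..n]$ be a string over $[1..\sigma]$ and $\Gamma\subseteq[1..n]$ be an attractor for $S$. In $\mathcal O(n)$ space one can build a structure of size $\mathcal O(n)$ words supporting the following query: given a range $\langle i,j\rangle$, report all (or at most any given number of) positions $i'$ such that $S[i'..i'+(j-i)]=S[i..j]$ and $j'\in[i'..i'+(j-i)]$ for some $j'\in\Gamma$, where every such $i'$ is reported in constant time.
   Context: An attractor of $S$ is an $n$-attractor: a set $\Gamma\subseteq[1..n]$ such that every substring $S[i..j]$ ($i\leq j$) has an occurrence $S[i'..j']=S[i..j]$ with $j''\in[i'..j']$ for some $j''\in\Gamma$. Model: word RAM with words of $\Theta(\log n)$ bits. *)

(* Defs.v *)
From mathcomp Require Import all_boot.

Set Implicit Arguments.
Unset Strict Implicit.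
Unset Printing Implicit Defensive.

(* Positions of a string are 1-based, as in S[1..n]. *)
Definition substr (S : seq nat) (i j : nat) : seq nat :=
  take (j.+1 - i) (drop i.-1 S).

Definition meets (G : seq nat) (i j : nat) : bool := has (fun k => i <= k <= j) G.

Definition attractor (S : seq nat) (G : seq nat) : Prop :=
  all (fun k => 0 < k <= size S) G /\
  forall i j, 0 < i <= j -> j <= size S ->
    exists i' j', [/\ 0 < i' <= j', j' <= size S,
                      substr S i' j' = substr S i j & meets G i' j'].

Definition hit (S : seq nat) (G : seq nat) (i j : nat) : pred nat :=
  fun i' => [&& 0 < i', i' + (j - i) <= size S,
                substr S i' (i' + (j - i)) == substr S i j
              & meets G i' (i' + (j - i))].

(* Word RAM with w-bit words, programmed by a structured language.  A program
   mentions finitely many registers and does not depend on w or on the input. *)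

Inductive binop :=
  Add | Sub | Mul | Div | Mod | And | Or | Xor | Shl | Shr | Eq | Lt.

(* Sub wraps around; division by zero returns 0 and y mod 0 returns y. *)
Definition eval_op (w : nat) (o : binop) (y z : nat) : nat :=
  match o with
  | Add => y + z
  | Sub => y + (2 ^ w - z)
  | Mul => y * z
  | Div => y %/ z
  | Mod => y %% z
  | And => Nat.land y z
  | Or  => Nat.lor y z
  | Xor => Nat.lxor y z
  | Shl => y * 2 ^ z
  | Shr => y %/ 2 ^ z
  | Eq  => y == z
  | Lt  => y < z
  end %% 2 ^ w.

(* All arguments are register names, except the literal v of [Const x v]. *)
Inductive cmd :=
| Skip
| Const (x v : nat)
| Op (o : binop) (x y z : nat)
| Read (x y : nat)
| Write (x y : nat)
| Report (x : nat)
| Seq (p q : cmd)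
| If (x : nat) (p q : cmd)
| While (x : nat) (p : cmd).

Record state := State { reg : nat -> nat; memory : nat -> nat }.

Definition set_reg (s : state) (x v : nat) : state :=
  State [eta reg s with x |-> v] (memory s).
Definition set_mem (s : state) (a v : nat) : state :=
  State (reg s) [eta memory s with a |-> v].

(* One entry per machine step: [Some v] when the step reports v, else [None]. *)
Definition trace := seq (option nat).

(* [exec w L p s t s']: from s, the program p halts in s' after the steps t,
   with a memory of L words.  Accessing an address >= L has no derivation, so
   that L bounds the space used by a terminating run. *)
Inductive exec (w L : nat) : cmd -> state -> trace -> state -> Prop :=
| ExecSkip s :
    exec w L Skip s [::] s
| ExecConst x v s :
    exec w L (Const x v) s [:: None] (set_reg s x (v %% 2 ^ w))
| ExecOp o x y z s :
    exec w L (Op o x y z) s [:: None]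
      (set_reg s x (eval_op w o (reg s y) (reg s z)))
| ExecRead x y s : reg s y < L ->
    exec w L (Read x y) s [:: None] (set_reg s x (memory s (reg s y)))
| ExecWrite x y s : reg s x < L ->
    exec w L (Write x y) s [:: None] (set_mem s (reg s x) (reg s y))
| ExecReport x s :
    exec w L (Report x) s [:: Some (reg s x)] s
| ExecSeq p q s1 s2 s3 t u :
    exec w L p s1 t s2 -> exec w L q s2 u s3 ->
    exec w L (Seq p q) s1 (t ++ u) s3
| ExecIfTrue x p q s1 s2 t : reg s1 x != 0 ->
    exec w L p s1 t s2 -> exec w L (If x p q) s1 (None :: t) s2
| ExecIfFalse x p q s1 s2 t : reg s1 x = 0 ->
    exec w L q s1 t s2 -> exec w L (If x p q) s1 (None :: t) s2
| ExecWhileTrue x p s1 s2 s3 t u : reg s1 x != 0 ->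
    exec w L p s1 t s2 -> exec w L (While x p) s2 u s3 ->
    exec w L (While x p) s1 (None :: t ++ u) s3
| ExecWhileFalse x p s : reg s x = 0 ->
    exec w L (While x p) s [:: None] s.

Definition word_state (w : nat) (s : state) : Prop :=
  (forall x, reg s x < 2 ^ w) /\ (forall a, memory s a < 2 ^ w).

Definition holds (m : nat -> nat) (D : seq nat) : Prop :=
  forall a, a < size D -> m a = nth 0 D a.

Definition reports (t : trace) : seq nat := pmap id t.

(* No c.+1 consecutive steps pass without a report: this bounds the time to the
   first report, between two reports, and from the last report to halting. *)
Definition constant_delay (c : nat) (t : trace) : Prop :=
  forall t1 t2 t3, t = t1 ++ t2 ++ t3 -> all (pred1 None) t2 -> size t2 <= c.

Definition input (S : seq nat) (G : seq nat) : seq nat :=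
  [:: size S, size G & S ++ G].

(* The words D, stored from address 0 on, are a data structure for which
   [query] reports min(k, occ) distinct hits among the occ existing ones; all of
   them are obtained with k = n.  Registers 0, 1, 2 hold i, j, k; the rest of
   the memory is working space with arbitrary initial content, and D is left
   intact so that it can be queried again. *)
Definition supports (w L c : nat) (query : cmd) (S G D : seq nat) : Prop :=
  forall i j k s,
    0 < i <= j -> j <= size S -> k < 2 ^ w ->
    word_state w s -> holds (memory s) D ->
    reg s 0 = i -> reg s 1 = j -> reg s 2 = k ->
    exists t s',
      [/\ exec w L query s t s',
          holds (memory s') D,
          constant_delay c t
        & [/\ uniq (reports t), all (hit S G i j) (reports t)
            & size (reports t) =
                minn k (count (hit S G i j) (iota 1 (size S)))]].

(* Main.v *)
(* The locus of S[i..j] in the suffix array is an interval of ranks [l, r), and the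
   hits are the ranks in it whose distance to the next element of the attractor is
   less than the length of S[i..j].  They are enumerated by range minimum queries.

   The interval is found in constant time.  Unless an end of it is near the rank of
   the suffix i, where a search in the LCP array finds it, the interval contains a rank
   that is a multiple of g = polylog n, and then, if 2^h is the power of two next below
   its size, a rank u 2^h.  The suffix i' of this rank starts with S[i..j], and the
   interval changes only O(2^h / g) times by more than g as the length varies, so that
   all intervals of these suffixes, rounded to multiples of g, take O(n log n / g) words.
   The position of the length in the list of changes is bounded below through the counts
   of S[i0..e), for an end e rounded to a multiple of g and an aligned i0 >= i' shared by
   many rows: the number of matches lost by extending S[i'..] is at most the number lost
   by extending S[i0..].  The remaining errors of size polylog n are repaired by searches
   in trees of degree d = (log n)^(1/8), whose nodes are searched with table lookups.

   Only the existence of the tables matters: they can be recognized, since a program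
   can compare every answer with its definition, and so the building program tries all
   contents of O(n) words. *)

(* Finding the interval of a substring is a weighted ancestor query in the suffix tree. On arbitrary
   weighted trees such queries contain predecessor search, which admits no constant time in linear
   space; so the proof has to use a property of suffix trees, the inequality [cnt_shift] between
   lost matches, by which many rows share one table indexed by the end of the substring. The
   expressions are designed for contents that are wrong: every address read is reduced modulo [D]
   and evaluation always ends, so that any content can be tested. The same expressions serve the
   test and the query; [All], the only loop, occurs in the test alone. The content found may differ
   from the intended one, hence the query is proved correct from the passed test only. The intended
   content has a single task, to show that some content passes, so that the enumeration ends. The
   delay is constant because a range of ranks is kept only if its minimal distance shows a hit
   inside: no step of the query is wasted on an empty range. *)
Require Import Defs.
From mathcomp Require Import all_boot zify.

Set Implicit Arguments.
Unset Strict Implicit.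
Unset Printing Implicit Defensive.

(** * Expressions and their compilation *)

(* [Var i] is the i-th variable bound so far, [Fr ns e] evaluates [e] in the frame
   made of the variables [ns] only, and [Rd] reads at an address modulo [D]. *)
Inductive exp :=
| Var (i : nat)
| Cst (v : nat)
| Bop (o : binop) (e1 e2 : exp)
| Rd (e : exp)
| Ite (e1 e2 e3 : exp)
| Let (e1 e2 : exp)
| Fr (ns : seq nat) (e : exp)
| All (e1 e2 : exp).

Fixpoint eval (w D : nat) (m : nat -> nat) (vs : seq nat) (e : exp) : nat :=
  match e with
  | Var i => nth 0 vs i
  | Cst v => v %% 2 ^ w
  | Bop o e1 e2 => eval_op w o (eval w D m vs e1) (eval w D m vs e2)
  | Rd e => m (eval w D m vs e %% D)
  | Ite e1 e2 e3 =>
      if eval w D m vs e1 != 0 then eval w D m vs e2 else eval w D m vs e3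
  | Let e1 e2 => eval w D m (rcons vs (eval w D m vs e1)) e2
  | Fr ns e =>
      if all (fun i => i < size vs) ns
      then eval w D m [seq nth 0 vs i | i <- ns] e else 0
  | All e1 e2 =>
      all (fun v => eval w D m (rcons vs v) e2 != 0) (iota 0 (eval w D m vs e1))
  end.

(** Only the cells below [D] count, because [Rd] reduces its address; the stack of the query can
    therefore grow above [D] without disturbing any table. *)
Lemma eq_eval w D m m' vs e : 0 < D ->
  (forall a, a < D -> m a = m' a) -> eval w D m vs e = eval w D m' vs e.
Proof.
move=> D0 mm; elim: e vs => //=.
- by move=> o e1 IH1 e2 IH2 vs; rewrite IH1 IH2.
- by move=> e IH vs; rewrite IH mm // ltn_mod.
- by move=> e1 IH1 e2 IH2 e3 IH3 vs; rewrite IH1 IH2 IH3.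
- by move=> e1 IH1 e2 IH2 vs; rewrite IH1 IH2.
- by move=> ns e IH vs; rewrite IH.
- by move=> e1 IH1 e2 IH2 vs; rewrite IH1; congr (nat_of_bool _); apply: eq_all => v; rewrite IH2.
Qed.

Definition copy (t x : nat) : cmd := Seq (Const t 0) (Op Add t t x).

(* The value of an expression whose variables sit in the registers [rs] goes to
   register [t]; registers from [t] on are scratch, register 3 holds [D]. *)
Fixpoint comp (rs : seq nat) (t : nat) (e : exp) : cmd :=
  match e with
  | Var i => if i < size rs then copy t (nth 0 rs i) else Const t 0
  | Cst v => Const t v
  | Bop o e1 e2 => Seq (comp rs t e1) (Seq (comp rs t.+1 e2) (Op o t t t.+1))
  | Rd e => Seq (comp rs t e) (Seq (Op Mod t t 3) (Read t t))
  | Ite e1 e2 e3 => Seq (comp rs t e1) (If t (comp rs t e2) (comp rs t e3))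
  | Let e1 e2 =>
      Seq (comp rs t e1) (Seq (comp (rcons rs t) t.+1 e2) (copy t t.+1))
  | Fr ns e =>
      if all (fun i => i < size rs) ns
      then comp [seq nth 0 rs i | i <- ns] t e else Const t 0
  | All e1 e2 =>
      Seq (comp rs t e1) (Seq (Const t.+1 0) (Seq (Op Lt t.+2 t.+1 t) (Seq
        (While t.+2 (Seq (comp (rcons rs t.+1) t.+3 e2)
           (If t.+3 (Seq (Const t.+3 1) (Seq (Op Add t.+1 t.+1 t.+3)
                      (Op Lt t.+2 t.+1 t)))
                    (Const t.+2 0))))
        (Op Eq t t.+1 t))))
  end.

(** These expressions compile to code without loops, whose running time is bounded by [steps] of the
    code; [All] alone needs a [While]. *)
Fixpoint flat (e : exp) : bool :=
  match e with
  | Var _ | Cst _ => true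
  | Bop _ e1 e2 | Let e1 e2 => flat e1 && flat e2
  | Rd e | Fr _ e => flat e
  | Ite e1 e2 e3 => [&& flat e1, flat e2 & flat e3]
  | All _ _ => false
  end.

Definition silent (t : trace) : bool := all (pred1 None) t.

Lemma silent_cat t u : silent (t ++ u) = silent t && silent u.
Proof. exact: all_cat. Qed.

Fixpoint straight (p : cmd) : bool :=
  match p with
  | Seq p q | If _ p q => straight p && straight q
  | Report _ | While _ _ => false
  | _ => true
  end.

Fixpoint steps (p : cmd) : nat :=
  match p with
  | Seq p q | If _ p q => (steps p + steps q).+1
  | _ => 1
  end.

Lemma straight_exec w L p s t s' : exec w L p s t s' -> straight p -> silent t /\ size t <= steps p.
Proof.
elim=> //= {p s t s'}.
- move=> p q s1 s2 s3 t u _ IH1 _ IH2 /andP[/IH1[h1 h2] /IH2[h3 h4]].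
  by rewrite silent_cat h1 size_cat leqW ?leq_add.
- by move=> x p q s1 s2 t _ _ IH /andP[/IH[h1 h2] _]; rewrite ltnS (leq_trans h2) ?leq_addr.
- by move=> x p q s1 s2 t _ _ IH /andP[_ /IH[h1 h2]]; rewrite ltnS (leq_trans h2) ?leq_addl.
Qed.

Arguments steps : simpl never.

Lemma straight_comp e rs t : flat e -> straight (comp rs t e).
Proof.
elim: e rs t => //=.
- by move=> i rs t _; case: ifP.
- by move=> o e1 IH1 e2 IH2 rs t /andP[/IH1 -> /IH2 ->].
- by move=> e IH rs t /IH ->.
- by move=> e1 IH1 e2 IH2 e3 IH3 rs t /and3P[/IH1 -> /IH2 -> /IH3 ->].
- by move=> e1 IH1 e2 IH2 rs t /andP[/IH1 -> /IH2 ->].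
- by move=> ns e IH rs t /IH h; case: ifP.
Qed.

Definition runs w L p s s' := exists tr, exec w L p s tr s'.

Section Runs.
Variables (w L : nat).
Notation runs := (runs w L).

Lemma runs_seq p q s1 s2 s3 : runs p s1 s2 -> runs q s2 s3 -> runs (Seq p q) s1 s3.
Proof. by move=> [t1 h1] [t2 h2]; exists (t1 ++ t2); apply: ExecSeq h1 h2. Qed.

Lemma runs_const x v s : v < 2 ^ w -> runs (Const x v) s (set_reg s x v).
Proof. by move=> h; exists [:: None]; rewrite -{2}(modn_small h); apply: ExecConst. Qed.

Lemma runs_op o x y z s v : eval_op w o (reg s y) (reg s z) = v -> runs (Op o x y z) s (set_reg s x v).
Proof. by move=> <-; exists [:: None]; apply: ExecOp. Qed.

Lemma runs_read x y s a v : reg s y = a -> a < L -> memory s a = v -> runs (Read x y) s (set_reg s x v).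
Proof. by move=> <- h <-; exists [:: None]; apply: ExecRead. Qed.

Lemma runs_write x y s a v : reg s x = a -> a < L -> reg s y = v -> runs (Write x y) s (set_mem s a v).
Proof. by move=> <- h <-; exists [:: None]; apply: ExecWrite. Qed.

Lemma runs_while x p s1 s2 s3 : reg s1 x != 0 -> runs p s1 s2 -> runs (While x p) s2 s3 ->
  runs (While x p) s1 s3.
Proof. by move=> h [t1 h1] [t2 h2]; exists (None :: t1 ++ t2); apply: ExecWhileTrue h1 h2. Qed.

Lemma runs_while0 x p s : reg s x = 0 -> runs (While x p) s s.
Proof. by move=> h; exists [:: None]; apply: ExecWhileFalse. Qed.
Lemma runs_if x p q s s' : reg s x != 0 -> runs p s s' -> runs (If x p q) s s'.
Proof. by move=> h [t e]; exists (None :: t); apply: ExecIfTrue. Qed.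

Lemma runs_if0 x p q s s' : reg s x = 0 -> runs q s s' -> runs (If x p q) s s'.
Proof. by move=> h [t e]; exists (None :: t); apply: ExecIfFalse. Qed.
End Runs.

Section Comp.
Variables (w L D : nat).
Hypotheses (D0 : 0 < D) (DL : D <= L) (Dw : D < 2 ^ w).

Lemma reg_set s x v y : reg (set_reg s x v) y = if y == x then v else reg s y.
Proof. by []. Qed.

Lemma memory_set_reg s x v : memory (set_reg s x v) = memory s.
Proof. by []. Qed.

Lemma eval_op_lt o y z : eval_op w o y z < 2 ^ w.
Proof. by rewrite /eval_op ltn_mod expn_gt0. Qed.

Lemma word_set_reg s x v : word_state w s -> v < 2 ^ w -> word_state w (set_reg s x v).
Proof. by case=> H1 H2 Hv; split=> // y; rewrite reg_set; case: eqP. Qed.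

Lemma word_set_mem s a v : word_state w s -> v < 2 ^ w -> word_state w (set_mem s a v).
Proof. by case=> H1 H2 Hv; split=> // y /=; case: eqP. Qed.

Definition keeps t (s s' : state) :=
  [/\ memory s' = memory s, (forall x, x < t -> reg s' x = reg s x) & word_state w s'].

Lemma keeps_trans t t' s1 s2 s3 :
  t <= t' -> keeps t s1 s2 -> keeps t' s2 s3 -> keeps t s1 s3.
Proof.
move=> le [m1 r1 w1] [m2 r2 w2]; split; rewrite ?m2 //.
by move=> x xt; rewrite r2 ?r1 //; apply: leq_trans le.
Qed.

Lemma keeps_set t x v s : word_state w s -> v < 2 ^ w -> t <= x -> keeps t s (set_reg s x v).
Proof.
move=> ws vw tx; split=> //; last exact: word_set_reg.
by move=> y yt; rewrite reg_set; case: eqP => // yx; move: (leq_trans yt tx); rewrite yx ltnn.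
Qed.

Lemma copy_ok t x s : word_state w s -> x != t ->
  exists s', [/\ runs w L (copy t x) s s', reg s' t = reg s x & keeps t s s'].
Proof.
move=> ws xt; eexists; split.
- by exists ([:: None] ++ [:: None]); apply: ExecSeq; [exact: ExecConst | exact: ExecOp].
- rewrite reg_set eqxx /eval_op !reg_set eqxx (negbTE xt) mod0n add0n modn_small //.
  by case: ws.
- apply: (@keeps_trans t t _ (set_reg s t (0 %% 2 ^ w))) => //.
    by apply: keeps_set; rewrite ?ltn_mod ?expn_gt0.
  apply: keeps_set => //; last exact: eval_op_lt.
  by apply: word_set_reg; rewrite ?ltn_mod ?expn_gt0.
Qed.

Lemma map_keeps t s s' rs : all (gtn t) rs -> keeps t s s' ->
  map (reg s') rs = map (reg s) rs.
Proof. by move=> /allP rt [_ k _]; apply/eq_in_map => x /rt; apply: k. Qed.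

Lemma nth_reg s rs i : i < size rs -> nth 0 (map (reg s) rs) i = reg s (nth 0 rs i).
Proof. by move=> ?; rewrite (nth_map 0). Qed.

Definition computes (p : cmd) (t : nat) (s : state) (v : nat) :=
  exists s', [/\ runs w L p s s', reg s' t = v & keeps t s s'].

Lemma all_gtn_leq t t' rs : t <= t' -> all (gtn t) rs -> all (gtn t') rs.
Proof. by move=> le; apply: sub_all => x /= xt; apply: leq_trans le. Qed.

Lemma computes_const t s v : word_state w s -> computes (Const t v) t s (v %% 2 ^ w).
Proof.
move=> ws; exists (set_reg s t (v %% 2 ^ w)); split; rewrite ?reg_set ?eqxx //.
  by exists [:: None]; apply: ExecConst.
by apply: keeps_set; rewrite ?ltn_mod ?expn_gt0.
Qed.

Lemma comp_ok e : forall rs t s, 3 < t -> all (gtn t) rs -> word_state w s -> reg s 3 = D ->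
  computes (comp rs t e) t s (eval w D (memory s) (map (reg s) rs) e).
Proof.
elim: e.
- move=> i rs t s t3 rt ws s3 /=; case: ltnP => ir.
    have /(copy_ok ws)[s' [H1 H2 H3]] : nth 0 rs i != t.
      by rewrite ltn_eqF //; apply: (allP rt); apply: mem_nth.
    by exists s'; split; rewrite // nth_reg.
  rewrite [nth _ _ _]nth_default ?size_map //.
  by have := @computes_const t s 0 ws; rewrite mod0n.
- by move=> v rs t s t3 rt ws s3 /=; apply: computes_const.
- move=> o e1 IH1 e2 IH2 rs t s t3 rt ws s3 /=.
  have [s1 [E1 V1 K1]] := IH1 rs t s t3 rt ws s3.
  have [m1 r1 w1] := K1.
  have rt' := all_gtn_leq (leqnSn t) rt.
  have [||s2 [E2 V2 K2]] := IH2 rs t.+1 s1 _ rt' w1; rewrite ?r1 //; first lia.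
  rewrite m1 (map_keeps rt K1) in V2.
  exists (set_reg s2 t (eval_op w o (reg s2 t) (reg s2 t.+1))); split.
  + by apply: runs_seq E1 (runs_seq E2 _); apply: runs_op.
  + by rewrite reg_set eqxx V2; case: K2 => _ -> //; rewrite V1.
  + apply: (keeps_trans (leqnn t)) (K1) _.
    apply: (@keeps_trans t t _ s2) => //; last by apply: keeps_set; rewrite ?eval_op_lt //; case: K2.
    by case: K2 => ? H ?; split=> // x xt; apply: H; lia.
- move=> e IH rs t s t3 rt ws s3 /=.
  have [s1 [E1 V1 K1]] := IH rs t s t3 rt ws s3.
  have [m1 r1 w1] := K1.
  set v := (eval_op w Mod (reg s1 t) (reg s1 3)).
  have vE : v = reg s1 t %% D.
    rewrite /v /eval_op (r1 3) // s3 [LHS]modn_small //.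
    by apply: (@leq_trans D); rewrite ?ltn_mod // ltnW.
  have vD : v < D by rewrite vE ltn_mod.
  exists (set_reg (set_reg s1 t v) t (memory s (v))); split.
  + apply: runs_seq E1 (runs_seq (_ : runs _ _ _ _ (set_reg s1 t v)) _); first exact: runs_op.
    by apply: (@runs_read _ _ _ _ _ v); rewrite ?reg_set ?eqxx ?memory_set_reg ?m1 //; apply: leq_trans DL.
  + by rewrite reg_set eqxx vE V1.
  + apply: (keeps_trans (leqnn t)) (K1) _.
    apply: (@keeps_trans t t _ (set_reg s1 t v)) => //; apply: keeps_set => //.
    * exact: eval_op_lt.
    * by apply: word_set_reg => //; apply: eval_op_lt.
    * by case: ws.
- move=> e1 IH1 e2 IH2 e3 IH3 rs t s t3 rt ws s3 /=.
  have [s1 [E1 V1 K1]] := IH1 rs t s t3 rt ws s3.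
  have [m1 r1 w1] := K1.
  case: eqP => V.
  + have [||s2 [E2 V2 K2]] := IH3 rs t s1 _ rt w1; rewrite ?r1 //.
    rewrite m1 (map_keeps rt K1) in V2.
    exists s2; split=> //.
    * by apply: runs_seq E1 _; apply: runs_if0 E2; rewrite V1.
    * exact: (keeps_trans (leqnn t)) K1 K2.
  + have [||s2 [E2 V2 K2]] := IH2 rs t s1 _ rt w1; rewrite ?r1 //.
    rewrite m1 (map_keeps rt K1) in V2.
    exists s2; split=> //.
    * by apply: runs_seq E1 _; apply: runs_if E2; rewrite V1; apply/eqP.
    * exact: (keeps_trans (leqnn t)) K1 K2.
- move=> e1 IH1 e2 IH2 rs t s t3 rt ws s3 /=.
  have [s1 [E1 V1 K1]] := IH1 rs t s t3 rt ws s3.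
  have [m1 r1 w1] := K1.
  have rt' : all (gtn t.+1) (rcons rs t) by rewrite all_rcons /= ltnSn (all_gtn_leq _ rt).
  have [||s2 [E2 V2 K2]] := IH2 (rcons rs t) t.+1 s1 _ rt' w1; rewrite ?r1 //; first lia.
  rewrite m1 map_rcons V1 (map_keeps rt K1) in V2.
  have [m2 r2 w2] := K2.
  have [|s' [E3 V3 K3]] := @copy_ok t t.+1 s2 w2; first by apply/eqP; lia.
  exists s'; split.
  + exact: runs_seq E1 (runs_seq E2 E3).
  + by rewrite V3 V2.
  + apply: (keeps_trans (leqnn t)) (K1) _.
    apply: (keeps_trans (leqnn t)) _ (K3).
    by split=> // x xt; apply: r2; lia.
- move=> ns e IH rs t s t3 rt ws s3 /=.
  rewrite size_map; case: ifP => Hns; last first.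
    by have := @computes_const t s 0 ws; rewrite mod0n.
  have rt' : all (gtn t) [seq nth 0 rs i | i <- ns].
    apply/allP => x /mapP[i /(allP Hns) ir ->]; apply: (allP rt); exact: mem_nth.
  have [s1 [E1 V1 K1]] := IH _ t s t3 rt' ws s3.
  exists s1; split=> //.
  rewrite V1; congr eval; rewrite -map_comp; apply/eq_in_map => i /(allP Hns) ir /=.
  by rewrite nth_reg.
- move=> e1 IH1 e2 IH2 rs t s t3 rt ws s3 /=.
  have [s1 [E1 V1 K1]] := IH1 rs t s t3 rt ws s3.
  have [m1 r1 w1] := K1.
  set N := eval w D (memory s) (map (reg s) rs) e1 in V1 *.
  have Nw : N < 2 ^ w by rewrite -V1; case: w1.
  set body := Seq (comp (rcons _ _) _ _) _.
  pose P v := eval w D (memory s) (rcons (map (reg s) rs) v) e2 != 0.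
  have w0 : 1 < 2 ^ w by lia.
  have bw (b : bool) : (b : nat) %% 2 ^ w = b by rewrite modn_small //; case: b; lia.
  (* The loop ends at the first counterexample, with its index left in register [t.+1], or with this
     register equal to [N]; comparing it with [N] gives the truth value. *)
  have loop j : forall v s2, v + j = N -> all P (iota 0 v) -> keeps t s s2 -> reg s2 t = N ->
      reg s2 t.+1 = v -> reg s2 t.+2 = (v < N) ->
      exists s3, [/\ runs w L (While t.+2 body) s2 s3, keeps t s s3, reg s3 t = N
        & (reg s3 t.+1 == N) = all P (iota 0 N)].
    elim: j => [|j IHj] v s2.
      rewrite addn0 => <- aP k2 r20 r21 r22.
      exists s2; split=> //; rewrite ?r21 //; last by rewrite eqxx aP.
      by apply: runs_while0; rewrite r22 ltnn.
    move=> vj aP k2 r20 r21 r22.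
    have rt' : all (gtn t.+3) (rcons rs t.+1).
      by rewrite all_rcons /= ltnW //; apply: all_gtn_leq rt; lia.
    have w2 : word_state w s2 by case: k2.
    have [||s4 [E3 V3 K3]] := IH2 (rcons rs t.+1) t.+3 s2 _ rt' w2.
      by lia.
      by case: k2 => _ ->.
    have mm2 : memory s2 = memory s by case: k2.
    have [mm3 rr3 w4] := K3.
    rewrite map_rcons r21 (map_keeps rt k2) mm2 in V3.
    have k4 : keeps t s s4.
      apply: (keeps_trans (leqnn t) k2); split=> // x xt; apply: rr3; lia.
    have vN : v < N by lia.
    case Pv: (P v); last first.
      move: Pv; rewrite /P -V3 => /negbFE/eqP V30.
      exists (set_reg s4 t.+2 (0 %% 2 ^ w)); split.
      + apply: (@runs_while _ _ _ _ _ (set_reg s4 t.+2 (0 %% 2 ^ w))); first by rewrite r22 vN.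
          by apply: runs_seq E3 _; apply: runs_if0 => //; exists [:: None]; apply: ExecConst.
        by apply: runs_while0; rewrite reg_set eqxx mod0n.
      + apply: (keeps_trans (leqnn t) k4); apply: keeps_set => //; first by rewrite mod0n; lia.
        by lia.
      + by rewrite reg_set (_ : t == t.+2 = false) ?rr3 //; lia.
      + rewrite reg_set (_ : t.+1 == t.+2 = false) ?rr3 ?r21 //; last by lia.
        rewrite (_ : v == N = false); last by lia.
        apply/esym/negbTE/negP => /allP /(_ v); rewrite mem_iota /= add0n vN /P -V3 V30.
        by move=> /(_ isT).
    have V31 : reg s4 t.+3 != 0 by rewrite V3.
    set s5 := set_reg s4 t.+3 (1 %% 2 ^ w).
    set s6 := set_reg s5 t.+1 (eval_op w Add (reg s5 t.+1) (reg s5 t.+3)).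
    set s7 := set_reg s6 t.+2 (eval_op w Lt (reg s6 t.+1) (reg s6 t)).
    have s61 : reg s6 t.+1 = v.+1.
      rewrite /s6 reg_set eqxx /s5 !reg_set eqxx (_ : t.+1 == t.+3 = false); last by lia.
      by rewrite rr3 // r21 /eval_op (modn_small w0) addn1 modn_small //; lia.
    have s60 : reg s6 t = N.
      rewrite /s6 /s5 !reg_set (_ : t == t.+1 = false); last by lia.
      by rewrite (_ : t == t.+3 = false) ?rr3 //; lia.
    have k7 : keeps t s s7.
      apply: (keeps_trans (leqnn t) k4).
      apply: (@keeps_trans t t _ s6) => //; last first.
        apply: keeps_set; rewrite ?eval_op_lt //; last by lia.
        by apply: word_set_reg; rewrite ?eval_op_lt //; apply: word_set_reg => //; lia.
      apply: (@keeps_trans t t _ s5) => //; apply: keeps_set; rewrite ?eval_op_lt //; try lia.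
      by apply: word_set_reg => //; lia.
    have [|||||s8 [E8 K8 r80 r82]] := IHj v.+1 s7 _ _ k7.
    + by lia.
    + by rewrite -addn1 iotaD all_cat aP /= add0n Pv.
    + by rewrite /s7 reg_set (_ : t == t.+2 = false) ?s60 //; lia.
    + by rewrite /s7 reg_set (_ : t.+1 == t.+2 = false) ?s61 //; lia.
    + by rewrite /s7 reg_set eqxx s60 s61 /eval_op bw.
    exists s8; split=> //.
    apply: runs_while E8; first by rewrite r22 vN.
    apply: runs_seq E3 _; apply: runs_if => //.
    apply: runs_seq (_ : runs _ _ _ _ s5) _; first by exists [:: None]; apply: ExecConst.
    by apply: runs_seq (_ : runs _ _ _ _ s6) _; apply: runs_op.
  set s2 := set_reg s1 t.+1 (0 %% 2 ^ w).
  set s4 := set_reg s2 t.+2 (eval_op w Lt (reg s2 t.+1) (reg s2 t)).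
  have s20 : reg s2 t = N by rewrite /s2 reg_set (_ : t == t.+1 = false) ?V1 //; lia.
  have s21 : reg s2 t.+1 = 0 by rewrite /s2 reg_set eqxx mod0n.
  have ww2 : word_state w s2 by apply: word_set_reg => //; rewrite mod0n; lia.
  have k4 : keeps t s s4.
    apply: (keeps_trans (leqnn t) K1).
    apply: (@keeps_trans t t _ s2) => //; apply: keeps_set; rewrite ?eval_op_lt ?mod0n //; lia.
  have [|||||s8 [E8 K8 r80 r82]] := loop N 0 s4 _ _ k4 => //.
  + by rewrite /s4 reg_set (_ : t == t.+2 = false) ?s20 //; lia.
  + by rewrite /s4 reg_set (_ : t.+1 == t.+2 = false) ?s21 //; lia.
  + by rewrite /s4 reg_set eqxx s20 s21 /eval_op bw.
  exists (set_reg s8 t (eval_op w Eq (reg s8 t.+1) (reg s8 t))); split=> //.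
  + apply: runs_seq E1 (runs_seq (_ : runs _ _ _ _ s2) _); first by exists [:: None]; apply: ExecConst.
    apply: runs_seq (_ : runs _ _ _ _ s4) _; first exact: runs_op.
    by apply: runs_seq E8 _; apply: runs_op.
  + by rewrite reg_set eqxx r80 /eval_op r82 bw.
  + by apply: (keeps_trans (leqnn t) K8); apply: keeps_set; rewrite ?eval_op_lt //; case: K8.
Qed.

End Comp.

(** * Searching an array with a tree of small degree *)

Lemma find_firstP (P : pred nat) n q : q <= n -> (q < n -> P q) ->
  (forall q', q' < q -> ~~ P q') -> find P (iota 0 n) = q.
Proof.
move=> qn Pq H.
have hs : has P (iota q (n - q)) -> find P (iota q (n - q)) = 0.
  case E : (n - q) => [|r] //= _; rewrite Pq //; lia.
have -> : iota 0 n = iota 0 q ++ iota q (n - q) by rewrite -{1}(subnKC qn) iotaD add0n.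
rewrite find_cat size_iota (_ : has P (iota 0 q) = false); last first.
  by apply/hasPn => x; rewrite mem_iota => /H.
case: (ltnP q n) => h; last by rewrite (_ : n - q = 0) ?addn0 //; lia.
rewrite hs ?addn0 //; apply/hasP; exists q; last exact: Pq.
by rewrite mem_iota; lia.
Qed.

Lemma find_iota_le (P : pred nat) n : find P (iota 0 n) <= n.
Proof. by rewrite -[leqRHS](size_iota 0) find_size. Qed.

Lemma find_iotaT (P : pred nat) n : find P (iota 0 n) < n -> P (find P (iota 0 n)).
Proof.
move=> h; have := @nth_find _ 0 P (iota 0 n); rewrite has_find size_iota => /(_ h).
by rewrite nth_iota.
Qed.

Lemma find_iotaF (P : pred nat) n q : q < find P (iota 0 n) -> ~~ P q.
Proof.
move=> h; have := @before_find _ 0 P (iota 0 n) q h; rewrite nth_iota ?add0n => [->//|].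
exact: leq_trans (find_iota_le P n).
Qed.

Section Next.
Variables (V : nat -> nat -> nat) (d l : nat).
Hypothesis d0 : 0 < d.
Hypothesis V_tree : forall lev b,
  (V lev.+1 b < l) = has (fun j => V lev (b * d + j) < l) (iota 0 d).

(* [V lev] is level [lev] of a tree of degree [d] of block minima over [V 0]. *)
Definition fb lev b y := find (fun j => (y <= j) && (V lev (b * d + j) < l)) (iota 0 d).

(* Climbs at most [f] levels; beyond this horizon the answer is a lower bound. *)
Fixpoint nx f lev pos :=
  if f is f'.+1 then
    let r := fb lev (pos %/ d) (pos %% d) in
    if r < d then pos %/ d * d + r
    else let b := nx f' lev.+1 (pos %/ d).+1 in b * d + fb lev b 0
  else pos.

Definition is_first lev pos q :=
  [/\ pos <= q, V lev q < l & forall q', pos <= q' < q -> l <= V lev q'].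

(** If the answer is not among the remaining entries of the block of [pos], it is in the first later
    block whose minimum is below [l]; this block is found one level up, with a horizon [d] times
    smaller. *)
Lemma nx_spec f : forall lev pos q, is_first lev pos q ->
  pos <= nx f lev pos <= q /\ (q < pos + d ^ f -> nx f lev pos = q).
Proof.
elim: f => [|f IH] lev pos q [pq Vq Hq] /=; first by rewrite expn0; split; lia.
set u := pos %/ d; set v := pos %% d.
have posE : pos = u * d + v by rewrite /u /v -divn_eq.
have vd : v < d by rewrite ltn_mod.
have fbP b y j : y <= j -> j < d -> V lev (b * d + j) < l ->
    (forall j', y <= j' < j -> l <= V lev (b * d + j')) -> fb lev b y = j.
  move=> yj jd Vj Hj; apply: find_firstP; [exact: ltnW | by rewrite yj | ].
  move=> q' q'j; rewrite negb_and -leqNgt -ltnNge.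
  by case: (ltnP q' y) => //= yq; apply: Hj; rewrite yq.
case: (ltnP q (u * d + d)) => qu.
  have -> : fb lev u v = q - u * d.
    apply: fbP; rewrite ?subnKC //; try lia.
    by move=> j' j'q; apply: Hq; lia.
  rewrite (_ : q - u * d < d); last by lia.
  rewrite subnKC; lia.
have fbn : fb lev u v = d.
  apply: find_firstP; rewrite ?ltnn // => j jd; rewrite negb_and -leqNgt -ltnNge.
  case: (ltnP j v) => //= vj; apply: Hq; lia.
rewrite fbn ltnn.
set s := q %/ d; set r := q %% d.
have qE : q = s * d + r by rewrite /s /r -divn_eq.
have rd : r < d by rewrite ltn_mod.
have us : u < s by rewrite -(ltn_pmul2r d0); lia.
have fs : is_first lev.+1 u.+1 s.
  split=> //.
    by rewrite V_tree; apply/hasP; exists r; rewrite ?mem_iota // -qE.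
  move=> s' /andP[us' s's]; rewrite leqNgt V_tree; apply/hasPn => j.
  rewrite mem_iota /= add0n -leqNgt => jd; apply: Hq.
  have : u.+1 * d <= s' * d by rewrite leq_mul2r us' orbT.
  have : s'.+1 * d <= s * d by rewrite leq_mul2r s's orbT.
  by rewrite !mulSn; lia.
have [/andP[b1 b2] b3] := IH _ _ _ fs.
set b := nx f lev.+1 u.+1 in b1 b2 b3 *.
have ub : u.+1 * d <= b * d by rewrite leq_mul2r b1 orbT.
(* An upper answer [b] that is only a lower bound names a block without a value below [l]: [fb] then
   returns [d], and the result is the start of the next block, still at most [q]. *)
case: (ltnP b s) => bs.
  have fb0 : fb lev b 0 = d.
    apply: find_firstP; rewrite ?ltnn // => j jd; rewrite -leqNgt.
    apply: Hq; move: ub; rewrite mulSn.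
    have : b.+1 * d <= s * d by rewrite leq_mul2r bs orbT.
    by rewrite mulSn; lia.
  have bs' : b.+1 * d <= s * d by rewrite leq_mul2r bs orbT.
  rewrite fb0; split; first by move: ub bs'; rewrite !mulSn; lia.
  move=> qw; have : b = s; last by lia.
  apply: b3; rewrite -(ltn_pmul2r d0) mulnDl -expnSr; rewrite mulSn; lia.
have bE : b = s by lia.
rewrite bE; have -> : fb lev s 0 = r.
  apply: fbP => //; rewrite -?qE // => j' j'r; apply: Hq.
  have : u.+1 * d <= s * d by rewrite leq_mul2r us orbT.
  by rewrite mulSn; lia.
by rewrite -qE; split=> //; rewrite pq leqnn.
Qed.

End Next.

(** * Longest common prefixes of binary numbers *)

Lemma ltn_div_ltn p a b : a %/ 2 ^ p < b %/ 2 ^ p -> a < b.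
Proof. by move=> h; rewrite ltnNge; apply/negP => /(leq_div2r (2 ^ p)); lia. Qed.

Lemma div2S a p : a %/ 2 ^ p = (a %/ 2 ^ p.+1).*2 + odd (a %/ 2 ^ p).
Proof. by rewrite expnSr divnMA divn2 addnC odd_double_half. Qed.

Section Lev.
Variable W : nat.

(* The number of low bits to drop before [a] and [b] agree. *)
Definition lev a b := find (fun p => a %/ 2 ^ p == b %/ 2 ^ p) (iota 0 W).

Lemma lev_le a b : lev a b <= W.
Proof. exact: find_iota_le. Qed.

Lemma leq_lev a b p : a < 2 ^ W -> b < 2 ^ W ->
  (lev a b <= p) = (a %/ 2 ^ p == b %/ 2 ^ p).
Proof.
move=> aW bW; apply/idP/eqP => [|E].
  have lE : a %/ 2 ^ lev a b = b %/ 2 ^ lev a b.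
    have := lev_le a b; rewrite leq_eqVlt => /orP[/eqP ->|]; first by rewrite !divn_small.
    by move/find_iotaT/eqP.
  by move=> h; rewrite -(subnKC h) expnD !divnMA lE.
by rewrite leqNgt; apply/negP => /find_iotaF; rewrite E eqxx.
Qed.

Lemma levC a b : lev a b = lev b a.
Proof. by apply: eq_find => p; rewrite eq_sym. Qed.

Lemma lev_gt0 a b : a < 2 ^ W -> b < 2 ^ W -> a != b -> 0 < lev a b.
Proof. by move=> aW bW; rewrite ltnNge leq_lev // expn0 !divn1. Qed.

(** The highest of the dropped bits is the first in which the two numbers differ, and it decides
    their order. *)
Lemma bit_lev a b : a < 2 ^ W -> b < 2 ^ W -> a != b ->
  odd (a %/ 2 ^ (lev a b).-1) = (b < a).
Proof.
move=> aW bW ab; have l0 := lev_gt0 aW bW ab.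
have E : a %/ 2 ^ lev a b = b %/ 2 ^ lev a b by apply/eqP; rewrite -leq_lev.
have : a %/ 2 ^ (lev a b).-1 != b %/ 2 ^ (lev a b).-1 by rewrite -leq_lev // -ltnNge prednK.
have := div2S a (lev a b).-1; have := div2S b (lev a b).-1.
have lt1 := @ltn_div_ltn (lev a b).-1 a b; have lt2 := @ltn_div_ltn (lev a b).-1 b a.
by rewrite !prednK // E; do 2 case: odd => /=; lia.
Qed.

End Lev.

(** * Searching a block of few words by table lookup *)

Definition enc (X : finType) (x : X) : nat := enum_rank x.
Definition dec (X : finType) (x0 : X) (c : nat) : X := nth x0 (enum X) c.

Lemma encK (X : finType) (x0 x : X) : dec x0 (enc x) = x.
Proof. by rewrite /dec /enc nth_enum_rank. Qed.

Lemma enc_lt (X : finType) (x : X) : enc x < #|X|.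
Proof. exact: ltn_ord. Qed.

(** Tables with several arguments are indexed in mixed radix; these equations recover the digits of
    an index. *)
Lemma mxE a b c : b < c -> ((a * c + b) %/ c = a) * ((a * c + b) %% c = b).
Proof. by move=> bc; rewrite divnMDl ?modnMDl ?divn_small ?modn_small ?addn0 //; lia. Qed.

Lemma mx_lt a b A B : a < A -> b < B -> a * B + b < A * B.
Proof.
move=> aA bB; apply: (@leq_trans (a.+1 * B)); last by rewrite leq_mul2r aA orbT.
by rewrite mulSn addnC ltn_add2r.
Qed.

Lemma find_ord n (P : pred nat) : find P (iota 0 n) = find (fun j : 'I_n => P j) (enum 'I_n).
Proof. by rewrite -val_enum_ord find_map. Qed.

Section Flat.
Variables (d be : nat).
Hypothesis d0 : 0 < d.

(* As in a fusion tree: the trie of the d values [y j] < 2^W branches at no more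
   than d^2 bits.  Those bits of x, found in its two halves with the table [px],
   lead blindly ([u1]) to a value [y a] having a longest common prefix with x, and
   [u2] reads the answer off the levels at which the other values leave [y a].
   Finite objects are stored as their ranks [enc]. *)
Definition W := be.*2.
Definition B := 2 ^ be.
Definition PosT : finType := {ffun 'I_d * 'I_d -> 'I_be.+1}.
Definition BitT : finType := {ffun 'I_d * 'I_d -> bool}.
Definition LevT : finType := {ffun 'I_d -> 'I_W.+1 * bool}.
Definition pos0 : PosT := [ffun=> ord0].
Definition bit0 : BitT := [ffun=> false].
Definition lev0 : LevT := [ffun=> (ord0, false)].
Definition Sg := #|BitT|.

(** The position [be], one past the bits of a half, marks a bit that lies in the other half and
    yields false; hence the disjunction of the sketches of both halves gives all the bits. *)
Definition px c : nat :=
  let f := dec pos0 (c %/ B) in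
  enc ([ffun ij => (f ij < be) && odd (c %% B %/ 2 ^ f ij)] : BitT).
Definition lvt c := lev be (c %/ B) (c %% B).
(** [o (a, j) || o (j, a)] says that [y a] and [y j] differ, and [o (a, j)] is then the bit of [y a]
    where they branch: x agrees with [y a] at every branching on the path of [y a]. *)
Definition blind (o s1 s2 : BitT) (a : 'I_d) :=
  [forall j, (o (a, j) || o (j, a)) ==> ((s1 (a, j) || s2 (a, j)) == o (a, j))].
Definition u1 c : nat :=
  let o := dec bit0 (c %/ Sg %/ Sg) in
  let s1 := dec bit0 (c %/ Sg %% Sg) in
  let s2 := dec bit0 (c %% Sg) in
  if [pick a | blind o s1 s2 a] is Some a then a else 0.
(** For each value, [q] gives the level at which it leaves [y a] and whether it is smaller than
    [y a]; [P] is the level at which x leaves [y a]. A value leaving above [P] compares with x as it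
    does with [y a]; any other lies on the same side of x as [y a]. *)
Definition u2 c :=
  let q := dec lev0 (c %/ d %/ 2 %/ W.+1) in
  let P := c %/ d %/ 2 %% W.+1 in
  let dir := odd (c %/ d) in
  find (fun j : 'I_d => (c %% d <= j) && (if P < (q j).1 then (q j).2 else dir)) (enum 'I_d).

Variable y : nat -> nat.

Definition branch i j := (lev W (y i) (y j)).-1.
Definition cc1 := enc ([ffun ij : 'I_d * 'I_d =>
  inord (if be <= branch ij.1 ij.2 then branch ij.1 ij.2 - be else be)] : PosT).
Definition cc2 := enc ([ffun ij : 'I_d * 'I_d =>
  inord (if branch ij.1 ij.2 < be then branch ij.1 ij.2 else be)] : PosT).
Definition occ := enc ([ffun ij : 'I_d * 'I_d => y ij.2 < y ij.1] : BitT).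
Definition qcc a := enc ([ffun j : 'I_d => (inord (lev W (y a) (y j)), y j < y a)] : LevT).

Definition fsk1 x := px (cc1 * B + x %/ B).
Definition fsk2 x := px (cc2 * B + x %% B).
Definition fa x := u1 ((occ * Sg + fsk1 x) * Sg + fsk2 x).
Definition flv x z := if x %/ B == z %/ B then lvt (x %% B * B + z %% B)
                      else be + lvt (x %/ B * B + z %/ B).
Definition ff x y0 :=
  u2 (((qcc (fa x) * W.+1 + flv x (y (fa x))) * 2 + (y (fa x) < x)) * d + y0).

Lemma B0 : 0 < B. Proof. by rewrite expn_gt0. Qed.

Lemma WB : 2 ^ W = B * B.
Proof. by rewrite /W /B -expnD addnn. Qed.

Lemma hi_lt x : x < 2 ^ W -> x %/ B < B.
Proof. by rewrite WB => h; rewrite ltn_divLR // B0. Qed.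

Lemma fa_lt x : fa x < d.
Proof. by rewrite /fa /u1; case: pickP => [a _|_]; rewrite ?ltn_ord. Qed.

Lemma flvE x z : x < 2 ^ W -> z < 2 ^ W -> flv x z = lev W x z.
Proof.
move=> xW zW; have [hx hz] := (hi_lt xW, hi_lt zW).
have [lx lz] : x %% B < B /\ z %% B < B by rewrite !ltn_mod B0.
apply/eqP; rewrite eqn_leq; apply/andP.
have split v p : v %/ 2 ^ (be + p) = v %/ B %/ 2 ^ p by rewrite expnD divnMA.
have splitl v p : p <= be -> v %/ 2 ^ p = v %/ B * 2 ^ (be - p) + v %% B %/ 2 ^ p.
  move=> pb; have {1}-> : v = v %/ B * 2 ^ (be - p) * 2 ^ p + v %% B.
    by rewrite -mulnA -expnD subnK // -divn_eq.
  by rewrite divnMDl // expn_gt0.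
rewrite /flv /lvt; case: eqP => E; rewrite !mxE //.
- have lb := lev_le be (x %% B) (z %% B).
  split.
    have [h|h] := leqP (lev W x z) be; last by apply: leq_trans lb (ltnW h).
    rewrite leq_lev // -(eqn_add2l (x %/ B * 2 ^ (be - lev W x z))) -splitl // E -splitl //.
    by rewrite -(@leq_lev W).
  by rewrite leq_lev // (splitl x _ lb) (splitl z _ lb) E eqn_add2l -(@leq_lev be).
- split; last by rewrite leq_lev // !split -(@leq_lev be).
  have [h|h] := leqP be (lev W x z).
    by rewrite -(subnKC h) leq_add2l leq_lev // -!split subnKC // -(@leq_lev W).
  case: E; apply/eqP.
  have := leq_lev be xW zW; rewrite (ltnW h) => /esym/eqP E; apply/eqP; exact: E.
Qed.

Hypothesis yW : forall j, j < d -> y j < 2 ^ W.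

Lemma branch_lt i j : i < d -> j < d -> y i != y j -> branch i j < W.
Proof.
move=> id jd ne; rewrite /branch prednK ?lev_le //.
by apply: lev_gt0; rewrite ?yW.
Qed.

Lemma fskE x (i j : 'I_d) : x < 2 ^ W -> y i != y j ->
  dec bit0 (fsk1 x) (i, j) || dec bit0 (fsk2 x) (i, j) = odd (x %/ 2 ^ branch i j).
Proof.
move=> xW ne; have bW := branch_lt (ltn_ord i) (ltn_ord j) ne.
have lx : x %% B < B by rewrite ltn_mod B0.
rewrite /fsk1 /fsk2 /px !mxE ?hi_lt // !encK !ffunE /=.
have [h|h] := leqP be (branch i j).
  rewrite (inordK (_ : be < be.+1)) // ltnn orbF inordK; last by move: bW; rewrite /W; lia.
  rewrite (_ : _ < be); last by move: bW; rewrite /W; lia.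
  by rewrite /= -divnMA /B -expnD subnKC.
rewrite (inordK (_ : be < be.+1)) // ltnn /= inordK; last by lia.
rewrite h /=.
have xE : x = x %/ B * 2 ^ (be - branch i j) * 2 ^ branch i j + x %% B.
  by rewrite -mulnA -expnD subnK ?(ltnW h) // -divn_eq.
rewrite [in RHS]xE divnMDl ?expn_gt0 // oddD.
by rewrite oddM oddX /= (_ : be - branch i j == 0 = false) ?andbF //; lia.
Qed.

Lemma ltn_lev a b c p : a < 2 ^ W -> b < 2 ^ W -> c < 2 ^ W ->
  lev W a b <= p -> p < lev W a c -> (c < a) = (c < b).
Proof.
move=> aW bW cW; rewrite leq_lev // => /eqP E; rewrite ltnNge leq_lev // => ne.
have := @ltn_div_ltn p a c; have := @ltn_div_ltn p c a.
have := @ltn_div_ltn p b c; have := @ltn_div_ltn p c b.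
by rewrite -E; lia.
Qed.

(** Descent in the trie: among the candidates, which agree above bit [p], those having the bit of x
    are kept. If there are none, all candidates have the opposite bit, the trie does not branch
    there and nothing is lost. *)
Lemma exists_blind x (A : seq 'I_d) p : A != [::] -> x < 2 ^ W ->
  {in A &, forall i j : 'I_d, y i %/ 2 ^ p = y j %/ 2 ^ p} ->
  exists2 a, a \in A & {in A, forall j : 'I_d, y a != y j ->
     odd (x %/ 2 ^ branch a j) = (y j < y a)}.
Proof.
move=> A0 xW; elim: p A A0 => [|p IH] A A0 HA.
  case: A A0 HA => // a A _ HA; exists a; rewrite ?mem_head // => j jA.
  have := HA a j (mem_head _ _) jA; by rewrite expn0 !divn1 => ->; rewrite eqxx.
pose b := odd (x %/ 2 ^ p).
pose A' := [seq i : 'I_d <- A | odd (y i %/ 2 ^ p) == b].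
have [A'0|A'0] := eqVneq A' [::].
  apply: IH => // i j iA jA; rewrite div2S (div2S (y j)) (HA _ _ iA jA).
  have nA k : k \in A -> odd (y k %/ 2 ^ p) = ~~ b.
    move=> kA; have : k \notin A' by rewrite A'0.
    by rewrite mem_filter kA andbT; case: odd; case: (b).
  by rewrite !nA.
have [|a aA Ha] := IH A' A'0.
  move=> i j; rewrite !mem_filter => /andP[/eqP bi iA] /andP[/eqP bj jA].
  by rewrite div2S (div2S (y j)) (HA _ _ iA jA) bi bj.
move: aA; rewrite mem_filter => /andP[/eqP ab aA].
(* A candidate dropped at bit [p] branches from [y a] exactly there, where [y a] has the bit of
   x. *)
exists a => // j jA ne; have [jb|jb] := eqVneq (odd (y j %/ 2 ^ p)) b.
  by apply: Ha => //; rewrite mem_filter jb eqxx.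
have [ya yj] : y a < 2 ^ W /\ y j < 2 ^ W by rewrite !yW.
have lE : lev W (y a) (y j) = p.+1.
  apply/eqP; rewrite eqn_leq leq_lev // (HA _ _ aA jA) eqxx ltnNge leq_lev //.
  by apply/negP => /eqP E; move: jb; rewrite -E ab eqxx.
by rewrite /branch lE /= -/b -ab -(bit_lev ya yj ne) lE.
Qed.

(** If some [y j] shared a longer prefix with x than [y a], then [y a] would branch from [y j] at
    the bit where it leaves x, and x would have there the bit of [y j], against the choice of
    [a]. *)
Lemma fa_best x : x < 2 ^ W -> (forall j, j < d -> y j != x) ->
  forall j, j < d -> lev W x (y (fa x)) <= lev W x (y j).
Proof.
move=> xW xn j jd.
rewrite /fa /u1 !mxE ?enc_lt //.
have blindP a : blind (dec bit0 occ) (dec bit0 (fsk1 x)) (dec bit0 (fsk2 x)) a <->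
    forall j : 'I_d, y a != y j -> odd (x %/ 2 ^ branch a j) = (y j < y a).
  split=> [/forallP H i ne|H].
    move: (H i); rewrite encK !ffunE /= (_ : (y i < y a) || (y a < y i)) /=; last by lia.
    by rewrite fskE // => /eqP.
  apply/forallP => i; rewrite encK !ffunE /=; apply/implyP => ne.
  by rewrite fskE ?H //; lia.
case: pickP => [a /blindP Ha|]; last first.
  move=> H; have [||a _ Ha] := @exists_blind x (enum 'I_d) W _ xW.
  - by rewrite -size_eq0 size_enum_ord; lia.
  - by move=> i k _ _; rewrite !divn_small // yW.
  by have /negP[] := negbT (H a); apply/blindP => i; apply: Ha; rewrite mem_enum.
rewrite leqNgt; apply/negP => h.
set P := lev W x (y a) in h.
have [ya yj] : y a < 2 ^ W /\ y j < 2 ^ W by rewrite !yW.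
have P0 : 0 < P by apply: leq_trans h.
have ne : y a != y j by apply/eqP => E; move: h; rewrite /P E ltnn.
have E1 : x %/ 2 ^ P = y a %/ 2 ^ P by apply/eqP; rewrite -(@leq_lev W).
have E2 : x %/ 2 ^ P = y j %/ 2 ^ P by apply/eqP; rewrite -(@leq_lev W) // ltnW.
have E3 : x %/ 2 ^ P.-1 = y j %/ 2 ^ P.-1 by apply/eqP; rewrite -(@leq_lev W) // -ltnS prednK.
have E4 : x %/ 2 ^ P.-1 != y a %/ 2 ^ P.-1 by rewrite -(@leq_lev W) // -/P -ltnNge prednK.
have lE : lev W (y a) (y j) = P.
  apply/eqP; rewrite eqn_leq leq_lev // -E1 E2 eqxx -[X in X <= _]prednK // ltnNge leq_lev //.
  by rewrite -E3 eq_sym.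
have := Ha (Ordinal jd) ne; rewrite /branch /= lE -(bit_lev ya yj ne) lE => E.
by move: E4; rewrite div2S (div2S (y a)) !prednK // E1 E eqxx.
Qed.

Lemma ffE x y0 : x < 2 ^ W -> (forall j, j < d -> y j != x) -> y0 < d ->
  ff x y0 = find (fun j => (y0 <= j) && (y j < x)) (iota 0 d).
Proof.
move=> xW xn y0d; have ad := fa_lt x; have best := fa_best xW xn.
rewrite /ff; set a := fa x in ad best *; have ya := yW ad.
have lW : flv x (y a) < W.+1 by rewrite flvE // ltnS lev_le.
have b2 : nat_of_bool (y a < x) < 2 by case: (y a < x).
rewrite /u2 !mxE // encK find_ord; apply: eq_find => j.
rewrite oddD oddM andbF /= !ffunE /= oddb inordK ?ltnS ?lev_le //; congr (_ && _).
have yj := yW (ltn_ord j).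
rewrite flvE //; case: ltnP => h.
  have := @ltn_lev (y a) x (y j) (lev W x (y a)) ya xW yj.
  by rewrite levC leqnn => /(_ isT h) ->.
(* In case of equality x and [y j] would both take the side opposite to [y a] at the same bit, so
   that [y j] would share a longer prefix with x than [y a] does. *)
have {}h : lev W (y a) (y j) < lev W x (y a).
  rewrite ltn_neqAle h andbT; apply/eqP => lE.
  have l0 : 0 < lev W x (y a) by apply: lev_gt0; rewrite // eq_sym xn.
  set P := lev W x (y a) in lE l0.
  have E1 : x %/ 2 ^ P = y a %/ 2 ^ P by apply/eqP; rewrite -(@leq_lev W).
  have E2 : y a %/ 2 ^ P = y j %/ 2 ^ P by apply/eqP; rewrite -(@leq_lev W) // lE.
  have E4 : x %/ 2 ^ P.-1 != y a %/ 2 ^ P.-1 by rewrite -(@leq_lev W) // -/P -ltnNge prednK.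
  have E5 : y a %/ 2 ^ P.-1 != y j %/ 2 ^ P.-1 by rewrite -(@leq_lev W) // lE -ltnNge prednK.
  have : lev W x (y j) <= P.-1.
    rewrite leq_lev //; move: E4 E5.
    rewrite (div2S x) (div2S (y a) P.-1) (div2S (y j) P.-1) !prednK // E1 E2.
    by do 3 case: odd; rewrite ?eqxx.
  by move=> h2; have := leq_trans (best j (ltn_ord j)) h2; rewrite -/P -ltnS prednK // ltnn.
have := @ltn_lev (y a) (y j) x _ ya yj xW (leqnn _); rewrite (levC _ _ x) => /(_ h).
have := xn j (ltn_ord j); have := xn a ad; move: (y a) (y j) => u v; clear - x; lia.
Qed.

End Flat.

(** * Suffix array intervals *)

Fixpoint lexle (s t : seq nat) : bool :=
  match s, t with
  | [::], _ => true
  | _ :: _, [::] => false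
  | a :: s', b :: t' => (a < b) || (a == b) && lexle s' t'
  end.

Fixpoint lcpl (s t : seq nat) : nat :=
  match s, t with
  | a :: s', b :: t' => if a == b then (lcpl s' t').+1 else 0
  | _, _ => 0
  end.

Lemma lexle_total : total lexle.
Proof. by elim=> [|a s IH] [|b t] //=; have := IH t; case: ltngtP. Qed.

Lemma lexle_trans : transitive lexle.
Proof.
move=> t s u; elim: t s u => [|b t IH] [|a s] [|c u] //=.
case: (ltngtP a b) => //= [ab _|-> h1].
  by case: (ltngtP b c) => //= [bc _|<- h2]; [rewrite (ltn_trans ab bc) | rewrite ab].
by case: (ltngtP b c) => //= _ h2; apply: IH h1 h2.
Qed.

Lemma leq_lcpl l s t : (l <= lcpl s t) =
  [&& l <= size s, l <= size t & all (fun k => nth 0 s k == nth 0 t k) (iota 0 l)].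
Proof.
elim: s t l => [|a s IH] [|b t] [|l] //=; rewrite ?andbF //.
rewrite -[1]/(1 + 0) iotaDl all_map; case: eqP => [_|_]; last by rewrite /= !andbF.
by rewrite ltnS IH.
Qed.

Lemma lcpl_lexle s t u : lexle s t -> lexle t u -> lcpl s u <= lcpl s t.
Proof.
elim: s t u => [|a s IH] [|b t] [|c u] //=.
case: ltngtP => //= [ab _|-> h1]; first by case: ltngtP => //= bc _; case: eqP => //; lia.
by case: ltngtP => //= _ h2; apply: IH h1 h2.
Qed.

Lemma convexP (P : pred nat) n (a := find P (iota 0 n)) (c := count P (iota 0 n)) :
  (forall q1 q2 q3, q1 <= q2 <= q3 -> q3 < n -> P q1 -> P q3 -> P q2) ->
  a + c <= n /\ forall q, q < n -> P q = (a <= q < a + c).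
Proof.
move=> cv; have an : a <= n := find_iota_le P n.
pose b := a + find (predC P) (iota a (n - a)).
have bn : b <= n.
  by have := find_size (predC P) (iota a (n - a)); rewrite size_iota /b; lia.
have PE q : q < n -> P q = (a <= q < b).
  move=> qn; case: (leqP a q) => /= [aq|qa]; last by apply: negbTE; apply: find_iotaF qa.
  case: (ltnP q b) => [qb|bq].
    have h : q - a < find (predC P) (iota a (n - a)) by lia.
    have := before_find a h; rewrite nth_iota ?subnKC //=; last by lia.
    by move/negbFE.
  apply/negbTE/negP => Pq.
  have h : has (predC P) (iota a (n - a)) by rewrite has_find size_iota; lia.
  have := nth_find a h; rewrite nth_iota /=; last by move: h; rewrite has_find size_iota.
  rewrite -/b => /negP; apply; apply: (cv a b q); rewrite ?leq_addr ?bq //.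
  by apply: find_iotaT; apply: leq_ltn_trans qn.
have -> : c = b - a.
  have -> : c = count (fun q => a <= q < b) (iota 0 n).
    by apply: eq_in_count => q; rewrite mem_iota => /andP[_ /PE].
  have -> : iota 0 n = iota 0 a ++ (iota a (b - a) ++ iota b (n - b)).
    have {1}-> : n = a + ((b - a) + (n - b)) by rewrite /b; lia.
    by rewrite !iotaD add0n subnKC // leq_addr.
  rewrite !count_cat.
  have -> : count (fun q => a <= q < b) (iota 0 a) = 0.
    by apply/eqP; rewrite -leqn0 leqNgt -has_count; apply/hasPn => q; rewrite mem_iota; lia.
  have -> : count (fun q => a <= q < b) (iota b (n - b)) = 0.
    by apply/eqP; rewrite -leqn0 leqNgt -has_count; apply/hasPn => q; rewrite mem_iota; lia.
  rewrite add0n addn0; apply/eqP; rewrite -[X in _ == X](size_iota a) -all_count.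
  by apply/allP => q; rewrite mem_iota /b; lia.
by rewrite subnKC ?leq_addr.
Qed.

Section Text.
Variable T : seq nat.
Let n := size T.

Definition same l i j :=
  [&& i + l <= n, j + l <= n & all (fun t => nth 0 T (i + t) == nth 0 T (j + t)) (iota 0 l)].

Lemma same_refl l i : i + l <= n -> same l i i.
Proof. by move=> h; rewrite /same h; apply/allP => t _. Qed.

Lemma same_sym l i j : same l i j = same l j i.
Proof. by rewrite /same andbCA; congr [&& _, _ & _]; apply: eq_all => t; rewrite eq_sym. Qed.

Lemma same_trans l i j k : same l i j -> same l j k -> same l i k.
Proof.
move=> /and3P[h1 h2 /allP h3] /and3P[_ h4 /allP h5]; rewrite /same h1 h4 /=.
by apply/allP => t ht; rewrite (eqP (h3 _ ht)) h5.
Qed.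

Lemma same_eq l i j k : same l i j -> same l i k = same l j k.
Proof.
by move=> h; apply/idP/idP; apply: same_trans => //; rewrite same_sym.
Qed.

Lemma sameD a b i j : same (a + b) i j = same a i j && same b (i + a) (j + a).
Proof.
rewrite /same iotaD all_cat add0n -[X in iota X b]addn0 iotaDl all_map.
have -> : all (preim (addn a) (fun t => nth 0 T (i + t) == nth 0 T (j + t))) (iota 0 b) =
   all (fun t => nth 0 T (i + a + t) == nth 0 T (j + a + t)) (iota 0 b).
  by apply: eq_all => t /=; rewrite !addnA.
by case: all; case: all; lia.
Qed.

Lemma same_le l l' i j : l' <= l -> same l i j -> same l' i j.
Proof. by move=> h; rewrite -(subnKC h) sameD => /andP[]. Qed.

Lemma same_lcpl l i j : i <= n -> j <= n ->
  same l i j = (l <= lcpl (drop i T) (drop j T)).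
Proof.
move=> i_n j_n; rewrite leq_lcpl !size_drop -/n /same.
have -> : all (fun k => nth 0 (drop i T) k == nth 0 (drop j T) k) (iota 0 l) =
   all (fun t => nth 0 T (i + t) == nth 0 T (j + t)) (iota 0 l).
  by apply: eq_all => t; rewrite !nth_drop.
by congr [&& _, _ & _]; lia.
Qed.

Definition sa := sort (fun i j => lexle (drop i T) (drop j T)) (iota 0 n).
Definition suf q := nth 0 sa q.

Lemma size_sa : size sa = n.
Proof. by rewrite size_sort size_iota. Qed.

Lemma perm_sa : perm_eq sa (iota 0 n).
Proof. by rewrite perm_sort. Qed.

Lemma suf_lt q : q < n -> suf q < n.
Proof.
move=> qn; have : suf q \in sa by rewrite mem_nth ?size_sa.
by rewrite (perm_mem perm_sa) mem_iota.
Qed.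

Lemma suf_inj q q' : q < n -> q' < n -> suf q = suf q' -> q = q'.
Proof.
move=> h h' /eqP; rewrite nth_uniq ?size_sa //; first by move/eqP.
by rewrite (perm_uniq perm_sa) iota_uniq.
Qed.

Lemma map_suf : map suf (iota 0 n) = sa.
Proof. by rewrite -{1}size_sa; exact: mkseq_nth. Qed.

Lemma suf_sorted q q' : q <= q' -> q' < n -> lexle (drop (suf q) T) (drop (suf q') T).
Proof.
move=> qq q'n; have /(sorted_leq_nth _ _ 0) : sorted (fun i j => lexle (drop i T) (drop j T)) sa.
  by apply: sort_sorted => i j; apply: lexle_total.
move=> H; apply: H => //; rewrite ?inE ?size_sa //; first by move=> j i k; apply: lexle_trans.
  by move=> i; have := lexle_total (drop i T) (drop i T); rewrite orbb.
exact: leq_ltn_trans q'n.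
Qed.

(* The suffix array interval of T[i..i+l) is [lft i l, rgt i l), of size [cnt i l]. *)
Definition cnt i l := count (same l i) (iota 0 n).
Definition lft i l := find (fun q => same l i (suf q)) (iota 0 n).
Definition rgt i l := lft i l + cnt i l.

Lemma cntE i l : cnt i l = count (fun q => same l i (suf q)) (iota 0 n).
Proof.
rewrite /cnt -(seq.permP perm_sa) -map_suf count_map; exact: eq_count.
Qed.

Lemma rgt_le i l : rgt i l <= n.
Proof.
rewrite /rgt cntE; apply: (proj1 (convexP _)).
move=> q1 q2 q3 /andP[h12 h23] h3 s1 s3.
have [q1n q2n] : q1 < n /\ q2 < n by lia.
have := same_trans (etrans (same_sym _ _ _) s1) s3.
rewrite same_lcpl ?(ltnW (suf_lt _)) // => h.
apply: same_trans s1 _; rewrite same_lcpl ?(ltnW (suf_lt _)) //.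
by apply: leq_trans h _; apply: lcpl_lexle; apply: suf_sorted.
Qed.

Lemma same_suf i l q : q < n -> same l i (suf q) = (lft i l <= q < rgt i l).
Proof.
rewrite /rgt cntE; apply: (proj2 (convexP _)).
move=> q1 q2 q3 /andP[h12 h23] h3 s1 s3.
have [q1n q2n] : q1 < n /\ q2 < n by lia.
have := same_trans (etrans (same_sym _ _ _) s1) s3.
rewrite same_lcpl ?(ltnW (suf_lt _)) // => h.
apply: same_trans s1 _; rewrite same_lcpl ?(ltnW (suf_lt _)) //.
by apply: leq_trans h _; apply: lcpl_lexle; apply: suf_sorted.
Qed.

Lemma eq_cnt i j l : same l i j -> cnt i l = cnt j l.
Proof. by move=> h; apply: eq_count => k; apply: same_eq. Qed.

Lemma eq_lft i j l : same l i j -> lft i l = lft j l.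
Proof. by move=> h; apply: eq_find => k; apply: same_eq. Qed.

Lemma eq_rgt i j l : same l i j -> rgt i l = rgt j l.
Proof. by move=> h; rewrite /rgt (eq_cnt h) (eq_lft h). Qed.

Lemma cnt_le i l l' : l <= l' -> cnt i l' <= cnt i l.
Proof. by move=> h; apply: sub_count => y; apply: same_le. Qed.

Lemma lft_le i l l' : l <= l' -> 0 < cnt i l' -> lft i l <= lft i l' /\ rgt i l' <= rgt i l.
Proof.
move=> h c0; have r' := rgt_le i l'; have rE : rgt i l' = lft i l' + cnt i l' by [].
have H q : lft i l' <= q < rgt i l' -> lft i l <= q < rgt i l.
  move=> hq; have qn : q < n by lia.
  by rewrite -same_suf //; apply: same_le h _; rewrite same_suf.
by have := H (lft i l'); have := H (rgt i l').-1; lia.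
Qed.

(** Shifting by [d] maps the occurrences lost when the length grows from [d + a] to [d + b] at [i]
    injectively to those lost when it grows from [a] to [b] at [i + d]. Since [0 < a], the shifted
    positions stay below [n]. *)
Lemma cnt_shift i d a b : 0 < a <= b ->
  cnt i (d + a) + cnt (i + d) b <= cnt (i + d) a + cnt i (d + b).
Proof.
case/andP=> a0 ab.
pose dif i' l l' := [seq y <- iota 0 n | same l i' y & ~~ same l' i' y].
have difE i' l l' : l <= l' -> cnt i' l = cnt i' l' + size (dif i' l l').
  move=> ll; rewrite /cnt /dif size_filter -count_predUI -[LHS]addn0; congr (_ + _).
    by apply: eq_count => y /=; have /implyP := @same_le l' l i' y ll; do 2 case: same.
  by rewrite -[LHS](count_pred0 (iota 0 n)); apply: eq_count => y /=; do 2 case: same.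
rewrite (difE i (d + a) (d + b)) ?leq_add2l // (difE (i + d) a b) //.
suff: size (dif i (d + a) (d + b)) <= size (dif (i + d) a b) by lia.
rewrite -(size_map (addn d)); apply: uniq_leq_size.
  by rewrite map_inj_uniq ?filter_uniq ?iota_uniq //; exact: addnI.
move=> _ /mapP[y + ->]; rewrite !mem_filter !mem_iota !sameD.
case/andP=> /andP[/andP[hd h] nh] yn; rewrite (addnC d) h; move: nh; rewrite hd /= => -> /=.
by case/and3P: h => _ h _; lia.
Qed.

(** The case of [cnt_shift] in which the longer lengths exceed the text, so that both extended
    counts vanish. *)
Lemma cnt_le_suffix i d a : 0 < a -> cnt i (d + a) <= cnt (i + d) a.
Proof.
move=> a0; have := @cnt_shift i d a (n.+1 + a); rewrite a0 leq_addl => /(_ isT).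
have z i' l : n < l -> cnt i' l = 0.
  move=> h; rewrite /cnt -[RHS](count_pred0 (iota 0 n)); apply: eq_count => y /=.
  by rewrite /same; lia.
by rewrite (z (i + d) (n.+1 + a)) 1?(z i (d + (n.+1 + a))); lia.
Qed.

(** The value 0 at both ends is a sentinel: every search for an entry below a positive [l] stops
    there at the latest. *)
Definition lcp q := if 0 < q < n then lcpl (drop (suf q.-1) T) (drop (suf q) T) else 0.

Lemma leq_lcp l q : 0 < l -> q.+1 < n -> (l <= lcp q.+1) = same l (suf q) (suf q.+1).
Proof. by move=> l0 qn; rewrite /lcp qn /= same_lcpl // ltnW // suf_lt // ltnW. Qed.

Lemma lcp_le q : lcp q <= n.
Proof.
rewrite /lcp; case: ifP => // _; set s := drop _ _.
have := leq_lcpl (lcpl s (drop (suf q) T)) s (drop (suf q) T).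
by rewrite leqnn => /esym/and3P[h _ _]; apply: leq_trans h _; rewrite size_drop leq_subr.
Qed.

Lemma lcp_in i l q : 0 < l -> lft i l < q < rgt i l -> l <= lcp q.
Proof.
move=> l0; case: q => // q h; have rn := rgt_le i l; rewrite leq_lcp //; last by lia.
apply: (@same_trans _ _ i); last by rewrite same_suf; lia.
by rewrite same_sym same_suf; lia.
Qed.

Lemma lcp_lft i l : 0 < l -> 0 < cnt i l -> lcp (lft i l) < l.
Proof.
move=> l0 c0; have rn := rgt_le i l; have rE : rgt i l = lft i l + cnt i l by [].
case E : (lft i l) => [|q]; first by rewrite /lcp.
rewrite ltnNge leq_lcp //; last by lia.
apply/negP => h; have : same l i (suf q); last by rewrite same_suf; lia.
apply: (@same_trans _ _ (suf q.+1)); last by rewrite same_sym.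
by rewrite same_suf; lia.
Qed.

Lemma lcp_rgt i l : 0 < l -> 0 < cnt i l -> lcp (rgt i l) < l.
Proof.
move=> l0 c0; have rn := rgt_le i l; have rE : rgt i l = lft i l + cnt i l by [].
move: rn; rewrite leq_eqVlt => /orP[/eqP ->|rn]; first by rewrite /lcp ltnn andbF.
case E : (rgt i l) => [|q]; first by lia.
rewrite ltnNge leq_lcp //; last by lia.
apply/negP => h; have : same l i (suf q.+1); last by rewrite same_suf; lia.
by apply: (same_trans _ h); rewrite same_suf; lia.
Qed.

End Text.

(** * Locating the interval of a frequent substring *)

(** Keys are kept in decreasing order with 0 as a sentinel, so that counting the keys at or above
    [l] is again a search for the first entry below [l]. *)
Lemma count_find_sorted (s : seq nat) l : sorted gtn s -> 0 < l ->
  find (fun k => k < l) (rcons s 0) = count (leq l) s.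
Proof.
move=> + l0; elim: s => [|a s IH] /=; first by rewrite l0.
move=> pa; have ss := path_sorted pa; case: ltnP => h /=; last by rewrite IH.
rewrite add0n; apply/esym/eqP; rewrite -leqn0 leqNgt -has_count; apply/hasPn => b bs.
have /allP/(_ b bs) /= : all (gtn a) s by apply: order_path_min pa; move=> x y z /= ? ?; lia.
by rewrite -ltnNge => ?; lia.
Qed.

Lemma nth_last_geq (s : seq nat) l k : sorted gtn s -> k \in s -> l <= k ->
  let x := nth 0 s (count (leq l) s).-1 in [/\ x \in s, l <= x, x <= k & 0 < count (leq l) s].
Proof.
elim: s k => [|a s IH] k //= pa; rewrite inE => ks lk.
have ss := path_sorted pa.
have as_ : all (gtn a) s by apply: order_path_min pa; move=> x y z /= ? ?; lia.
have la : l <= a.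
  by case/orP: ks => [/eqP <- //|/(allP as_)] /= ?; lia.
rewrite la /=; case: (boolP (has (leq l) s)) => [hs|hs].
  have c0 : 0 < count (leq l) s by rewrite -has_count.
  case/hasP: hs => k' k's lk'.
  have [x1 x2 _ _] := IH k' ss k's lk'.
  have -> : nth 0 (a :: s) (count (leq l) s) = nth 0 s (count (leq l) s).-1 by case: (count _ s) c0.
  split=> //; first by rewrite inE x1 orbT.
  case/orP: ks => [/eqP ->|ks]; last by case: (IH k ss ks lk).
  by have /= := allP as_ _ x1; lia.
have -> : count (leq l) s = 0 by apply/eqP; rewrite -leqn0 leqNgt -has_count.
rewrite /= inE eqxx; split=> //; case/orP: ks => [/eqP -> //|ks].
by case/negP: hs; apply/hasP; exists k.
Qed.

(** The keys from [l] to below [l'] are distinct numbers, and [f], which drops after each of them,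
    takes distinct values on them, all above [f l'] and at most [f l]. *)
Lemma count_keys (s : seq nat) (f : nat -> nat) (l l' : nat) : uniq s -> l <= l' ->
  (forall a b, a <= b -> f b <= f a) -> (forall k, k \in s -> f k.+1 < f k) ->
  count (leq l) s <= count (leq l') s + minn (l' - l) (f l - f l').
Proof.
move=> us ll fm fs; pose s' := [seq k <- s | l <= k < l'].
have -> : count (leq l) s = count (leq l') s + size s'.
  rewrite size_filter -count_predUI -[LHS]addn0; congr (_ + _).
    by apply: eq_count => k /=; lia.
  by rewrite -[LHS](count_pred0 s); apply: eq_count => k /=; lia.
rewrite leq_add2l leq_min; apply/andP; split.
  rewrite -[X in _ <= X](size_iota l); apply: uniq_leq_size; first exact: filter_uniq.
  by move=> k; rewrite mem_filter mem_iota => /andP[? _]; lia.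
rewrite -(size_map f) -[X in _ <= X](size_iota (f l').+1); apply: uniq_leq_size.
  rewrite map_inj_in_uniq ?filter_uniq // => a b; rewrite !mem_filter => /andP[_ /fs ha] /andP[_ /fs hb] e.
  have := fm a.+1 b; have := fm b.+1 a; lia.
move=> _ /mapP[k + ->]; rewrite mem_filter mem_iota => /andP[/andP[lk kl] /fs hk].
by have := fm _ _ lk; have := fm _ _ kl; lia.
Qed.

Lemma nth_flatten_off (ss : seq (seq nat)) r c : r < size ss -> c < size (nth [::] ss r) ->
  nth 0 (flatten ss) (sumn (take r (shape ss)) + c) = nth 0 (nth [::] ss r) c.
Proof.
elim: ss r => [|s ss IH] [|r] //= hr hc; first by rewrite add0n nth_cat hc.
by rewrite nth_cat -addnA ltnNge leq_addr /= addKn IH.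
Qed.

Lemma flatten_off_lt (ss : seq (seq nat)) r c : r < size ss -> c < size (nth [::] ss r) ->
  sumn (take r (shape ss)) + c < size (flatten ss).
Proof.
rewrite size_flatten; elim: ss r => [|s ss IH] [|r] //= hr hc; first by rewrite add0n; lia.
by have := IH r hr hc; lia.
Qed.

Section Macro.
Variables (T : seq nat) (lam g : nat).
Let n := size T.
Hypotheses (n0 : 0 < n) (g0 : 0 < g) (nlam : n < 2 ^ lam.+1).

Notation cnt := (cnt T).
Notation suf := (suf T).
Notation lft := (lft T).
Notation rgt := (rgt T).
Notation same := (same T).

Lemma cnt_big i l : n < i + l -> cnt i l = 0.
Proof.
move=> h; rewrite /cnt -[RHS](count_pred0 (iota 0 n)); apply: eq_count => y /=.
by rewrite /same -/n; lia.
Qed.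

Lemma cnt_len i l : 0 < cnt i l -> i + l <= n.
Proof. by case: (leqP (i + l) n) => // /cnt_big ->. Qed.

Lemma cnt_n i l : cnt i l <= n.
Proof. by rewrite -[xmax in _ <= xmax](size_iota 0) count_size. Qed.

(* The largest length for which the suffix of rank [q] has 2^h matches. *)
Definition LA q h := find (fun l => cnt (suf q) l.+1 < 2 ^ h) (iota 0 n).

Lemma leq_LA q h l : 0 < l -> (l <= LA q h) = (2 ^ h <= cnt (suf q) l).
Proof.
case: l => // l _; apply/idP/idP => h1.
  by rewrite leqNgt; apply: (find_iotaF (P := fun l => cnt (suf q) l.+1 < 2 ^ h) h1).
rewrite ltnNge; apply/negP => h2.
have c0 : 0 < cnt (suf q) l.+1 by apply: leq_trans h1; rewrite expn_gt0.
have ln := cnt_len c0.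
have hn : LA q h < n by lia.
have := find_iotaT hn; rewrite -/(LA q h) ltnNge => /negP; apply.
by apply: leq_trans h1 _; apply: cnt_le.
Qed.

Lemma LA_le q h : LA q h <= n.
Proof. exact: find_iota_le. Qed.

Definition hs := [seq h <- iota 0 lam.+1 | g <= 2 ^ h].
(* The row (h, u) is the suffix of rank u 2^h: among the matches of a string that
   occurs at least 2^h times there is such a suffix. *)
Definition rows := [seq (h, u) | h <- hs, u <- iota 0 (n %/ 2 ^ h).+1].

Definition cntg i l := cnt i l %/ g.
(* The lengths at which the number of matches of suffix [i], counted in units of [g],
   drops.  The interval of [i] is stored only for those. *)
Definition keys i t := [seq l <- rev (iota 1 n) | (cnt i l < t.*2) && (cntg i l.+1 < cntg i l)].
Definition nkeys i t l := count (leq l) (keys i t).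

Lemma keys_sorted i t : sorted gtn (keys i t).
Proof.
apply: sorted_filter; first by move=> x y z /= ? ?; lia.
by rewrite rev_sorted; exact: iota_ltn_sorted.
Qed.

Lemma keys_uniq i t : uniq (keys i t).
Proof. by rewrite filter_uniq // rev_uniq iota_uniq. Qed.

Lemma mem_keys i t l : l \in keys i t ->
  [/\ 0 < l, l <= n, cnt i l < t.*2 & cntg i l.+1 < cntg i l].
Proof. by rewrite mem_filter mem_rev mem_iota => /andP[/andP[-> ->]] /andP[? ?]; split; lia. Qed.

(** The rounded counts [cntg] at the keys are distinct, positive and at most [t.*2 %/ g]. *)
Lemma size_keys i t : size (keys i t) <= t.*2 %/ g.
Proof.
rewrite -(size_map (cntg i)) -[xmax in _ <= xmax](size_iota 1); apply: uniq_leq_size.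
  rewrite map_inj_in_uniq ?keys_uniq // => a b /mem_keys[_ _ _ ha] /mem_keys[_ _ _ hb] e.
  have fm x y : x <= y -> cntg i y <= cntg i x by move=> xy; rewrite leq_div2r // cnt_le.
  by have := fm a.+1 b; have := fm b.+1 a; lia.
move=> _ /mapP[k /mem_keys[k0 kn kt kf] ->]; rewrite mem_iota.
have : cntg i k <= t.*2 %/ g by rewrite leq_div2r // ltnW.
lia.
Qed.

Lemma N_bound i t l l' : l <= l' -> nkeys i t l <= nkeys i t l' + minn (l' - l) (cntg i l - cntg i l').
Proof.
move=> ll; apply: count_keys => //; first exact: keys_uniq.
  by move=> a b ab; rewrite leq_div2r // cnt_le.
by move=> k /mem_keys[].
Qed.

Lemma N_mono i t l l' : l <= l' -> nkeys i t l' <= nkeys i t l.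
Proof. by move=> ll; apply: sub_count => k /=; lia. Qed.

(** The last length with the same rounded count as [l] is a key, since rounded counts fall to 0
    beyond the text. So the least key [x >= l] has this rounded count too, and the true counts
    differ by less than [g]. *)
Lemma key_near i t l : g <= t -> 0 < l -> t <= cnt i l < t.*2 ->
  let x := nth 0 (keys i t) (nkeys i t l).-1 in
  [/\ 0 < nkeys i t l <= size (keys i t), l <= x, 0 < cnt i x & cnt i l < cnt i x + g].
Proof.
move=> gt l0 /andP[tl lt].
have fm x y : x <= y -> cntg i y <= cntg i x by move=> xy; rewrite leq_div2r // cnt_le.
have fl : 0 < cntg i l by rewrite divn_gt0 // (leq_trans gt).
pose k := l + find (fun m => cntg i (l + m).+1 < cntg i l) (iota 0 n).
have hk : k < l + n /\ cntg i k.+1 < cntg i l.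
  have h : find (fun m => cntg i (l + m).+1 < cntg i l) (iota 0 n) < n.
    rewrite -[xmax in _ < xmax](size_iota 0 n) -has_find; apply/hasP; exists n.-1.
      by rewrite mem_iota; lia.
    by rewrite /cntg cnt_big ?div0n //; lia.
  by split; [rewrite /k; lia | exact: (find_iotaT h)].
have fk : cntg i k = cntg i l.
  apply/eqP; rewrite eqn_leq fm ?leq_addr //= /k.
  case E : (find _ _) => [|m]; first by rewrite addn0.
  have : m < find (fun m => cntg i (l + m).+1 < cntg i l) (iota 0 n) by rewrite E.
  by move/find_iotaF; rewrite -leqNgt addnS.
have ck : 0 < cnt i k by move: fk fl; rewrite /cntg; case: (cnt i k) => //; rewrite div0n; lia.
have kk : k \in keys i t.
  rewrite mem_filter mem_rev mem_iota fk (proj2 hk) andbT.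
  have := cnt_len ck; have : cnt i k <= cnt i l by apply: cnt_le; rewrite leq_addr.
  by rewrite /k; lia.
have [x1 x2 x3 x4] := nth_last_geq (keys_sorted i t) kk (leq_addr _ l).
set x := nth _ _ _ in x1 x2 x3 *; move=> /=.
have xl : cntg i x = cntg i l by apply/eqP; rewrite eqn_leq fm //= -fk fm.
split=> //; first by rewrite x4 /nkeys count_size.
  by move: xl fl; rewrite /cntg; case: (cnt i x) => //; rewrite div0n; lia.
rewrite (divn_eq (cnt i l) g) (divn_eq (cnt i x) g) -/(cntg i l) -/(cntg i x) xl.
have : cnt i l %% g < g by rewrite ltn_mod.
lia.
Qed.

(** The interval of the longer length is nested in the other one and has fewer than [g] ranks less,
    so each end moves by less than [g]. *)
Lemma key_interval i l x : l <= x -> 0 < cnt i x -> cnt i l < cnt i x + g ->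
  [/\ lft i l <= lft i x, rgt i x <= rgt i l, lft i x < lft i l + g & rgt i l < rgt i x + g].
Proof. by move=> lx cx h; have := lft_le lx cx; rewrite /rgt; split; lia. Qed.

(* The last start of a string ending at [E] that has fewer than 2t matches. *)
Definition xmax t E := \max_(x < minn E n | cnt x (E - x) < t.*2) (x : nat).

Lemma X_spec t E i : i < E -> i < n -> cnt i (E - i) < t.*2 ->
  [/\ i <= xmax t E, xmax t E < E, xmax t E < n & cnt (xmax t E) (E - xmax t E) < t.*2].
Proof.
move=> iE i_n ci; have iM : i < minn E n by rewrite leq_min iE.
have h := @leq_bigmax_cond _ (fun x : 'I_(minn E n) => cnt x (E - x) < t.*2)
  (fun x => x : nat) (Ordinal iM) ci.
case: (@eq_bigmax_cond _ [pred x : 'I_(minn E n) | cnt x (E - x) < t.*2] (fun x => x : nat)) => [|x xP e].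
  by apply/card_gt0P; exists (Ordinal iM).
have xE : xmax t E = x by rewrite -e; apply: eq_bigl.
have := ltn_ord x; rewrite leq_min xE => /andP[-> ->]; split=> //.
by rewrite -xE.
Qed.

(* The rows of [i] are refined by comparison with the rows of [i0], the multiple of
   2^k next to [i], with 2^k <= xmax t E + 1 - i < 2^(k+1).  Since xmax / 2^k and
   i0 / 2^k differ by at most 1, i0 is known from [k] and one bit [jj]; hence the
   count [aa] of T[i0..E) is stored once for all [i] having the same [k]. *)
Definition up i k := (i + 2 ^ k - 1) %/ 2 ^ k.
Definition kk t E i := trunc_log 2 ((xmax t E).+1 - i).
Definition jj t E i := xmax t E %/ 2 ^ kk t E i - up i (kk t E i).
Definition T1 t k E j := let i0 := (xmax t E %/ 2 ^ k - j) * 2 ^ k in cnt i0 (E - i0) %/ g.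
Definition aa t E i := T1 t (kk t E i) E (jj t E i).

Lemma up_bounds i k : i <= up i k * 2 ^ k < i + 2 ^ k.
Proof.
have p0 : 0 < 2 ^ k by rewrite expn_gt0.
rewrite /up; set m := i + 2 ^ k - 1.
have mE : m = i + 2 ^ k - 1 by [].
have := divn_eq m (2 ^ k); have : m %% 2 ^ k < 2 ^ k by rewrite ltn_mod.
lia.
Qed.

Lemma kk_spec t E i : i < E -> i < n -> cnt i (E - i) < t.*2 ->
  let k := kk t E i in let i0 := up i k * 2 ^ k in
  [/\ i <= i0 <= xmax t E, jj t E i < 2, (xmax t E %/ 2 ^ k - jj t E i) * 2 ^ k = i0,
      cnt i0 (E - i0) < t.*2 & k <= lam].
Proof.
move=> iE i_n ci; have [iX XE Xn cX] := X_spec iE i_n ci.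
move=> k i0; have p0 : 0 < 2 ^ k by rewrite expn_gt0.
have Xi : 0 < (xmax t E).+1 - i by lia.
have /andP[k1 k2] := @trunc_log_bounds 2 _ isT Xi; rewrite -/(kk t E i) -/k in k1 k2.
have /andP[u1 u2] := up_bounds i k; rewrite -/i0 in u1 u2.
have i0X : i0 <= xmax t E by lia.
have uX : up i k <= xmax t E %/ 2 ^ k by rewrite leq_divRL.
have XE' : (xmax t E %/ 2 ^ k - jj t E i) * 2 ^ k = i0 by rewrite /jj -/k subKn.
split=> //; first by rewrite u1.
- rewrite /jj -/k ltn_subLR // ltn_divLR // mulnDl -/i0.
  by move: k2; rewrite expnS; lia.
(* The string from [xmax t E] to [E] is a suffix of the one from [i0] to [E], hence at least as
   frequent. *)
- apply: leq_ltn_trans cX.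
  have := @cnt_le_suffix T i0 (xmax t E - i0) (E - xmax t E).
  by rewrite subnKC //; rewrite (_ : xmax t E - i0 + (E - xmax t E) = E - i0); lia.
- have := @leq_ltn_trans _ _ _ k1 (leq_ltn_trans (_ : (xmax t E).+1 - i <= n) nlam).
  by rewrite ltn_exp2l // ltnS; apply; lia.
Qed.

(* Two end points of the same class of a row [i] have the same superset row
   [i0 >= i], whose counts differ by less than [g], hence so do those of [i]. *)
Lemma class_near t E E' i : i < E <= E' -> i < n -> cnt i (E - i) < t.*2 -> cnt i (E' - i) < t.*2 ->
  kk t E i = kk t E' i -> aa t E i = aa t E' i ->
  nkeys i t (E' - i) <= nkeys i t (E - i) <= (nkeys i t (E' - i)).+1.
Proof.
move=> /andP[iE EE] i_n c1 c2 ek ea; have iE' : i < E' by lia.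
rewrite N_mono; last by lia.
have := @N_bound i t (E - i) (E' - i); rewrite leq_sub2r // => /(_ isT) h.
apply: (leq_trans h); rewrite -addn1 leq_add2l geq_min; apply/orP; right.
have [b1 _ x1 _ _] := kk_spec iE i_n c1; have [b2 _ x2 _ _] := kk_spec iE' i_n c2.
have [_ XE _ _] := X_spec iE i_n c1.
rewrite -ek in b2 x2; move: ea; rewrite /aa /T1 x1 -ek x2; set i0 := up _ _ * _ => ea.
move: b1 b2; rewrite -/i0 => b1 b2.
clearbody i0; clear x1 x2 ek.
have := @cnt_shift T i (i0 - i) (E - i0) (E' - i0).
rewrite (_ : 0 < E - i0 <= E' - i0); last by lia.
rewrite (_ : i0 - i + (E - i0) = E - i); last by lia.
rewrite (_ : i0 - i + (E' - i0) = E' - i); last by lia.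
rewrite subnKC; last by lia.
move=> /(_ isT) sh.
have lt : cnt i0 (E - i0) < cnt i0 (E' - i0) + g.
  rewrite (divn_eq (cnt i0 (E - i0)) g) (divn_eq (cnt i0 (E' - i0)) g) ea.
  have : cnt i0 (E - i0) %% g < g by rewrite ltn_mod.
  lia.
have {}lt : cnt i (E - i) <= cnt i (E' - i) + g by lia.
rewrite /cntg; have := leq_div2r g lt; rewrite divnDr ?dvdnn // divnn g0; lia.
Qed.

Definition EB := n %/ g + 2.
(* A lower bound, up to g + 1, for the number of keys above a length, common to all
   end points of class (a, k). *)
Definition zstart i t a k :=
  nkeys i t (find (fun eb => [&& i < eb * g, cnt i (eb * g - i) < t.*2, kk t (eb * g) i == k
     & aa t (eb * g) i == a]) (iota 0 EB) * g - i) - 1.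

(** The end [i + l] is rounded up to [eb * g], which skips at most [g] keys; passing to the first
    end of the same class costs at most one more, and this one is subtracted in [zstart]. *)
Lemma Z_spec i t l (eb := (i + l + g - 1) %/ g) : 0 < l -> i + l <= n -> cnt i l < t.*2 ->
  [/\ eb < EB, i < eb * g, cnt i (eb * g - i) < t.*2 &
   let z := zstart i t (aa t (eb * g) i) (kk t (eb * g) i) in z <= nkeys i t l <= z + g + 1].
Proof.
move=> l0 ln cl; have i_n : i < n by lia.
have ebE := divn_eq (i + l + g - 1) g; rewrite -/eb in ebE.
have md : (i + l + g - 1) %% g < g by rewrite ltn_mod.
have e1 : i + l <= eb * g < i + l + g by lia.
have h1 : eb < EB.
  rewrite /EB addn2 -(@ltn_pmul2r g) // !mulSn.
  have := divn_eq n g; have : n %% g < g by rewrite ltn_mod.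
  by lia.
have h2 : i < eb * g by lia.
have h3 : cnt i (eb * g - i) < t.*2 by apply: leq_ltn_trans cl; apply: cnt_le; lia.
split=> //; rewrite /zstart; set P := fun eb => _; set e := find P _.
have ee : e <= eb.
  by rewrite leqNgt; apply/negP => /find_iotaF; rewrite /P h2 h3 !eqxx.
have /and4P[p1 p2 /eqP p3 /eqP p4] : P e by apply: find_iotaT; apply: leq_ltn_trans h1.
have := @class_near t (e * g) (eb * g) i; rewrite p1 leq_mul2r ee orbT => /(_ isT i_n p2 h3 p3 p4).
have := @N_bound i t l (eb * g - i); rewrite (_ : l <= _); last by lia.
move=> /(_ isT); have := @N_mono i t l (eb * g - i); lia.
Qed.

Lemma aa_le t E i : i < E -> i < n -> cnt i (E - i) < t.*2 -> aa t E i <= t.*2 %/ g.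
Proof.
move=> h i_n c; have [_ _ e c' _] := kk_spec h i_n c; rewrite /aa /T1 e; apply: leq_div2r; exact: ltnW.
Qed.

(** [uu q h * 2 ^ h] is the first multiple of 2^h in the interval of the longest prefix with 2^h
    matches, which has enough ranks to contain one. The intervals of all shorter prefixes contain
    this interval, so one row serves all lengths up to [LA q h]. *)
Definition uu q h := (lft (suf q) (LA q h) + 2 ^ h - 1) %/ 2 ^ h.

Lemma uu_spec q h l : q < n -> 0 < l <= LA q h -> same l (suf q) (suf (uu q h * 2 ^ h)) /\
   uu q h * 2 ^ h < n.
Proof.
move=> qn /andP[l0 lL]; have p0 : 0 < 2 ^ h by rewrite expn_gt0.
have := @leq_LA q h (LA q h); rewrite leqnn => /(_ (leq_trans l0 lL))/esym cL.
have := @up_bounds (lft (suf q) (LA q h)) h; rewrite /up -/(uu q h) => b.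
have rn := rgt_le T (suf q) (LA q h).
have rE : rgt (suf q) (LA q h) = lft (suf q) (LA q h) + cnt (suf q) (LA q h) by [].
have lt : uu q h * 2 ^ h < n by rewrite -/n in rn; lia.
split=> //; apply: same_le lL _; rewrite same_suf //; lia.
Qed.

End Macro.

Lemma foldr_minn_lt a s l : (foldr minn a s < l) = (a < l) || has (fun v => v < l) s.
Proof. by elim: s => [|b s IH] /=; rewrite ?orbF // gtn_min IH orbCA. Qed.

Lemma foldr_minn_le a s : foldr minn a s <= a.
Proof. by elim: s => //= b s IH; rewrite geq_min IH orbT. Qed.

Lemma nth_cat_addr (s1 s2 : seq nat) p k : size s1 = p -> nth 0 (s1 ++ s2) (p + k) = nth 0 s2 k.
Proof. by move=> <-; rewrite nth_cat ltnNge leq_addr addKn. Qed.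

Lemma nth_cat_mkseq (f : nat -> nat) p s2 k : k < p -> nth 0 (mkseq f p ++ s2) k = f k.
Proof. by move=> h; rewrite nth_cat size_mkseq h nth_mkseq. Qed.

(** * The searched arrays and the tables that tell where a search starts *)

Section Data.
Variables (T : seq nat) (lam g d : nat).
Let n := size T.
Hypotheses (n0 : 0 < n) (g0 : 0 < g) (nlam : n < 2 ^ lam.+1) (d0 : 0 < d).

Notation cnt := (cnt T).
Notation suf := (suf T).
Notation lft := (lft T).
Notation rgt := (rgt T).
Notation LA := (LA T).

(** The logarithm of a count is at most [lam]; one more level holds the value below [l] at which the
    search among the lengths [LA] stops. *)
Definition Hn := lam.+2.
Definition NR := (n %/ g).+1.
Definition rws := rows T lam g.
Definition hr r := (nth (0, 0) rws r).1.
Definition ir r := suf ((nth (0, 0) rws r).2 * 2 ^ hr r).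
Definition kr r := keys T g (ir r) (2 ^ hr r).
Definition KKs := mkseq (fun r => rcons (kr r) 0) (size rws).
Definition offK r := sumn (take r (shape KKs)).
Definition LA0 := n.*2.+2.
Definition KK0 := LA0 + NR * Hn.
(* One array is searched for four purposes: the LCP array, the same in reverse, the
   lengths [LA] of the multiples of [g], and the keys of all rows. *)
Definition VV :=
  mkseq (lcp T) n.+1 ++ mkseq (fun y => lcp T (n - y)) n.+1 ++
  mkseq (fun c => LA (c %/ Hn * g) (c %% Hn)) (NR * Hn) ++ flatten KKs.

Fixpoint V lev b :=
  if lev is lev'.+1 then
    foldr minn (V lev' (b * d)) [seq V lev' (b * d + j) | j <- iota 0 d]
  else nth 0 VV b.

Lemma V_min lev b l : (V lev.+1 b < l) = has (fun j => V lev (b * d + j) < l) (iota 0 d).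
Proof.
rewrite /= foldr_minn_lt has_map; case: d d0 => //= e _.
by rewrite addn0; case: (_ < l).
Qed.

Lemma VV_le v : v \in VV -> v <= n.
Proof.
rewrite !mem_cat; case/or4P.
- by case/mapP=> x _ ->; apply: lcp_le.
- by case/mapP=> x _ ->; apply: lcp_le.
- by case/mapP=> x _ ->; apply: LA_le.
- case/flattenP=> s /mapP[r _ ->]; rewrite mem_rcons inE => /orP[/eqP -> //|].
  by move=> h; have [] := mem_keys n0 g0 nlam h.
Qed.

Lemma V_le lev i : V lev i <= n.
Proof.
elim: lev i => [|lev IH] i /=; last exact: leq_trans (foldr_minn_le _ _) (IH _).
case: (ltnP i (size VV)) => h; last by rewrite nth_default.
by apply: VV_le; rewrite mem_nth.
Qed.

Lemma size_VV : size VV = KK0 + size (flatten KKs).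
Proof. by rewrite !size_cat !size_mkseq /KK0 /LA0; lia. Qed.

Lemma V0 b : V 0 b = nth 0 VV b.
Proof. by []. Qed.

Lemma VV_lcp q : q <= n -> nth 0 VV q = lcp T q.
Proof. by move=> h; rewrite nth_cat_mkseq. Qed.

Lemma VV_rev q : q <= n -> nth 0 VV (n.+1 + q) = lcp T (n - q).
Proof.
move=> h; rewrite nth_cat_addr ?size_mkseq //.
by rewrite nth_cat_mkseq.
Qed.

Lemma VV_LA c h : c < NR -> h < Hn -> nth 0 VV (LA0 + (c * Hn + h)) = LA (c * g) h.
Proof.
move=> cN hH; have ch := mx_lt cN hH.
rewrite (_ : LA0 + _ = n.+1 + (n.+1 + (c * Hn + h))); last by rewrite /LA0; lia.
rewrite nth_cat_addr ?size_mkseq //.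
rewrite nth_cat_addr ?size_mkseq //.
by rewrite nth_cat_mkseq // !mxE.
Qed.

Lemma VV_KK r c : r < size rws -> c <= size (kr r) ->
  nth 0 VV (KK0 + (offK r + c)) = nth 0 (rcons (kr r) 0) c.
Proof.
move=> hr hc.
rewrite (_ : KK0 + _ = n.+1 + (n.+1 + (NR * Hn + (offK r + c)))); last by rewrite /KK0 /LA0; lia.
rewrite nth_cat_addr ?size_mkseq //.
rewrite nth_cat_addr ?size_mkseq //.
rewrite nth_cat_addr ?size_mkseq //.
by rewrite /offK nth_flatten_off ?size_mkseq ?nth_mkseq // size_rcons.
Qed.

Lemma offK_lt r c : r < size rws -> c <= size (kr r) -> offK r + c < size (flatten KKs).
Proof. by move=> hr hc; apply: flatten_off_lt; rewrite ?size_mkseq ?nth_mkseq // size_rcons. Qed.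

Lemma first_rgt i l p : 0 < l -> 0 < cnt i l -> lft i l < p <= rgt i l ->
  is_first V l 0 p (rgt i l).
Proof.
move=> l0 c0 /andP[lp pr]; have rn := rgt_le T i l; split=> //.
  by rewrite V0 VV_lcp //; apply: lcp_rgt.
by move=> q /andP[pq qr]; rewrite V0 VV_lcp; [apply: (@lcp_in _ i); lia | rewrite /n; lia].
Qed.

Lemma first_lft i l p : 0 < l -> 0 < cnt i l -> lft i l <= p < rgt i l ->
  is_first V l 0 (n.+1 + (n - p)) (n.+1 + (n - lft i l)).
Proof.
move=> l0 c0 /andP[lp pr]; have := rgt_le T i l; rewrite -/n => rn; split; first by lia.
  rewrite V0 VV_rev ?leq_subr // subKn; last by lia.
  exact: lcp_lft.
move=> q hq; rewrite (_ : q = n.+1 + (q - n.+1)); last by lia.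
by rewrite V0 VV_rev; [apply: (@lcp_in _ i); lia | lia].
Qed.

(** Since [l <= LA q h] means at least 2^h matches, the first length below [l] comes right after the
    binary logarithm of the count. *)
Lemma first_LA c l : c * g < n -> 0 < l -> 0 < cnt (suf (c * g)) l ->
  let h := trunc_log 2 (cnt (suf (c * g)) l) in
  is_first V l 0 (LA0 + c * Hn) (LA0 + (c * Hn + h.+1)) /\ h.+1 < Hn.
Proof.
move=> cn l0 c0 h.
have /andP[b1 b2] := @trunc_log_bounds 2 _ isT c0; rewrite -/h in b1 b2.
have cN : c < NR by rewrite ltnS leq_divRL // ltnW.
have hH : h.+1 < Hn.
  have : 2 ^ h < 2 ^ lam.+1.
    by apply: leq_ltn_trans nlam; apply: leq_trans b1 _; apply: cnt_n.
  by rewrite ltn_exp2l // /Hn; lia.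
split=> //; split; first by lia.
  by rewrite V0 VV_LA // ltnNge (leq_LA n0 g0 nlam) // -ltnNge.
move=> q hq; rewrite (_ : q = LA0 + (c * Hn + (q - LA0 - c * Hn))); last by lia.
rewrite V0 VV_LA //; last by lia.
by rewrite (leq_LA n0 g0 nlam) //; apply: leq_trans b1; rewrite leq_exp2l //; lia.
Qed.

Lemma first_KK r l z : r < size rws -> 0 < l -> z <= nkeys T g (ir r) (2 ^ hr r) l ->
  is_first V l 0 (KK0 + offK r + z) (KK0 + (offK r + nkeys T g (ir r) (2 ^ hr r) l)).
Proof.
move=> hr l0; set c := nkeys _ _ _ _ _ => zc.
have cs : c <= size (kr r) by rewrite /c /nkeys -/(kr r) count_size.
have E : find (fun k => k < l) (rcons (kr r) 0) = c by apply: count_find_sorted => //; exact: (keys_sorted n0 g0 nlam).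
have sz : size (rcons (kr r) 0) = (size (kr r)).+1 by rewrite size_rcons.
split; first by lia.
  rewrite V0 VV_KK //; have := @nth_find _ 0 (fun k => k < l) (rcons (kr r) 0).
  by rewrite has_find E sz ltnS; apply.
move=> q hq; rewrite (_ : q = KK0 + (offK r + (q - KK0 - offK r))); last by lia.
rewrite V0 VV_KK //; last by lia.
rewrite leqNgt; have := @before_find _ 0 (fun k => k < l) (rcons (kr r) 0) (q - KK0 - offK r).
by rewrite E => ->; lia.
Qed.

(** The search among the keys of a row stops at the number [c] of keys at or above [l], one after
    the least such key; hence the entry [c] describes the key with index [c.-1]. *)
Definition KLs (fn : nat -> nat -> nat) :=
  mkseq (fun r => mkseq (fun c => fn (ir r) (nth 0 (kr r) c.-1)) (size (kr r)).+1) (size rws).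

Lemma shape_KLs fn : shape (KLs fn) = shape KKs.
Proof.
by rewrite /shape /mkseq -!map_comp; apply: eq_map => r /=; rewrite size_map size_iota size_rcons.
Qed.

Lemma nth_KLs fn r c : r < size rws -> c <= size (kr r) ->
  nth 0 (flatten (KLs fn)) (offK r + c) = fn (ir r) (nth 0 (kr r) c.-1).
Proof.
by move=> hr hc; rewrite /offK -(shape_KLs fn) nth_flatten_off ?size_mkseq ?nth_mkseq // ?size_mkseq // nth_mkseq.
Qed.

Definition K := lam.+1.
(** The lower bound [zstart] of each class is stored as an address of the searched array, so that a
    search can start from it. *)
Definition T2s :=
  mkseq (fun r => mkseq (fun c => KK0 + offK r + zstart T g (ir r) (2 ^ hr r) (c %/ K) (c %% K))
    (((2 ^ hr r).*2 %/ g).+1 * K)) (size rws).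
Definition offT r := sumn (take r (shape T2s)).

Lemma nth_T2s r a k : r < size rws -> a <= (2 ^ hr r).*2 %/ g -> k < K ->
  nth 0 (flatten T2s) (offT r + (a * K + k)) = KK0 + offK r + zstart T g (ir r) (2 ^ hr r) a k /\
  offT r + (a * K + k) < size (flatten T2s).
Proof.
move=> rs ha hk; have h := @mx_lt a k _ K (ha : a < _.+1) hk.
have sr : r < size T2s by rewrite size_mkseq.
have E := nth_mkseq [::] (fun r => mkseq (fun c => KK0 + offK r + zstart T g (ir r) (2 ^ hr r)
  (c %/ K) (c %% K)) (((2 ^ hr r).*2 %/ g).+1 * K)) rs.
by rewrite nth_flatten_off ?flatten_off_lt // E ?size_mkseq // nth_mkseq // !mxE.
Qed.

Definition rowix c := index (c %% Hn, uu T (c %/ Hn * g) (c %% Hn)) rws.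

Lemma rowix_spec c h l : c < NR -> c * g < n -> g <= 2 ^ h -> 0 < l <= LA (c * g) h ->
  let r := rowix (c * Hn + h) in
  [/\ r < size rws, hr r = h & same T l (suf (c * g)) (ir r)].
Proof.
move=> cN cn gh hl r.
have hlam : h < lam.+1.
  have /andP[l0 lL] := hl; move: lL; rewrite (leq_LA n0 g0 nlam) // => hc.
  have : 2 ^ h < 2 ^ lam.+1 by apply: leq_ltn_trans nlam; apply: leq_trans hc _; apply: cnt_n.
  by rewrite ltn_exp2l.
have hH : h < Hn by rewrite /Hn; lia.
have [sm un] := uu_spec n0 g0 nlam cn hl.
have p0 : 0 < 2 ^ h by rewrite expn_gt0.
have mem : (h, uu T (c * g) h) \in rws.
  apply/allpairsPdep; exists h, (uu T (c * g) h); split=> //.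
    by rewrite mem_filter gh mem_iota.
  by rewrite mem_iota /= add0n ltnS leq_divRL // ltnW.
have rE : r = index (h, uu T (c * g) h) rws by rewrite /r /rowix !mxE.
have E : nth (0, 0) rws r = (h, uu T (c * g) h) by rewrite rE nth_index.
split; first by rewrite rE index_mem.
  by rewrite /hr E.
by rewrite /ir /hr E.
Qed.

End Data.

(** * Evaluating the searches from tables *)

Declare Scope exp_scope.
Delimit Scope exp_scope with X.
Bind Scope exp_scope with exp.
Notation "e1 + e2" := (Bop Add e1 e2) : exp_scope.
Notation "e1 - e2" := (Bop Defs.Sub e1 e2) : exp_scope.
Notation "e1 * e2" := (Bop Mul e1 e2) : exp_scope.
Notation "e1 / e2" := (Bop Div e1 e2) : exp_scope.
Notation "e1 %% e2" := (Bop Mod e1 e2) : exp_scope.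
Notation "e1 <<< e2" := (Bop Shl e1 e2) (at level 35) : exp_scope.
Notation "e1 >>> e2" := (Bop Shr e1 e2) (at level 35) : exp_scope.
Notation "e1 == e2" := (Bop Eq e1 e2) : exp_scope.
Notation "e1 < e2" := (Bop Lt e1 e2) : exp_scope.
Notation "# i" := (Var i) (at level 2, format "# i") : exp_scope.
Notation "$ v" := (Cst v) (at level 2, format "$ v") : exp_scope.

(* The length n is stored at address 0 and the address of table t at 4n + t. *)
Definition lenE : exp := Rd ($0)%X.
Definition Tb (t : nat) (e : exp) : exp := Rd (Rd ($4 * lenE + $t) + e)%X.
Definition prm (t : nat) : exp := Tb t ($0)%X.
(** [N] must be the number of variables in scope: the arguments become the variables [N] and [N.+1],
    and the body sees them as [#0] and [#1] wherever it is inserted. *)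
Definition call2 N (e1 e2 body : exp) := Let e1 (Let e2 (Fr [:: N; N.+1] body)).
Definition call3 N (e1 e2 e3 body : exp) :=
  Let e1 (Let e2 (Let e3 (Fr [:: N; N.+1; N.+2] body))).

Section Ev.
Variables (w D n : nat) (m : nat -> nat).
Hypotheses (n0 : 0 < n) (m0 : m 0 = n) (nD : 4 * n < D) (Dw : D < 2 ^ w).
Notation ev := (eval w D m).

(** All addresses lie below [D], where the reduction made by [Rd] changes nothing. *)
Definition tab t (F : nat -> nat) N :=
  4 * n + t < D /\ forall a, a < N -> m (4 * n + t) + a < D /\ m (m (4 * n + t) + a) = F a.

Lemma evC vs v : v < 2 ^ w -> ev vs (Cst v) = v.
Proof. exact: modn_small. Qed.

Lemma evAdd vs e1 e2 a b v : ev vs e1 = a -> ev vs e2 = b -> v = a + b -> v < 2 ^ w ->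
  ev vs (e1 + e2)%X = v.
Proof. by move=> /= -> -> -> h; rewrite /eval_op modn_small. Qed.

Lemma evSub vs e1 e2 a b v : ev vs e1 = a -> ev vs e2 = b -> b <= a -> v = a - b -> a < 2 ^ w ->
  ev vs (e1 - e2)%X = v.
Proof.
move=> /= -> -> ba -> h; rewrite /eval_op addnBA; last by lia.
by rewrite addnC -addnBA // modnDl modn_small //; lia.
Qed.

Lemma evMul vs e1 e2 a b v : ev vs e1 = a -> ev vs e2 = b -> v = a * b -> v < 2 ^ w ->
  ev vs (e1 * e2)%X = v.
Proof. by move=> /= -> -> -> h; rewrite /eval_op modn_small. Qed.

Lemma evDiv vs e1 e2 a b v : ev vs e1 = a -> ev vs e2 = b -> v = a %/ b -> a < 2 ^ w ->
  ev vs (e1 / e2)%X = v.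
Proof.
by move=> /= -> -> -> h; rewrite /eval_op modn_small //; apply: leq_ltn_trans h; apply: leq_div.
Qed.

Lemma evMod vs e1 e2 a b v : ev vs e1 = a -> ev vs e2 = b -> v = a %% b -> a < 2 ^ w ->
  ev vs (e1 %% e2)%X = v.
Proof.
by move=> /= -> -> -> h; rewrite /eval_op modn_small //; apply: leq_ltn_trans h; apply: leq_mod.
Qed.

Lemma evShl vs e1 e2 a b v : ev vs e1 = a -> ev vs e2 = b -> v = a * 2 ^ b -> v < 2 ^ w ->
  ev vs (e1 <<< e2)%X = v.
Proof. by move=> /= -> -> -> h; rewrite /eval_op modn_small. Qed.

Lemma evShr vs e1 e2 a b v : ev vs e1 = a -> ev vs e2 = b -> v = a %/ 2 ^ b -> a < 2 ^ w ->
  ev vs (e1 >>> e2)%X = v.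
Proof.
by move=> /= -> -> -> h; rewrite /eval_op modn_small //; apply: leq_ltn_trans h; apply: leq_div.
Qed.

Lemma w1 : 1 < 2 ^ w. Proof. lia. Qed.

Lemma bool_w (b : bool) : (b : nat) %% 2 ^ w = b.
Proof. by rewrite modn_small //; have := w1; case: b; lia. Qed.

Lemma evEq vs e1 e2 a b v : ev vs e1 = a -> ev vs e2 = b -> v = (a == b) ->
  ev vs (e1 == e2)%X = v.
Proof. by move=> /= -> -> ->; rewrite /eval_op bool_w. Qed.

Lemma evLt vs e1 e2 a b v : ev vs e1 = a -> ev vs e2 = b -> v = (a < b) ->
  ev vs (e1 < e2)%X = v.
Proof. by move=> /= -> -> ->; rewrite /eval_op bool_w. Qed.

Lemma evLet vs e1 e2 v r : ev vs e1 = v -> ev (rcons vs v) e2 = r -> ev vs (Let e1 e2) = r.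
Proof. by move=> /= ->. Qed.

Lemma evIte vs e1 e2 e3 (b : bool) v : ev vs e1 = b ->
  (b -> ev vs e2 = v) -> (~~ b -> ev vs e3 = v) -> ev vs (Ite e1 e2 e3) = v.
Proof. by move=> /= ->; case: b => /= [/(_ isT) ->|_ /(_ isT) ->]. Qed.

Lemma evcall2 vs N e1 e2 body a b v : size vs = N -> ev vs e1 = a -> ev (rcons vs a) e2 = b ->
  ev [:: a; b] body = v -> ev vs (call2 N e1 e2 body) = v.
Proof.
move=> <- /= -> -> <-; rewrite !size_rcons leqnSn ltnSn /= !nth_rcons !size_rcons.
by rewrite !(ltnSn, ltnn, eqxx).
Qed.

Lemma evcall3 vs N e1 e2 e3 body a b c v : size vs = N -> ev vs e1 = a ->
  ev (rcons vs a) e2 = b -> ev (rcons (rcons vs a) b) e3 = c ->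
  ev [:: a; b; c] body = v -> ev vs (call3 N e1 e2 e3 body) = v.
Proof.
move=> <- /= -> -> -> <-; rewrite !size_rcons.
have -> : size vs < (size vs).+3 by lia.
have -> : (size vs).+1 < (size vs).+3 by lia.
have -> : (size vs).+2 < (size vs).+3 by lia.
have l2 : size vs < (size vs).+2 by lia.
by rewrite /= !nth_rcons !size_rcons !(l2, ltnSn, ltnn, eqxx).
Qed.

Lemma evlen vs : ev vs lenE = n.
Proof. by rewrite /= mod0n mod0n m0. Qed.

Lemma evT t F N vs e a v : tab t F N -> ev vs e = a -> a < N -> F a = v -> ev vs (Tb t e) = v.
Proof.
case=> tD H ea aN <-; have [h1 h2] := H a aN.
have h4 : 4 < 2 ^ w by lia.
have hA : ev vs ($4 * lenE + $t)%X = 4 * n + t.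
  apply: evAdd; last by lia.
  - by apply: evMul; [exact: evC | exact: evlen | reflexivity | lia].
  - by apply: evC; lia.
  - by [].
rewrite /Tb [LHS]/= -[eval_op w Add (eval_op _ _ _ _) _]/(ev vs ($4 * lenE + $t)%X) hA ea.
by rewrite (modn_small tD) /eval_op (@modn_small _ (2 ^ w)) ?modn_small // (ltn_trans h1).
Qed.

Lemma tab_le t F N : tab t F N -> N <= D.
Proof. by case=> _ H; case: N H => // N /(_ N (ltnSn _)) [h _]; lia. Qed.

Lemma evP t v vs : tab t (fun=> v) 1 -> ev vs (prm t) = v.
Proof. by move=> h; apply: (evT h); rewrite /= ?mod0n. Qed.

Lemma evMx vs e1 eB e2 a B' b A v : ev vs e1 = a -> ev vs eB = B' -> ev vs e2 = b ->
  a < A -> b < B' -> A * B' <= D -> v = a * B' + b -> ev vs (e1 * eB + e2)%X = v.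
Proof.
move=> h1 h2 h3 aA bB AB ->; have h := mx_lt aA bB.
apply: (evAdd (a := a * B') (b := b)) => //; last by lia.
by apply: (evMul h1 h2) => //; lia.
Qed.

Lemma evT2 t F A B' vs e1 eB e2 a b v : tab t F (A * B') -> ev vs e1 = a -> ev vs eB = B' ->
  ev vs e2 = b -> a < A -> b < B' -> F (a * B' + b) = v -> ev vs (Tb t (e1 * eB + e2)%X) = v.
Proof.
move=> ht h1 h2 h3 aA bB E; apply: (evT ht _ (mx_lt aA bB) E).
by apply: (evMx h1 h2 h3 aA bB) => //; apply: tab_le ht.
Qed.

(** The evaluation of [ff] in one block. Variables: 0 the block, 1 the first slot allowed, 2 the
    key, 3 and 4 its halves, 5 and 6 their sketches, 7 the slot found blindly, 8 its index over all
    blocks, 9 its value, 10 the level at which the key leaves this value. *)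
Definition FBE : exp := (
  Let (#2 / prm 0) (
  Let (#2 %% prm 0) (
  Let (Tb 14 (Tb 18 (#0) * prm 0 + #3)) (
  Let (Tb 14 (Tb 19 (#0) * prm 0 + #4)) (
  Let (Tb 16 ((Tb 20 (#0) * prm 1 + #5) * prm 1 + #6)) (
  Let (#0 * prm 2 + #7) (
  Let (Tb 21 (#8)) (
  Let (Ite (#3 == #9 / prm 0) (Tb 15 (#4 * prm 0 + #9 %% prm 0))
                              (prm 3 + Tb 15 (#3 * prm 0 + #9 / prm 0))) (
  Tb 17 (((Tb 22 (#8) * prm 4 + #10) * $2 + (#9 < #2)) * prm 2 + #1))))))))))%X.

Fixpoint NXE (f lev : nat) : exp :=
  if f is f'.+1 then (
    Let (#0 / prm 2) (
    Let (call3 3 ($lev * prm 5 + #2) (#0 %% prm 2) (#1) FBE) (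
    Ite (#3 < prm 2) (#2 * prm 2 + #3) (
    Let (call2 4 (#2 + $1) (#1) (NXE f' lev.+1)) (
    #4 * prm 2 + call3 5 ($lev * prm 5 + #4) ($0) (#1) FBE)))))%X
  else (#0)%X.

Variables (d be NB La : nat) (V : nat -> nat -> nat).
Hypotheses (d1 : 1 < d) (NB0 : 0 < NB).
Definition ykey lev b j := (V lev (b * d + j)).*2.+1.
Hypothesis VW : forall lev i, V lev i <= n.
Hypothesis nW : n.*2.+1 < 2 ^ W be.
Hypothesis V_min : forall lev b l,
  (V lev.+1 b < l) = has (fun j => V lev (b * d + j) < l) (iota 0 d).

(* Block b of level lev is numbered lev * NB + b; keys are odd and queries even, so
   that they never coincide. *)
Definition perb (f : (nat -> nat) -> nat) bid := f (ykey (bid %/ NB) (bid %% NB)).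
Definition perbd (f : (nat -> nat) -> nat -> nat) c := perb (fun y => f y (c %% d)) (c %/ d).

Hypotheses
  (h0 : tab 0 (fun=> B be) 1) (h1 : tab 1 (fun=> Sg d) 1) (h2 : tab 2 (fun=> d) 1)
  (h3 : tab 3 (fun=> be) 1) (h4 : tab 4 (fun=> (W be).+1) 1) (h5 : tab 5 (fun=> NB) 1)
  (h14 : tab 14 (px d be) (#|PosT d be| * B be)) (h15 : tab 15 (lvt be) (B be * B be))
  (h16 : tab 16 (u1 d) (Sg d * Sg d * Sg d))
  (h17 : tab 17 (u2 d be) (#|LevT d be| * (W be).+1 * 2 * d))
  (h18 : tab 18 (perb (cc1 d be)) (La * NB)) (h19 : tab 19 (perb (cc2 d be)) (La * NB))
  (h20 : tab 20 (perb (@occ d)) (La * NB)) (h21 : tab 21 (perbd id) (La * NB * d))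
  (h22 : tab 22 (perbd (qcc d be)) (La * NB * d)).

Lemma perbE f lev b : b < NB -> perb f (lev * NB + b) = f (ykey lev b).
Proof. by move=> h; rewrite /perb !mxE. Qed.

Lemma FBE_ok lev b y0 l : lev < La -> b < NB -> y0 < d -> l <= n ->
  ev [:: lev * NB + b; y0; l.*2] FBE = fb V d l lev b y0.
Proof.
move=> lLa bNB y0d ln.
have bid := mx_lt lLa bNB; set bi := lev * NB + b in bid *.
pose y := ykey lev b.
have yW j : j < d -> y j < 2 ^ W be.
  by move=> _; apply: leq_ltn_trans nW; rewrite ltnS leq_double VW.
have xW : l.*2 < 2 ^ W be by apply: leq_ltn_trans nW; lia.
have d0 : 0 < d by lia.
have B0 := B0 be.
have -> : fb V d l lev b y0 = ff d be y l.*2 y0.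
  rewrite ffE //; last by move=> j _; rewrite /y /ykey; lia.
  by apply: eq_find => j; congr (_ && _); rewrite /y /ykey; lia.
have hx := hi_lt xW; have lx : l.*2 %% B be < B be by rewrite ltn_mod.
have e0 vs := evP vs h0; have e1 vs := evP vs h1; have e2 vs := evP vs h2.
have e3 vs := evP vs h3; have e4 vs := evP vs h4.
have BD := tab_le h15.
have lw : l.*2 < 2 ^ w by rewrite WB in xW; lia.
have ad := @fa_lt d be d0 y l.*2; set a := fa d be y l.*2 in ad.
have yaW := yW _ ad.
have yaw : y a < 2 ^ w by rewrite WB in yaW; lia.
have bdD := tab_le h21.
rewrite /FBE; apply: evLet; first by apply: evDiv (e0 _) _ _ => //.
apply: evLet; first by apply: evMod (e0 _) _ _ => //.
rewrite [rcons _ _]/=; set hi := _ %/ _; set lo := _ %% _.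
apply: evLet.
  apply: (evT2 (a := cc1 d be y) (b := hi) h14) => //; first by apply: (evT h18) => //; rewrite perbE.
  exact: enc_lt.
apply: evLet.
  apply: (evT2 (a := cc2 d be y) (b := lo) h14) => //; first by apply: (evT h19) => //; rewrite perbE.
  exact: enc_lt.
rewrite -/(fsk1 d be y l.*2) -/(fsk2 d be y l.*2).
apply: evLet.
  apply: (evT2 (A := Sg d * Sg d) (a := occ d y * Sg d + fsk1 d be y l.*2) (b := fsk2 d be y l.*2) h16) => //.
  - apply: (evMx (A := Sg d) (a := occ d y) (b := fsk1 d be y l.*2)) => //; first by apply: (evT h20) => //; rewrite perbE.
    + exact: enc_lt.
    + by rewrite /= /fsk1 /px; apply: enc_lt.
    + by apply: leq_trans (tab_le h16); rewrite leq_pmulr // /Sg; apply: leq_ltn_trans (enc_lt (bit0 d)).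
  - by apply: mx_lt; rewrite ?enc_lt.
  - by rewrite /= /fsk2 /px; apply: enc_lt.
rewrite -/(fa d be y l.*2) -/a.
have slot : bi * d + a < La * NB * d by apply: mx_lt.
apply: (evLet (v := bi * d + a)); first by apply: (evMx (A := La * NB) (a := bi) (b := a)).
apply: (evLet (v := y a)).
  by apply: (evT (a := bi * d + a) h21) => //; rewrite /perbd !mxE // perbE.
have hya := hi_lt yaW; have lya : y a %% B be < B be by rewrite ltn_mod.
have fE := flvE xW yaW.
apply: (evLet (v := flv be l.*2 (y a))).
  apply: (evIte (b := hi == y a %/ B be)).
  - by apply: (evEq (a := hi) (b := y a %/ B be)) => //; apply: evDiv (e0 _) _ _.
  - move=> e; apply: (evT2 (a := lo) (b := y a %% B be) h15) => //; first by apply: evMod (e0 _) _ _.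
    by rewrite /flv -/hi e.
  - move=> e; apply: evAdd; first exact: e3.
    + by apply: (evT2 (a := hi) (b := y a %/ B be) h15) => //; apply: evDiv (e0 _) _ _.
    + by rewrite /flv -/hi (negbTE e).
    + rewrite fE; have := lev_le (W be) l.*2 (y a); have : W be < 2 ^ W be by rewrite ltn_expl.
      by rewrite WB; lia.
rewrite [rcons _ _]/=; set P := flv _ _ _.
have PW : P < (W be).+1 by rewrite /P fE ltnS lev_le.
have h17D := tab_le h17.
have lev0 : 0 < #|LevT d be| by apply: leq_ltn_trans (enc_lt (lev0 d be)).
have q1 : qcc d be y a * (W be).+1 + P < #|LevT d be| * (W be).+1 by rewrite mx_lt // enc_lt.
have b2 : nat_of_bool (y a < l.*2) < 2 by case: (y a < l.*2).
set qP := qcc d be y a * (W be).+1 + P in q1.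
apply: (evT2 (A := #|LevT d be| * (W be).+1 * 2) (a := qP * 2 + (y a < l.*2)) (b := y0) h17) => //.
  apply: (evMx (A := #|LevT d be| * (W be).+1) (B' := 2) (a := qP) (b := (y a < l.*2))) => //.
  - apply: (evMx (A := #|LevT d be|) (a := qcc d be y a) (b := P)) => //.
    + by apply: (evT (a := bi * d + a) h22) => //; rewrite /perbd !mxE // perbE.
    + exact: enc_lt.
    + by apply: leq_trans h17D; rewrite -mulnA leq_pmulr // muln_gt0.
  - by apply: evC; lia.
  - exact: evLt.
  - by apply: leq_trans h17D; rewrite leq_pmulr.
by apply: mx_lt.
Qed.

(** An answer [q] inside the array bounds all blocks that are visited, so that no table is read out
    of its range. *)
Lemma NXE_ok f : forall lev pos q l, lev + f <= La -> is_first V l lev pos q -> q < NB * d ->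
  l <= n -> ev [:: pos; l.*2] (NXE f lev) = nx V d l f lev pos.
Proof.
elim: f => // f IH lev pos q l lf fi qNB ln; have [pq Vq Hq] := fi.
have d0 : 0 < d by lia.
have e2 vs := evP vs h2; have e5 vs := evP vs h5.
have lLa : lev < La by lia.
have uNB : pos %/ d < NB by rewrite ltn_divLR //; apply: leq_ltn_trans qNB.
have vd : pos %% d < d by rewrite ltn_mod.
have LD := tab_le h21; have LD' := tab_le h20.
have NBd : NB * d <= D by apply: leq_trans LD; rewrite -mulnA leq_pmull //; lia.
have NBle : NB <= NB * d by rewrite leq_pmulr.
have pw : pos < 2 ^ w by lia.
have levw : lev < 2 ^ w by nia.
have fbd b y : fb V d l lev b y <= d by exact: find_iota_le.
rewrite [NXE _ _]/=; apply: (evLet (v := pos %/ d)).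
  exact: (evDiv (a := pos) (b := d)).
rewrite [rcons _ _]/=; set u := pos %/ d; set v := pos %% d.
have bidE vs b e : b < NB -> ev vs e = b -> ev vs ($lev * prm 5 + e)%X = lev * NB + b.
  by move=> bN eb; apply: (evMx (A := La) (a := lev) (B' := NB) (b := b)) => //; apply: evC.
apply: (evLet (v := fb V d l lev u v)).
  apply: (evcall3 (a := lev * NB + u) (b := v) (c := l.*2)) => //; first exact: bidE.
    exact: (evMod (a := pos) (b := d)).
  exact: FBE_ok.
rewrite [rcons _ _]/= -/u -/v; set r := fb V d l lev u v.
rewrite [RHS]/= -/u -/v -/r.
apply: (evIte (b := r < d)); first by apply: (evLt (a := r) (b := d)).
  by move=> rd; rewrite rd; apply: (evMx (A := NB) (a := u) (B' := d) (b := r)).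
move=> rd; rewrite (negbTE rd).
have [/andP[n1 n2] n3] := nx_spec d0 (fun lev b => V_min lev b l) f.+1 fi.
rewrite /= -/u -/v -/r (negbTE rd) in n1 n2; set b := nx V d l f lev.+1 u.+1 in n1 n2 *.
have fi' : is_first V l lev.+1 u.+1 (q %/ d).
  have qE := divn_eq q d; have qm : q %% d < d by rewrite ltn_mod.
  have pE := divn_eq pos d; rewrite -/u -/v in pE.
  have nofb j : v <= j < d -> l <= V lev (u * d + j).
    move=> /andP[vj jd]; have rE : r = d by apply/eqP; rewrite eqn_leq fbd leqNgt.
    have : j < r by rewrite rE.
    by move/find_iotaF; rewrite vj /= -leqNgt.
  split.
  - rewrite ltnNge; apply/negP => le.
    have : u * d <= q by lia.
    have uq : q %/ d = u by apply/eqP; rewrite eqn_leq le leq_div2r.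
    rewrite uq in qE; have := nofb (q %% d); rewrite qm -qE.
    by rewrite (_ : v <= _); [move=> /(_ isT); lia | lia].
  - by rewrite V_min; apply/hasP; exists (q %% d); rewrite ?mem_iota // -qE.
  - move=> s /andP[us sq]; rewrite leqNgt V_min; apply/hasPn => j.
    rewrite mem_iota /= add0n -leqNgt => jd; apply: Hq.
    have : u.+1 * d <= s * d by rewrite leq_mul2r us orbT.
    have : s.+1 * d <= q %/ d * d by rewrite leq_mul2r sq orbT.
    by rewrite !mulSn; lia.
have bq : b * d <= q by lia.
have bNB : b < NB by rewrite -(@ltn_pmul2r d) //; lia.
have qd : q %/ d < NB by rewrite ltn_divLR.
apply: (evLet (v := b)).
  apply: (evcall2 (a := u.+1) (b := l.*2)) => //.
    by apply: (evAdd (a := u) (b := 1)); [| exact: evC w1 | rewrite addn1 | lia].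
  apply: (IH _ _ (q %/ d)) => //; first by lia.
  by apply: leq_trans qd _; rewrite leq_pmulr.
rewrite [rcons _ _]/=; apply: (evAdd (a := b * d) (b := fb V d l lev b 0)); last 1 first.
- by apply: leq_ltn_trans n2 _; lia.
- by apply: (evMul (a := b) (b := d)) => //; lia.
- apply: (evcall3 (a := lev * NB + b) (b := 0) (c := l.*2)) => //; first exact: bidE.
    by rewrite /= mod0n.
  exact: FBE_ok.
- by [].
Qed.

End Ev.

(** * Evaluating the interval of a substring *)

(** An end out of reach is at distance at least [q], more than [2g + 1], from [p]: rounding towards
    it to a multiple of [g] stays inside the interval. If the right end was found, the left one is
    far, and [p] is rounded down. *)
Lemma rep_exists (ok1 : bool) p a b g q : 0 < g -> g.*2.+1 < q -> a <= p < b ->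
  (ok1 -> a + q <= p) -> (~~ ok1 -> p + q < b) ->
  let c := if ok1 then p %/ g else (p + g - 1) %/ g in a <= c * g < b /\ q <= b - a.
Proof.
move=> g0 gq pin h1 h2; case: ok1 h1 h2 => [/(_ isT) h _|_ /(_ isT) h] c.
  have := divn_eq p g; have : p %% g < g by rewrite ltn_mod.
  by rewrite -/c; lia.
have := divn_eq (p + g - 1) g; have : (p + g - 1) %% g < g by rewrite ltn_mod.
by rewrite -/c; lia.
Qed.

Section Loc.
Variables (La : nat).
Definition NX := NXE La 0.

(* Arguments: a 0-based position and a length.  The number after each [Let] is that
   of the variable it binds. *)
Definition LocE (right : bool) : exp := (
  Let (#1 * $2) (                                  (* 2 *)
  Let (Tb 24 (#0)) (                               (* 3 *)
  Let (call2 4 (#3 + $1) (#2) NX) (                (* 4 *)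
  Let (call2 5 (lenE + $1 + (lenE - #3)) (#2) NX) ( (* 5 *)
  Let (Tb 23 (#4) < #1) (                          (* 6 *)
  Let (Tb 23 (#5) < #1) (                          (* 7 *)
  Ite (#6 * #7) (if right then #4 else lenE + lenE + $1 - #5) (
  Let (Ite (#6) (#3 / prm 6) ((#3 + prm 6 - $1) / prm 6)) ( (* 8 *)
  Let (prm 10 + #8 * prm 7) (                      (* 9 *)
  Let (call2 10 (#9) (#2) NX - #9 - $1) (           (* 10 *)
  Let (Tb 25 (#8 * prm 7 + #10)) (                 (* 11 *)
  Let (Tb 26 (#11)) (                              (* 12 *)
  Let ((#12 + #1 + prm 6 - $1) / prm 6) (          (* 13 *)
  Let (Tb 29 (#10 * prm 8 + #13)) (                (* 14 *)
  Let (Tb 30 (#14 + $1 - #12)) (                   (* 15 *)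
  Let (#14 >>> #15 - (#12 + ($1 <<< #15) - $1) >>> #15) ( (* 16 *)
  Let (Tb 31 (((#10 * prm 9 + #15) * prm 8 + #13) * $2 + #16)) ( (* 17 *)
  Let (Tb 32 (Tb 28 (#11) + (#17 * prm 9 + #15))) ( (* 18 *)
  Let (call2 19 (#18) (#2) NX - prm 11) (          (* 19 *)
  if right then call2 20 (Tb 34 (#19)) (#2) NX
  else lenE + lenE + $1 - call2 20 (lenE + $1 + (lenE - Tb 33 (#19))) (#2) NX
  ))))))))))))))))))))%X.

Variables (w D : nat) (m : nat -> nat) (T : seq nat).
Let n := size T.
Hypotheses (n0 : 0 < n) (m0 : m 0 = n) (nD : 4 * n < D) (Dw : D < 2 ^ w).
Notation ev := (eval w D m).
Notation tab := (tab D n m).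

Variables (lam g d be NB : nat).
Hypotheses (d1 : 1 < d) (NB0 : 0 < NB) (g0 : 0 < g) (nlam : n < 2 ^ lam.+1).
Notation V := (V T lam g d).
Hypothesis nW : n.*2.+1 < 2 ^ W be.
Notation perb := (perb d NB V).
Notation perbd := (perbd d NB V).
Notation rws := (rws T lam g).
Notation cnt := (cnt T).
Notation suf := (suf T).
Notation lft := (lft T).
Notation rgt := (rgt T).
Notation EBn := (EB T g).
Notation Kn := (K lam).
Notation Hm := (Hn lam).

Hypotheses
  (h0 : tab 0 (fun=> B be) 1) (h1 : tab 1 (fun=> Sg d) 1) (h2 : tab 2 (fun=> d) 1)
  (h3 : tab 3 (fun=> be) 1) (h4 : tab 4 (fun=> (W be).+1) 1) (h5 : tab 5 (fun=> NB) 1)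
  (h6 : tab 6 (fun=> g) 1) (h7 : tab 7 (fun=> Hm) 1) (h8 : tab 8 (fun=> EBn) 1)
  (h9 : tab 9 (fun=> Kn) 1) (h10 : tab 10 (fun=> LA0 T) 1) (h11 : tab 11 (fun=> KK0 T lam g) 1)
  (h14 : tab 14 (px d be) (#|PosT d be| * B be)) (h15 : tab 15 (lvt be) (B be * B be))
  (h16 : tab 16 (u1 d) (Sg d * Sg d * Sg d))
  (h17 : tab 17 (u2 d be) (#|LevT d be| * (W be).+1 * 2 * d))
  (h18 : tab 18 (perb (cc1 d be)) (La * NB)) (h19 : tab 19 (perb (cc2 d be)) (La * NB))
  (h20 : tab 20 (perb (@occ d)) (La * NB)) (h21 : tab 21 (perbd id) (La * NB * d))
  (h22 : tab 22 (perbd (qcc d be)) (La * NB * d))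
  (h23 : tab 23 (nth 0 (VV T lam g)) (size (VV T lam g)))
  (h24 : tab 24 (fun i => index i (sa T)) n)
  (h25 : tab 25 (rowix T lam g) (NR T g * Hm))
  (h26 : tab 26 (ir T lam g) (size rws))
  (h28 : tab 28 (offT T lam g) (size rws))
  (h29 : tab 29 (fun c => xmax T (2 ^ (c %/ EBn)) (c %% EBn * g)) (lam.+1 * EBn))
  (h30 : tab 30 (trunc_log 2) n.+1)
  (h31 : tab 31 (fun c => T1 T g (2 ^ (c %/ 2 %/ EBn %/ Kn)) (c %/ 2 %/ EBn %% Kn)
            (c %/ 2 %% EBn * g) (c %% 2)) (lam.+1 * Kn * EBn * 2))
  (h32 : tab 32 (nth 0 (flatten (T2s T lam g))) (size (flatten (T2s T lam g))))
  (h33 : tab 33 (nth 0 (flatten (KLs T lam g lft))) (size (flatten (KKs T lam g))))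
  (h34 : tab 34 (nth 0 (flatten (KLs T lam g rgt))) (size (flatten (KKs T lam g)))).
Hypotheses (hNB : size (VV T lam g) <= NB * d) (hg : g.*2.+1 < d ^ La) (hH : Hm <= d ^ La)
  (La0 : 0 < La) (nb3 : n.*2 + g.*2 + 2 <= D) (nb4 : 2 ^ lam + n < D).

Let d0 : 0 < d. Proof. lia. Qed.

Lemma NX_ok pos q l : is_first V l 0 pos q -> q < size (VV T lam g) -> l <= n ->
  exists2 r, ev [:: pos; l.*2] NX = r & pos <= r <= q /\ (q < pos + d ^ La -> r = q).
Proof.
move=> fi qs ln; exists (nx V d l La 0 pos).
  apply: (NXE_ok n0 m0 nD Dw d1 NB0 _ nW _ h0 h1 h2 h3 h4 h5 h14 h15 h16 h17 h18 h19 h20 h21 h22 _ fi) => //.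
  - by move=> lev i; apply: (V_le d n0 g0 nlam).
  - by move=> lev b l'; apply: (V_min T lam g d0).
  - exact: leq_trans hNB.
by apply: nx_spec => // lev b; apply: (V_min T lam g d0).
Qed.

Lemma VV_lt q l i : 0 < l -> 0 < cnt i l -> q < rgt i l -> lft i l < q ->
  (nth 0 (VV T lam g) q < l) = false.
Proof.
move=> l0 c0 qr lq; have rn := rgt_le T i l.
rewrite VV_lcp; last by rewrite -/n in rn *; lia.
by apply: negbTE; rewrite -leqNgt; apply: (@lcp_in T i) => //; rewrite lq.
Qed.

Lemma size_VV_ge : n.*2.+2 <= size (VV T lam g).
Proof. by rewrite (size_VV n0 g0 nlam d0) /KK0 /LA0 -addnA leq_addr. Qed.

Lemma LocE_ok right i l : i < n -> 0 < l -> i + l <= n ->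
  ev [:: i; l] (LocE right) = if right then rgt i l else lft i l.
Proof.
move=> i_n l0 iln; have ln : l <= n by lia.
have sV := size_VV_ge; have D4 : 4 < 2 ^ w by lia.
set p := index i (sa T).
have pn : p < n.
  by rewrite /p /n -(size_sa T) index_mem (perm_mem (perm_sa T)) mem_iota.
have sp : suf p = i by apply: nth_index; rewrite (perm_mem (perm_sa T)) mem_iota.
have pin : lft i l <= p < rgt i l by rewrite -same_suf // sp same_refl.
have rn : rgt i l <= n := rgt_le T i l.
have rE : rgt i l = lft i l + cnt i l by [].
have c0 : 0 < cnt i l by lia.
have e1 vs : ev vs ($1)%X = 1 by apply: evC; lia.
have e2 vs : ev vs ($2)%X = 2 by apply: evC; lia.
have en vs : ev vs lenE = n := evlen w D m0 vs.
have e6 vs : ev vs (prm 6) = g := evP n0 m0 nD Dw vs h6.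
have e7 vs : ev vs (prm 7) = Hm := evP n0 m0 nD Dw vs h7.
have e8 vs : ev vs (prm 8) = EBn := evP n0 m0 nD Dw vs h8.
have e9 vs : ev vs (prm 9) = Kn := evP n0 m0 nD Dw vs h9.
have e10 vs : ev vs (prm 10) = LA0 T := evP n0 m0 nD Dw vs h10.
have e11 vs : ev vs (prm 11) = KK0 T lam g := evP n0 m0 nD Dw vs h11.
have eT := evT n0 m0 nD Dw.
have sVD : size (VV T lam g) <= D := tab_le n0 m0 nD Dw h23.
have w32 : 2 ^ lam < 2 ^ w by lia.
have inr1 : lft i l < p.+1 <= rgt i l by lia.
have [|r1 er1 [/andP[pr1 r1R] r1E]] := NX_ok (first_rgt n0 g0 nlam d0 l0 c0 inr1) _ ln; first by lia.
have [|y1 ey1 [/andP[py1 y1L] y1E]] := NX_ok (first_lft n0 g0 nlam d0 l0 c0 pin) _ ln; first by rewrite -/n; lia.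
rewrite -/n in py1 y1L y1E ey1.
(* Beyond its horizon the search returns an earlier index, where the entry is not below [l]; looking
   up the entry tells whether the end was really found. *)
set okr := nth 0 (VV T lam g) r1 < l; set okl := nth 0 (VV T lam g) y1 < l.
have okrE : okr -> r1 = rgt i l.
  move=> h; apply/eqP; rewrite eqn_leq r1R leqNgt; apply/negP => lt.
  by have := VV_lt l0 c0 lt; rewrite -/okr h => H; have //: true = false by apply: H; lia.
have okrN : ~~ okr -> p + d ^ La < rgt i l.
  move=> h; rewrite ltnNge; apply/negP => le; case/negP: h; rewrite /okr r1E; last by lia.
  by rewrite VV_lcp //; apply: lcp_rgt.
have y1n : y1 = n.+1 + (n - (n.*2.+1 - y1)) by lia.
have oklE : okl -> n.*2.+1 - y1 = lft i l.
  rewrite /okl y1n VV_rev ?leq_subr // -/n subKn; last by lia.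
  set c := n.*2.+1 - y1 => h; apply/eqP; rewrite eqn_leq; apply/andP; split; last by lia.
  by rewrite leqNgt; apply/negP => lt; have := @lcp_in T i l c l0; lia.
have oklN : ~~ okl -> lft i l + d ^ La <= p.
  move=> h; rewrite leqNgt; apply/negP => le; case/negP: h; rewrite /okl y1E; last by lia.
  by rewrite VV_rev ?leq_subr // -/n subKn; [apply: lcp_lft | lia].
rewrite /LocE; apply: (evLet (v := l.*2)); first by apply: (evMul (a := l) (b := 2)) => //; lia.
apply: (evLet (v := p)); first exact: (eT _ _ _ _ _ _ _ h24).
rewrite [rcons _ _]/=.
apply: (evLet (v := r1)).
  apply: (evcall2 (a := p.+1) (b := l.*2)) => //.
  by apply: (evAdd (a := p) (b := 1)); rewrite ?addn1 //; lia.
apply: (evLet (v := y1)).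
  apply: (evcall2 (a := n.+1 + (n - p)) (b := l.*2)) => //.
  apply: (evAdd (a := n.+1) (b := n - p)) => //; last by lia.
    by apply: (evAdd (a := n) (b := 1)); rewrite ?addn1 //; lia.
  by apply: (evSub n0 m0 nD Dw (a := n) (b := p)) => //; lia.
rewrite [rcons _ _]/=.
apply: (evLet (v := okr)).
  apply: (evLt n0 m0 nD Dw (a := nth 0 (VV T lam g) r1) (b := l)) => //.
  by apply: (eT _ _ _ _ _ r1 _ h23) => //; lia.
apply: (evLet (v := okl)).
  apply: (evLt n0 m0 nD Dw (a := nth 0 (VV T lam g) y1) (b := l)) => //.
  by apply: (eT _ _ _ _ _ y1 _ h23) => //; lia.
rewrite [rcons _ _]/=.
have fin y vs : ev vs y = n.+1 + (n - lft i l) -> ev vs (lenE + lenE + $1 - y)%X = lft i l.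
  move=> ey; apply: (evSub n0 m0 nD Dw (a := n + n + 1) (b := n.+1 + (n - lft i l))) => //; try lia.
  by apply: (evAdd (a := n + n) (b := 1)) => //; [apply: (evAdd (a := n) (b := n)) => //; lia | lia].
apply: (evIte (b := okr && okl)).
- apply: (evMul (a := okr) (b := okl)) => //; first by rewrite mulnb.
  by apply: leq_ltn_trans (leq_b1 _) _; lia.
- case/andP=> h1r h1l; case: (right); first exact: okrE.
  by apply: fin; rewrite /= y1n (oklE h1l).
rewrite negb_and => nok.
have okl' : okr -> lft i l + d ^ La <= p.
  by move=> hr; apply: oklN; move: nok; rewrite hr.
have := rep_exists g0 hg pin okl' okrN; set c := (if _ then _ else _); case=> cin cw.
have {}cw : d ^ La <= cnt i l by rewrite rE addKn in cw.
clear okrE okrN y1n oklE oklN okl' pr1 r1R r1E py1 y1L y1E er1 ey1.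
have cn : c * g < n by lia.
have cN : c < NR T g by rewrite ltnS leq_divRL // ltnW.
have sBi : same T l i (suf (c * g)) by rewrite same_suf.
have cB := eq_cnt sBi.
have cB0 : 0 < cnt (suf (c * g)) l by rewrite -cB.
have [fLA hH1] := first_LA n0 g0 nlam d0 cn l0 cB0.
set h := trunc_log 2 _ in fLA hH1.
have /andP[b1 b2] := @trunc_log_bounds 2 _ isT cB0; rewrite -/h -cB in b1 b2.
(* More than [2g + 1] matches leave a power 2^h of at least [g]; there are rows for such [h]
   only. *)
have gh : g <= 2 ^ h by rewrite expnS in b2; lia.
have lLA : 0 < l <= LA T (c * g) h by rewrite l0 (leq_LA n0 g0 nlam) // -cB.
have [rs hrE sBr] := rowix_spec n0 g0 nlam d0 cN cn gh lLA.
set r := rowix _ _ _ _ in rs hrE sBr.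
have sir := same_trans sBi sBr.
pose j := ir T lam g r; rewrite -/j in sBr sir.
have jln : j + l <= n by case/and3P: sir.
have j_n : j < n by lia.
pose t := 2 ^ h.
have cj : t <= cnt j l < t.*2 by rewrite -(eq_cnt sir) b1 -mul2n -expnS.
have /andP[cj1 cj2] := cj.
have [eb1 eb2 eb3 /andP[z1 z2]] := Z_spec n0 g0 nlam l0 jln cj2.
set e := (j + l + g - 1) %/ g in eb1 eb2 eb3 z1 z2.
have [/andP[i01 i02] jj2 T1E _ klam] := kk_spec n0 g0 nlam eb2 j_n eb3.
have [jX XE Xn _] := X_spec eb2 j_n eb3.
have aale := aa_le n0 g0 nlam eb2 j_n eb3.
set k := kk T t (e * g) j in z1 z2 i01 i02 T1E klam.
set a := aa T g t (e * g) j in z1 z2 aale.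
set x := xmax T t (e * g) in jX XE Xn i02 T1E.
have kK : k < Kn by [].
have hlam : h < lam.+1 by exact: hH1.
have := @nth_T2s T lam g r a k rs; rewrite hrE => /(_ aale kK)[T2E T2s].
set z := zstart _ _ _ _ _ _ in z1 z2; rewrite -/t -/j -/z in T2E.
have fKK := first_KK n0 g0 nlam d0 rs l0; rewrite hrE -/t -/j in fKK.
set Nl := nkeys T g j t l in z1 z2 fKK.
have {}fKK := fKK z z1.
have [/andP[N0 Ns] lx cx0 cxg] := key_near n0 g0 nlam gh l0 cj.
have Ns' : Nl <= size (kr T lam g r) by rewrite /kr hrE.
set x' := nth 0 _ _ in lx cx0 cxg.
have [n1 n2 n3 n4] := key_interval n0 g0 nlam lx cx0 cxg.
rewrite -(eq_lft sir) -(eq_rgt sir) in n1 n2 n3 n4.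
have off := offK_lt rs Ns'.
have KLE fn : nth 0 (flatten (KLs T lam g fn)) (offK T lam g r + Nl) = fn j x'.
  by rewrite nth_KLs // /kr hrE.
have svE : size (VV T lam g) = KK0 T lam g + size (flatten (KKs T lam g)) by rewrite (size_VV n0 g0 nlam d0).
have hHm := mx_lt cN (ltnW hH1); have hHm1 := mx_lt cN hH1.
have [|idx1 eidx1 [_ idx1E]] := NX_ok fLA _ ln; first by rewrite svE /KK0 -addnA ltn_add2l; apply: leq_trans hHm1 (leq_addr _ _).
have {}idx1E : idx1 = LA0 T + (c * Hm + h.+1).
  by apply: idx1E; rewrite addnA ltn_add2l; apply: leq_trans hH.
have [|idx2 eidx2 [_ idx2E]] := NX_ok fKK _ ln; first by rewrite svE ltn_add2l.
have {}idx2E : idx2 = KK0 T lam g + (offK T lam g r + Nl).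
  (* The start [z] is at most [g + 1] below the answer, within the horizon [d ^ La]. *)
  apply: idx2E; rewrite addnA -!addnA !ltn_add2l.
  by move: z2 hg; clear; lia.
have sx : rgt j x' = lft j x' + cnt j x' by [].
have kp : 2 ^ k <= 2 ^ lam by rewrite leq_exp2l.
have XD : lam.+1 * EBn <= D := tab_le n0 m0 nD Dw h29.
have T1D : lam.+1 * Kn * EBn * 2 <= D := tab_le n0 m0 nD Dw h31.
have EB0 : 0 < EBn by rewrite /EB addn2.
have T1D3 : lam.+1 * Kn * EBn <= D by apply: leq_trans T1D; rewrite leq_pmulr.
have T1D2 : lam.+1 * Kn <= D by apply: leq_trans T1D3; rewrite leq_pmulr.
have T2D := tab_le n0 m0 nD Dw h32.
have LAD : NR T g * Hm <= D := tab_le n0 m0 nD Dw h25.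
have heb := mx_lt hlam eb1; have hk := mx_lt hlam kK; have hkeb := mx_lt hk eb1.
have hall := mx_lt hkeb jj2.
have jx : j <= x by apply: leq_trans i02.
have upx : up j k <= x %/ 2 ^ k by rewrite leq_divRL // expn_gt0.
have pw : p + g < 2 ^ w by clear - pn nb3 Dw; lia.
have jlw : j + l + g < 2 ^ w by clear - jln nb3 Dw; lia.
apply: (evLet (v := c)).
  rewrite /c; apply: (evIte (b := okr)) => // hr; rewrite ?hr ?(negbTE hr).
    by apply: (evDiv (a := p) (b := g)) => //; clear - pw; lia.
  apply: (evDiv (a := p + g - 1) (b := g)) => //; last by clear - pw; lia.
  apply: (evSub n0 m0 nD Dw (a := p + g) (b := 1)) => //; last by clear - g0; lia.
  exact: (evAdd (a := p) (b := g)).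
rewrite [rcons _ _]/=.
have KKD : LA0 T + NR T g * Hm <= D.
  by rewrite svE in sVD; apply: leq_trans sVD; rewrite leq_addr.
have KKw : KK0 T lam g + size (flatten (KKs T lam g)) < 2 ^ w.
  by rewrite -svE; apply: leq_ltn_trans Dw.
have LAw : LA0 T + c * Hm < 2 ^ w by clear - KKD hHm Dw; lia.
apply: (evLet (v := LA0 T + c * Hm)).
  apply: (evAdd (a := LA0 T) (b := c * Hm)) => //.
  by apply: (evMul (a := c) (b := Hm)) => //; clear - LAw; lia.
rewrite [rcons _ _]/=.
have idx1w : idx1 < 2 ^ w by rewrite idx1E; clear - KKD hHm1 Dw; lia.
apply: (evLet (v := h)).
  apply: (evSub n0 m0 nD Dw (a := h.+1) (b := 1)) => //; rewrite ?subn1 //; last by rewrite idx1E in idx1w; clear - idx1w; lia.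
  apply: (evSub n0 m0 nD Dw (a := idx1) (b := LA0 T + c * Hm)) => //.
  - by rewrite idx1E addnA leq_addr.
  - by rewrite idx1E addnA addKn.
rewrite [rcons _ _]/=.
apply: (evLet (v := r)); first by apply: (evT2 n0 m0 nD Dw (a := c) (b := h) h25) => //; exact: ltnW.
apply: (evLet (v := j)); first by apply: (eT _ _ _ _ _ r _ h26).
rewrite [rcons _ _]/=.
apply: (evLet (v := e)).
  apply: (evDiv (a := j + l + g - 1) (b := g)) => //; last by clear - jlw; lia.
  apply: (evSub n0 m0 nD Dw (a := j + l + g) (b := 1)) => //; last by clear - g0; lia.
  by apply: (evAdd (a := j + l) (b := g)) => //; apply: (evAdd (a := j) (b := l)) => //; clear - jlw; lia.
rewrite [rcons _ _]/=.
apply: (evLet (v := x)).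
  by apply: (evT2 n0 m0 nD Dw (a := h) (b := e) h29) => //; rewrite !mxE.
rewrite [rcons _ _]/=.
apply: (evLet (v := k)).
  apply: (eT _ _ _ _ _ (x.+1 - j) _ h30) => //; last by apply: leq_ltn_trans (leq_subr _ _) _.
  apply: (evSub n0 m0 nD Dw (a := x.+1) (b := j)) => //; [|by apply: leqW | by clear - Xn nb3 Dw; lia].
  by apply: (evAdd (a := x) (b := 1)); rewrite ?addn1 //; clear - Xn nb3 Dw; lia.
rewrite [rcons _ _]/=.
apply: (evLet (v := jj T t (e * g) j)).
  have xw : x < 2 ^ w by clear - Xn nb3 Dw; lia.
  have jkw : j + 2 ^ k < 2 ^ w by clear - j_n kp nb4 Dw; lia.
  have p0 : 0 < 2 ^ k by rewrite expn_gt0.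
  apply: (evSub n0 m0 nD Dw (a := x %/ 2 ^ k) (b := up j k)) => //.
  + by apply: (evShr (a := x) (b := k)).
  + apply: (evShr (a := j + 2 ^ k - 1) (b := k)) => //; last by clear - jkw; lia.
    apply: (evSub n0 m0 nD Dw (a := j + 2 ^ k) (b := 1)) => //; last by clear - p0; lia.
    apply: (evAdd (a := j) (b := 2 ^ k)) => //.
    by apply: (evShl (a := 1) (b := k)); rewrite ?mul1n //; clear - jkw; lia.
  + by apply: leq_ltn_trans xw; apply: leq_div.
rewrite [rcons _ _]/=.
apply: (evLet (v := a)).
  apply: (evT2 n0 m0 nD Dw (A := lam.+1 * Kn * EBn) (B' := 2) (a := (h * Kn + k) * EBn + e)
            (b := jj T t (e * g) j) h31) => //; last by rewrite !mxE.
  apply: (evMx n0 m0 nD Dw (A := lam.+1 * Kn) (B' := EBn) (a := h * Kn + k) (b := e)) => //.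
  by apply: (evMx n0 m0 nD Dw (A := lam.+1) (B' := Kn) (a := h) (b := k)).
rewrite [rcons _ _]/=.
apply: (evLet (v := KK0 T lam g + offK T lam g r + z)).
  apply: (eT _ _ _ _ _ (offT T lam g r + (a * Kn + k)) _ h32) => //.
  apply: (evAdd (a := offT T lam g r) (b := a * Kn + k)) => //; last by clear - T2s T2D Dw; lia.
    by apply: (eT _ _ _ _ _ r _ h28).
  apply: (evAdd (a := a * Kn) (b := k)) => //; last by clear - T2s T2D Dw; lia.
  by apply: (evMul (a := a) (b := Kn)) => //; clear - T2s T2D Dw; lia.
rewrite [rcons _ _]/=.
have idx2w : idx2 < 2 ^ w by rewrite idx2E; clear - KKw off; lia.
apply: (evLet (v := offK T lam g r + Nl)).
  apply: (evSub n0 m0 nD Dw (a := idx2) (b := KK0 T lam g)) => //.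
  - by rewrite idx2E leq_addr.
  - by rewrite idx2E addKn.
rewrite [rcons _ _]/=.
have rx : lft i l < rgt j x' <= rgt i l by rewrite n2 sx; clear - n1 cx0; lia.
have lx' : lft i l <= lft j x' < rgt i l by rewrite n1; clear - n2 sx cx0; lia.
(* The stored ends are less than [g] away from the true ones, again within the horizon. *)
have [|r2 er2 [_ r2E]] := NX_ok (first_rgt n0 g0 nlam d0 l0 c0 rx) _ ln; first by clear - rn sV; lia.
have {}r2E : r2 = rgt i l by apply: r2E; clear - n4 hg; lia.
have [|y2 ey2 [_ y2E]] := NX_ok (first_lft n0 g0 nlam d0 l0 c0 lx') _ ln; first by rewrite -/n; clear - sV; lia.
have {}y2E : y2 = n.+1 + (n - lft i l) by apply: y2E; rewrite -/n; clear - n3 hg; lia.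
case: (right).
  apply: (evcall2 (a := rgt j x') (b := l.*2)) => //; last by rewrite er2.
  by apply: (eT _ _ _ _ _ (offK T lam g r + Nl) _ h34).
apply: fin; apply: (evcall2 (a := n.+1 + (n - lft j x')) (b := l.*2)) => //; last by rewrite ey2.
apply: (evAdd (a := n.+1) (b := n - lft j x')) => //; last by clear - nb3 Dw n0; lia.
  by apply: (evAdd (a := n) (b := 1)); rewrite ?addn1 //; clear - nb3 Dw n0; lia.
apply: (evSub n0 m0 nD Dw (a := n) (b := lft j x')) => //; last 2 first.
- by clear - lx' rn; lia.
- by clear - nb3 Dw n0; lia.
by apply: (eT _ _ _ _ _ (offK T lam g r + Nl) _ h33).
Qed.

End Loc.

(** * Range minima *)

Definition bet (x y : exp) : exp := Ite (Tb 36 y < Tb 36 x)%X y x.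

(** Variables 2 and 3 are the blocks of the two ends. A range within one block is answered from the
    stack of its last element. Otherwise the minimum is the best of the stored minima of the end of
    the first block and of the start of the last one, and, if there are blocks between, of two
    overlapping runs of 2^k blocks. *)
Definition AME : exp := (
  Let (#0 / prm 12) (
  Let (#1 / prm 12) (
  Ite (#2 == #3) (#2 * prm 12 + Tb 37 (Tb 38 (#1) * prm 12 + #0 %% prm 12)) (
  Let (Tb 39 (#0)) (
  Let (Tb 40 (#1)) (
  Let (bet (#4) (#5)) (
  Ite (#2 + $1 == #3) (#6) (
  Let (Tb 30 (#3 - #2 - $1)) (
  Let (Tb 41 (#7 * prm 13 + (#2 + $1))) (
  Let (Tb 41 (#7 * prm 13 + (#3 - ($1 <<< #7)))) (
  Let (bet (#8) (#9)) (
  bet (#6) (#10)))))))))))))%X.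

Section Argmin.
Variable DD : nat -> nat.

Definition is_am a b x := a <= x <= b /\ forall z, a <= z <= b -> DD x <= DD z.

Fixpoint am_rec a k :=
  if k is k'.+1 then
    let x := am_rec a k' in if DD (a + k) < DD x then a + k else x
  else a.

Definition am a b := am_rec a (b - a).

Lemma am_ok a b : a <= b -> is_am a b (am a b).
Proof.
move=> ab; rewrite /am -{1}(subnKC ab); elim: (b - a) => [|k [h1 h2]] /=.
  by split=> [|z]; rewrite addn0 ?leqnn // -eqn_leq => /eqP ->.
case: ltnP => h; split; try by lia.
  move=> z hz; case: (ltnP z (a + k.+1)) => hz'; last by rewrite (_ : z = a + k.+1) //; lia.
  by apply: leq_trans (ltnW h) (h2 _ _); lia.
move=> z hz; case: (ltnP z (a + k.+1)) => hz'; first by apply: h2; lia.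
by rewrite (_ : z = a + k.+1) //; lia.
Qed.

(** The ranges may overlap, as the two runs of blocks do. *)
Lemma is_am_join a b c d x y : is_am a b x -> is_am c d y -> a <= c <= b.+1 -> b <= d ->
  is_am a d (if DD y < DD x then y else x).
Proof.
move=> [hx mx] [hy my] ac bd; case: ltnP => h; split; try by lia.
  move=> z hz; case: (leqP z b) => hz'; last by apply: my; lia.
  by apply: leq_trans (ltnW h) (mx _ _); lia.
move=> z hz; case: (leqP z b) => hz'; first by apply: mx; lia.
by apply: leq_trans h (my _ _); lia.
Qed.

Variables (s n lam : nat).
Hypothesis s0 : 0 < s.

Definition StkT : finType := {ffun 'I_s -> bool}.
Definition stk0 : StkT := [ffun=> false].
(* A member y of [stk b] attains the minimum of [y, b] in the block of b, hence the
   first member from a on attains the minimum of [a, b]. *)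
Definition stk b : StkT := [ffun y : 'I_s => (y <= b %% s) &&
  [forall z : 'I_s, (y < z <= b %% s) ==> (DD (b %/ s * s + y) <= DD (b %/ s * s + z))]].
Definition RMf c := let S := dec stk0 (c %/ s) in
  find (fun y : 'I_s => (c %% s <= y) && S y) (enum 'I_s).
Definition NBs := (n %/ s).+1.
(* The cap [n] only matters for blocks past the end. *)
Definition SPf c := minn n (am (c %% NBs * s) ((c %% NBs + 2 ^ (c %/ NBs)) * s).-1).

Lemma RM_ok a b : a <= b -> a %/ s = b %/ s ->
  is_am a b (a %/ s * s + RMf (enc (stk b) * s + a %% s)).
Proof.
move=> ab uv; rewrite /RMf !mxE ?ltn_mod // encK.
have aE := divn_eq a s; have bE := divn_eq b s; rewrite -uv in bE.
have [as_ bs_] : a %% s < s /\ b %% s < s by rewrite !ltn_mod.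
set u := a %/ s in aE bE uv *.
have [[/andP[m1 m2] m3] mE] := (am_ok ab, erefl (am a b)).
set mm := am a b in m1 m2 m3 mE.
have ms : mm - u * s < s by lia.
set P := fun y : 'I_s => _.
have PE (y : 'I_s) : P y = [&& a %% s <= y, y <= b %% s &
    [forall z : 'I_s, (y < z <= b %% s) ==> (DD (u * s + y) <= DD (u * s + z))]].
  by rewrite /P ffunE -uv.
have Pm : P (Ordinal ms).
  rewrite PE /=; apply/and3P; split; try lia.
  apply/forallP => z; apply/implyP => hz; rewrite (_ : u * s + (mm - u * s) = mm); last by lia.
  by apply: m3; lia.
have hs : has P (enum 'I_s) by apply/hasP; exists (Ordinal ms); rewrite ?mem_enum.
pose y := nth (Ordinal ms) (enum 'I_s) (find P (enum 'I_s)).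
have Py : P y := nth_find _ hs.
have fE : find P (enum 'I_s) = y.
  by rewrite /y nth_enum_ord // -[X in _ < X](size_enum_ord s) -has_find.
have ym : u * s + y <= mm.
  rewrite -fE leqNgt; apply/negP => lt.
  have h : mm - u * s < find P (enum 'I_s) by lia.
  have := before_find (Ordinal ms) h.
  rewrite (_ : nth _ _ _ = Ordinal ms) ?Pm //.
  by apply: val_inj; rewrite /= nth_enum_ord.
rewrite fE; move: Py; rewrite PE => /and3P[y1 y2 /forallP y3].
split; first by lia.
move=> z hz; apply: leq_trans (m3 z hz).
move: ym; rewrite leq_eqVlt => /orP[/eqP -> //|lt].
have := y3 (Ordinal ms) => /implyP; rewrite /= (_ : u * s + (mm - u * s) = mm); last by lia.
by apply; lia.
Qed.

Section Eval.
Variables (w D : nat) (m : nat -> nat).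
Hypotheses (n0 : 0 < n) (m0 : m 0 = n) (nD : 4 * n < D) (Dw : D < 2 ^ w).
Notation ev := (eval w D m).
Notation tab := (tab D n m).
Hypotheses (nlam : n < 2 ^ lam.+1)
  (h12 : tab 12 (fun=> s) 1) (h13 : tab 13 (fun=> NBs) 1)
  (h30 : tab 30 (trunc_log 2) n.+1) (h36 : tab 36 DD n)
  (h37 : tab 37 RMf (#|StkT| * s)) (h38 : tab 38 (fun b => enc (stk b)) n)
  (h39 : tab 39 (fun a => am a (a %/ s * s + s.-1)) n) (h40 : tab 40 (fun b => am (b %/ s * s) b) n)
  (h41 : tab 41 SPf (lam.+1 * NBs)).

Lemma bet_ok vs e1 e2 x y : x < n -> y < n -> ev vs e1 = x -> ev vs e2 = y ->
  ev vs (bet e1 e2) = if DD y < DD x then y else x.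
Proof.
move=> xn yn h1 h2; apply: (evIte (b := DD y < DD x)).
- apply: (evLt n0 m0 nD Dw (a := DD y) (b := DD x)) => //.
    exact: (evT n0 m0 nD Dw h36 h2).
  exact: (evT n0 m0 nD Dw h36 h1).
- by move=> ->.
- by move=> /negbTE ->.
Qed.

Lemma AME_ok a b : a <= b -> b < n -> is_am a b (ev [:: a; b] AME).
Proof.
move=> ab bn; have an : a < n by lia.
have e1 vs : ev vs ($1)%X = 1 by apply: evC; lia.
have e12 vs : ev vs (prm 12) = s := evP n0 m0 nD Dw vs h12.
have e13 vs : ev vs (prm 13) = NBs := evP n0 m0 nD Dw vs h13.
have eT := evT n0 m0 nD Dw.
have hD := tab_le n0 m0 nD Dw h37; have hD' := tab_le n0 m0 nD Dw h41.
have uvN : b %/ s < NBs by rewrite ltnS leq_div2r // ltnW.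
pose u := a %/ s; pose v := b %/ s.
have uv : u <= v by apply: leq_div2r.
have [us vs_] : u * s <= a /\ v * s <= b by rewrite !leq_divM.
have [aE bE] := (divn_eq a s, divn_eq b s).
have [as_ bs_] : a %% s < s /\ b %% s < s by rewrite !ltn_mod.
have nw : n < 2 ^ w by lia.
have -> : ev [:: a; b] AME = ev [:: a; b; u; v] (
  Ite (#2 == #3) (#2 * prm 12 + Tb 37 (Tb 38 (#1) * prm 12 + #0 %% prm 12)) (
  Let (Tb 39 (#0)) (
  Let (Tb 40 (#1)) (
  Let (bet (#4) (#5)) (
  Ite (#2 + $1 == #3) (#6) (
  Let (Tb 30 (#3 - #2 - $1)) (
  Let (Tb 41 (#7 * prm 13 + (#2 + $1))) (
  Let (Tb 41 (#7 * prm 13 + (#3 - ($1 <<< #7)))) (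
  Let (bet (#8) (#9)) (
  bet (#6) (#10)))))))))))%X.
  apply: evLet; last apply: evLet; last reflexivity.
    by apply: (evDiv (a := a) (b := s)) => //; lia.
  by apply: (evDiv (a := b) (b := s)) => //; lia.
case: (eqVneq u v) => [e|ne].
  have := RM_ok ab e; set x := (_ + _); set y := ev _ _; suff -> : y = x by [].
  have := enc_lt (stk b) => cl.
  apply: (evIte (b := u == v)); rewrite ?e ?eqxx //; first by apply: (evEq n0 m0 nD Dw (a := v) (b := v)); rewrite ?eqxx.
  move=> _; apply: (evAdd (a := v * s) (b := RMf (enc (stk b) * s + a %% s))).
  - by apply: (evMul (a := v) (b := s)) => //; lia.
  - apply: (evT2 n0 m0 nD Dw (a := enc (stk b)) (b := a %% s) h37) => //.
      exact: (eT _ _ _ _ _ b _ h38).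
    by apply: (evMod (a := a) (b := s)) => //; lia.
  - by rewrite /x -/u e.
  - rewrite -/u e in x *; have := RM_ok ab e; rewrite -/u e => -[]; lia.
have ult : u < v by rewrite ltn_neqAle ne.
have usv : u.+1 * s <= v * s by rewrite leq_mul2r ult orbT.
have uE : u * s + s.-1 = (u.+1 * s).-1 by rewrite mulSn; lia.
have am4 := am_ok (_ : a <= u * s + s.-1); have am5 := am_ok vs_.
have {}am4 : is_am a (u * s + s.-1) (am a (u * s + s.-1)) by apply: am4; lia.
set x4 := am a _ in am4; set x5 := am _ b in am5.
have x4n : x4 < n by case: am4; rewrite mulSn in usv; lia.
have x5n : x5 < n by case: am5; lia.
pose x6 := if DD x5 < DD x4 then x5 else x4.
have x6n : x6 < n by rewrite /x6; case: ifP.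
have -> : forall e2 e3, ev [:: a; b; u; v] (Ite (#2 == #3) e2 (Let (Tb 39 (#0)) (Let (Tb 40 (#1))
   (Let (bet (#4) (#5)) e3))))%X = ev [:: a; b; u; v; x4; x5; x6] e3.
  move=> e2 e3; apply: (evIte (b := u == v)); rewrite ?(negbTE ne) //.
    by apply: (evEq n0 m0 nD Dw (a := u) (b := v)); rewrite ?(negbTE ne).
  move=> _; apply: (evLet (v := x4)); first by apply: (eT _ _ _ _ _ a _ h39).
  apply: (evLet (v := x5)); first by apply: (eT _ _ _ _ _ b _ h40).
  by apply: (evLet (v := x6)); first exact: bet_ok.
have vw : v < 2 ^ w by apply: leq_ltn_trans nw; apply: leq_trans (ltnW bn); apply: leq_div.
have e21 vs : ev (a :: b :: u :: v :: vs) (#2 + $1)%X = u.+1.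
  by apply: (evAdd (a := u) (b := 1)); rewrite ?addn1 //; lia.
case: (eqVneq u.+1 v) => [e|ne'].
  have -> : forall e3, ev [:: a; b; u; v; x4; x5; x6] (Ite (#2 + $1 == #3) (#6) e3)%X = x6.
    move=> e3; apply: (evIte (b := u.+1 == v)); rewrite ?e ?eqxx //.
    by apply: (evEq n0 m0 nD Dw (a := u.+1) (b := v)); [exact: e21 | | rewrite e eqxx].
  have vE : (u * s + s.-1).+1 = v * s by rewrite uE -e prednK // mulSn addn_gt0 s0.
  have aus : a < (u * s + s.-1).+1 by rewrite aE ltnS leq_add2l -ltnS prednK.
  by apply: (is_am_join am4 am5); rewrite ?vE ?leqnn ?andbT; [rewrite -vE ltnW | rewrite -ltnS vE; apply: leq_trans vs_ _].
have ult' : u.+1 < v by rewrite ltn_neqAle ne'.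
pose k := trunc_log 2 (v - u - 1).
have [k1 k2] : 2 ^ k <= v - u - 1 /\ v - u - 1 < (2 ^ k).*2.
  have h : 0 < v - u - 1 by clear - ult'; lia.
  by split; [exact: trunc_logP | rewrite -mul2n -expnS; apply: trunc_log_ltn].
have vn : v < n by apply: leq_ltn_trans bn; apply: leq_div.
have klam : k < lam.+1.
  by rewrite -(@ltn_exp2l 2) //; apply: leq_ltn_trans nlam; clear - k1 vn; lia.
have p0 : 0 < 2 ^ k by rewrite expn_gt0.
pose x8 := SPf (k * NBs + u.+1); pose x9 := SPf (k * NBs + (v - 2 ^ k)).
have s8 : u.+1 < NBs by lia.
have s9 : v - 2 ^ k < NBs by apply: leq_ltn_trans uvN; apply: leq_subr.
have blk c : c < NBs -> u.+1 <= c -> c + 2 ^ k <= v ->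
    let x := SPf (k * NBs + c) in is_am (c * s) ((c + 2 ^ k) * s).-1 x /\ x < n.
  move=> cN uc cv x; have lt : c * s < (c + 2 ^ k) * s by rewrite ltn_mul2r s0 -addn1 leq_add2l.
  have cvs : (c + 2 ^ k) * s <= v * s by rewrite leq_mul2r cv orbT.
  have := @am_ok (c * s) ((c + 2 ^ k) * s).-1; rewrite /x /SPf !mxE //; set y := am _ _ => h.
  have {}h : is_am (c * s) ((c + 2 ^ k) * s).-1 y by apply: h; clear - lt; lia.
  have yn : y < n by case: h; clear - vs_ bn lt cvs; lia.
  by rewrite (minn_idPr (ltnW yn)).
have [am8 x8n] : is_am (u.+1 * s) ((u.+1 + 2 ^ k) * s).-1 x8 /\ x8 < n by apply: blk; clear - s8 k1 ult'; lia.
have [am9 x9n] : is_am ((v - 2 ^ k) * s) ((v - 2 ^ k + 2 ^ k) * s).-1 x9 /\ x9 < n by apply: blk; clear - s9 k1 ult'; lia.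
pose x10 := if DD x9 < DD x8 then x9 else x8.
have x10n : x10 < n by rewrite /x10; case: ifP.
have -> : ev [:: a; b; u; v; x4; x5; x6] (Ite (#2 + $1 == #3) (#6) (
  Let (Tb 30 (#3 - #2 - $1)) (
  Let (Tb 41 (#7 * prm 13 + (#2 + $1))) (
  Let (Tb 41 (#7 * prm 13 + (#3 - ($1 <<< #7)))) (
  Let (bet (#8) (#9)) (bet (#6) (#10)))))))%X = if DD x10 < DD x6 then x10 else x6.
  have NBw : lam.+1 * NBs <= D by [].
  apply: (evIte (b := u.+1 == v)); rewrite ?(negbTE ne') //.
    by apply: (evEq n0 m0 nD Dw (a := u.+1) (b := v)); rewrite ?(negbTE ne').
  move=> _; apply: (evLet (v := k)).
    apply: (eT _ _ _ _ _ (v - u - 1) _ h30) => //; last by clear - vn; lia.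
    have vuw : v - u < 2 ^ w by apply: leq_ltn_trans vw; apply: leq_subr.
    apply: (evSub n0 m0 nD Dw (a := v - u) (b := 1)); rewrite ?subn_gt0 //.
    by apply: (evSub n0 m0 nD Dw (a := v) (b := u)).
  apply: (evLet (v := x8)); first by apply: (evT2 n0 m0 nD Dw (a := k) (b := u.+1) h41); rewrite ?[rcons _ _]/= ?e21.
  apply: (evLet (v := x9)).
    apply: (evT2 n0 m0 nD Dw (a := k) (b := v - 2 ^ k) h41) => //.
    have kv : 2 ^ k <= v by clear - k1; lia.
    apply: (evSub n0 m0 nD Dw (a := v) (b := 2 ^ k)) => //.
    by apply: (evShl (a := 1) (b := k)); rewrite ?mul1n //; apply: leq_ltn_trans kv vw.
  apply: (evLet (v := x10)); first exact: bet_ok.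
  exact: bet_ok.
have vk : v - 2 ^ k + 2 ^ k = v by rewrite subnK //; lia.
rewrite vk in am9.
have am10 : is_am (u.+1 * s) (v * s).-1 x10.
  apply: (is_am_join am8 am9).
    rewrite leq_mul2r (_ : u.+1 <= v - 2 ^ k) ?orbT /=; last by clear - k1 ult'; lia.
    by rewrite prednK ?leq_mul2r ?muln_gt0 ?s0 ?addSn // (_ : v - 2 ^ k <= _) ?orbT //; lia.
  have : (u.+1 + 2 ^ k) * s <= v * s by rewrite leq_mul2r (_ : u.+1 + 2 ^ k <= v) ?orbT //; clear - k1 ult'; lia.
  clear; lia.
set r := if _ then _ else _.
have [[r1 r2 r3] rab] : [/\ DD r <= DD x4, DD r <= DD x5 & DD r <= DD x10] /\
    (a <= r <= b).
  have [[h1 _] [h2 _]] := (am4, am5); have [h3 _] := am10.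
  have b1 : (u.+1 * s <= a) = false by apply/negbTE; rewrite -ltnNge mulSn; lia.
  have i4 : a <= x4 <= b by move: h1; rewrite uE; clear - usv vs_; lia.
  have i5 : a <= x5 <= b by move: h2; clear - b1 usv; lia.
  have i10 : a <= x10 <= b.
    by move: h3; clear - b1 vs_; lia.
  by clear - i4 i5 i10; rewrite /r /x6; case: (ltnP (DD x5) (DD x4)) => ?; case: ltnP => ?; split=> //; split; lia.
split=> // z hz; case: (ltnP z (u.+1 * s)) => hz1.
  by apply: leq_trans r1 _; case: am4 => _; apply; rewrite uE; clear - hz hz1; lia.
case: (ltnP z (v * s)) => hz2.
  by apply: leq_trans r3 _; case: am10 => _; apply; clear - hz1 hz2; lia.
by apply: leq_trans r2 _; case: am5 => _; apply; clear - hz hz2; lia.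
Qed.

End Eval.
End Argmin.

(** * Checking a memory content *)

Lemma rcons0 (x : nat) : rcons [::] x = [:: x]. Proof. by []. Qed.
Definition rcE := (rcons0, @rcons_cons nat).

Section Check.
Variables eL eR eA : exp.

Definition SAx (e : exp) := Tb 35 e.
Definition DDx (e : exp) := Tb 36 e.

Definition check1 : exp := (
  All lenE (All lenE (Ite (lenE < #0 + #1 + $1) $1 (
  Let (call2 2 (#0) (#1 + $1) eL) (
  Let (call2 3 (#0) (#1 + $1) eR) (
  Ite (#3 < lenE + $1) (
  Ite (#2 < #3) (
  All lenE (Let (SAx (#4)) (
  Bop Eq (Ite (#4 < #2) $0 (#4 < #3))
         (Ite (lenE < #5 + #1) $0
              (All (#1 + $1) (Rd (#0 + #6 + $2) == Rd (#5 + #6 + $1)))))))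
  $0) $0))))))%X.

Definition check2 : exp := (
  All lenE (
  Ite ($0 < SAx (#0)) (
  Ite (SAx (#0) < lenE + $1) (
  All lenE (Ite (SAx (#0) == SAx (#1)) (#0 == #1) $1)) $0) $0))%X.

(** Comparing [All] with 0 negates the statement that every element of [G] misses the range. *)
Definition check3 : exp := (
  All lenE (All lenE (Let (SAx (#0)) (
  Ite (lenE < #2 + #1) $1 (
  Bop Eq (DDx (#0) < #1 + $1)
    (Bop Eq $0 (All (Rd $1) (Let (Rd (#3 + lenE + $2)) (
      Ite (#4 < #2) $1 (#2 + #1 < #4))))))))))%X.

Definition check4 : exp := (
  All lenE (All lenE (Ite (#1 < #0) $1 (
  Let (call2 2 (#0) (#1) eA) (
  Ite (#2 < #0) $0 (Ite (#1 < #2) $0 (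
  All lenE (Ite (#3 < #0) $1 (Ite (#1 < #3) $1 (Ite (DDx (#3) < DDx (#2)) $0 $1))))))))))%X.

Definition check : exp := Ite check2 (Ite check1 (Ite check3 check4 $0) $0)%X ($0)%X.

Variables (n : nat) (S G : seq nat) (lf rg : nat -> nat -> nat) (sa dd : nat -> nat) (am : nat -> nat -> nat).

(* Here l is the length minus 1 and the position [x] is 1-based. *)
Definition occurs i l x := (x + l <= n) && all (fun t => nth 0 S (i + t) == nth 0 S (x.-1 + t)) (iota 0 l.+1).

Definition good1 := all (fun i => all (fun l => (n < i + l + 1) || [&& rg i l < n.+1, lf i l < rg i l &
  all (fun q => (lf i l <= q < rg i l) == occurs i l (sa q)) (iota 0 n)]) (iota 0 n)) (iota 0 n).
Definition good2 := all (fun q => (0 < sa q < n.+1) &&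
  all (fun q' => (sa q == sa q') ==> (q == q')) (iota 0 n)) (iota 0 n).
Definition good3 := all (fun q => all (fun l => (sa q + l <= n) ==>
  ((dd q < l.+1) == has (fun k => sa q <= k <= sa q + l) G)) (iota 0 n)) (iota 0 n).
Definition good4 := all (fun a => all (fun b => (a <= b) ==> [&& a <= am a b, am a b <= b &
  all (fun z => (a <= z <= b) ==> (dd (am a b) <= dd z)) (iota 0 n)]) (iota 0 n)) (iota 0 n).
(** What the query relies on. The order of the suffixes does not appear: [sa] may be any permutation
    in which the occurrences of each substring form the interval given by [lf] and [rg]. *)
Definition good := [&& good2, good1, good3 & good4].

Variables (w D : nat) (m : nat -> nat).
Hypotheses (n0 : 0 < n) (nD : 4 * n + 42 < D) (Dw : D < 2 ^ w).
Hypotheses (sS : size S = n) (sG : size G <= n) (Gn : all (leq^~ n) G)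
  (m0 : m 0 = n) (m1 : m 1 = size G)
  (mS : forall x, x < n -> m (x + 2) = nth 0 S x)
  (mG : forall k, k < size G -> m (k + n + 2) = nth 0 G k).
Notation ev := (eval w D m).
Hypotheses
  (lfE : forall i l, lf i l = ev [:: i; l.+1] eL)
  (rgE : forall i l, rg i l = ev [:: i; l.+1] eR)
  (saE : forall q, sa q = ev [:: q] (SAx (#0)%X))
  (ddE : forall q, dd q = ev [:: q] (DDx (#0)%X))
  (amE : forall a b, am a b = ev [:: a; b] eA).
Definition tt vs e := ev vs e != 0.

Lemma ttIte vs a b c : tt vs (Ite a b c) = if tt vs a then tt vs b else tt vs c.
Proof. by rewrite /tt /=; case: ifP. Qed.
Lemma ttAll vs a b : tt vs (All a b) = all (fun v => tt (rcons vs v) b) (iota 0 (ev vs a)).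
Proof. by rewrite /tt /=; case: all. Qed.
Lemma ev_bool vs e (b : bool) : ev vs e = b -> tt vs e = b.
Proof. by rewrite /tt => ->; case: b. Qed.
Let w2 : 3 < 2 ^ w. Proof. lia. Qed.
Let nD' : 4 * n < D. Proof. lia. Qed.
Lemma ttLt vs a b : tt vs (a < b)%X = (ev vs a < ev vs b).
Proof. by apply: ev_bool; exact: (evLt n0 m0 nD' Dw). Qed.
Lemma ttEq vs a b : tt vs (a == b)%X = (ev vs a == ev vs b).
Proof. by apply: ev_bool; exact: (evEq n0 m0 nD' Dw). Qed.
Lemma tt1 vs : tt vs ($1)%X.
Proof. by rewrite /tt (evC D m) //; lia. Qed.
Lemma tt0 vs : tt vs ($0)%X = false.
Proof. by rewrite /tt (evC D m) //; lia. Qed.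
Lemma ttLet vs a b : tt vs (Let a b) = tt (rcons vs (ev vs a)) b.
Proof. by []. Qed.
Lemma ev_All vs a b : ev vs (All a b) = tt vs (All a b).
Proof. by rewrite ttAll. Qed.
Lemma ev_Lt vs a b : ev vs (a < b)%X = (ev vs a < ev vs b).
Proof. exact: (evLt n0 m0 nD' Dw). Qed.
Lemma ev_Eq vs a b : ev vs (a == b)%X = (ev vs a == ev vs b).
Proof. exact: (evEq n0 m0 nD' Dw). Qed.
Lemma ev_Ite vs a b c : ev vs (Ite a b c) = if tt vs a then ev vs b else ev vs c.
Proof. by []. Qed.
Lemma ev_Add vs a b x y : ev vs a = x -> ev vs b = y -> x + y < 2 ^ w -> ev vs (a + b)%X = x + y.
Proof. by move=> h1 h2; apply: evAdd h1 h2 _. Qed.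
Lemma ev_C vs v : v <= 3 -> ev vs (Cst v) = v.
Proof. by move=> h; apply: evC; lia. Qed.
Lemma evV : (forall a vs, ev (a :: vs) (#0)%X = a) * (forall a b vs, ev (a :: b :: vs) (#1)%X = b)
  * (forall a b c vs, ev [:: a, b, c & vs] (#2)%X = c)
  * (forall a b c d vs, ev [:: a, b, c, d & vs] (#3)%X = d)
  * (forall a b c d e vs, ev [:: a, b, c, d, e & vs] (#4)%X = e).
Proof. by []. Qed.
Lemma ev_len vs : ev vs lenE = n. Proof. exact: evlen. Qed.
Lemma ev_Tb t vs e : ev vs (Tb t e) = ev [:: ev vs e] (Tb t (#0)%X).
Proof. by rewrite /=. Qed.
Lemma ev_SA vs e : ev vs (SAx e) = sa (ev vs e). Proof. by rewrite saE /SAx ev_Tb. Qed.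
Lemma ev_DD vs e : ev vs (DDx e) = dd (ev vs e). Proof. by rewrite ddE /DDx ev_Tb. Qed.
Lemma ev_call2 vs N e1 e2 body : size vs = N ->
  ev vs (call2 N e1 e2 body) = ev [:: ev vs e1; ev (rcons vs (ev vs e1)) e2] body.
Proof. by move=> h; apply: (evcall2 h). Qed.
Lemma ev_Rd vs e x : ev vs e = x -> x < D -> ev vs (Rd e) = m x.
Proof. by move=> /= -> h; rewrite modn_small. Qed.

Lemma eq_allI (p q : pred nat) N : (forall v, v < N -> p v = q v) -> all p (iota 0 N) = all q (iota 0 N).
Proof. by move=> h; apply: eq_in_all => v; rewrite mem_iota => /andP[_ /h]. Qed.

Lemma check2E : tt [::] check2 = good2.
Proof.
rewrite /check2 ttAll ev_len; apply: eq_allI => q qn; rewrite !rcE.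
rewrite !ttIte !ttLt ev_SA ev_C // (ev_Add (x := n) (y := 1)) ?ev_len ?ev_C //; last by lia.
rewrite tt0 addn1; case: (_ < _) => //=; case: (_ < _) => //=.
rewrite ttAll ev_len; apply: eq_allI => q' qn'; rewrite !rcE.
rewrite ttIte !ttEq !ev_SA tt1; by rewrite implybE; case: eqP.
Qed.

Lemma good2_lt q : good2 -> q < n -> 0 < sa q < n.+1.
Proof. by move=> /allP h qn; have /h/andP[] : q \in iota 0 n by rewrite mem_iota. Qed.

Lemma check1E : good2 -> tt [::] check1 = good1.
Proof.
move=> g2; rewrite /check1 ttAll ev_len; apply: eq_allI => i i_n; rewrite !rcE.
rewrite ttAll ev_len; apply: eq_allI => l ln; rewrite !rcE.
have e1 vs : ev vs ($1)%X = 1 by apply: ev_C.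
rewrite ttIte ttLt ev_len (ev_Add (x := i + l) (y := 1)) //; try lia; last first.
  by apply: (ev_Add (x := i) (y := l)) => //; lia.
case: ltnP => iln; first by rewrite tt1.
rewrite [RHS]/= 2!ttLet.
have el vs : ev (i :: l :: vs) (#1 + $1)%X = l.+1.
  by rewrite (ev_Add (x := l) (y := 1)) ?addn1 //; lia.
rewrite !ev_call2 // !rcE !el !evV -lfE -rgE ttIte ttLt !evV.
rewrite (ev_Add (x := n) (y := 1)) ?ev_len ?e1 //; last by lia.
rewrite addn1 tt0.
case: (ltnP (rg i l)) => //= _; rewrite ttIte ttLt !evV tt0.
case: ltnP => //= _; rewrite ttAll ev_len; apply: eq_allI => q qn; rewrite !rcE.
have /andP[s0 sn] := good2_lt g2 qn.
rewrite ttLet ev_SA !rcE !evV ttEq !ev_Ite !ttLt !ev_Lt !ev_len ev_C //.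
rewrite (ev_Add (x := sa q) (y := l)) //; last by lia.
rewrite ev_All ttAll (ev_Add (x := l) (y := 1)) //; last by lia.
rewrite !evV.
have -> : (if q < lf i l then 0 else (q < rg i l : nat)) = (lf i l <= q < rg i l :> nat) by case: ltnP.
set o1 := (if n < _ then _ else _); have -> : o1 = occurs i l (sa q); last by case: (_ && _); case: occurs.
rewrite /o1 /occurs; case: ltnP => //= sl; rewrite addn1; congr nat_of_bool.
apply: (@eq_allI _ _ l.+1) => t tl; rewrite ttEq.
have e2 vs : ev vs ($2)%X = 2 by apply: ev_C.
(* The text starts at address 2; the offset is 1 for [sa q], which counts positions from 1. *)
rewrite (@ev_Rd _ _ (i + t + 2)); try lia; last first.
  by apply: ev_Add; rewrite ?e2 //; [apply: ev_Add => //; lia | lia].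
rewrite (@ev_Rd _ _ (sa q + t + 1)); try lia; last first.
  by apply: ev_Add; rewrite ?e1 //; [apply: ev_Add => //; lia | lia].
by rewrite (_ : sa q + t + 1 = (sa q).-1 + t + 2) ?mS //; lia.
Qed.

Lemma check3E : good2 -> tt [::] check3 = good3.
Proof.
move=> g2; rewrite /check3 ttAll ev_len; apply: eq_allI => q qn; rewrite !rcE.
rewrite ttAll ev_len; apply: eq_allI => l ln; rewrite !rcE.
have /andP[s0 sn] := good2_lt g2 qn.
rewrite ttLet ev_SA !rcE !evV ttIte ttLt ev_len.
rewrite (ev_Add (x := sa q) (y := l)) //; last by lia.
case: ltnP => //= sl; first by rewrite tt1.
rewrite ttEq ev_Lt ev_DD (ev_Add (x := l) (y := 1)) ?ev_C //; last by lia.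
rewrite ev_Eq ev_All ttAll ev_C //.
rewrite (@ev_Rd _ _ 1) ?ev_C //; last by lia.
rewrite m1 addn1 !evV.
set a := all _ _; have -> : (0 == a) = has (fun k => sa q <= k <= sa q + l) G; last first.
  by case: (_ < _); case: has.
rewrite -[RHS]negbK -all_predC; have -> : (0 == a) = ~~ a by case: a.
congr negb; rewrite /a -(mkseq_nth 0 G) /mkseq all_map size_map size_iota.
apply: eq_allI => k kG; rewrite !rcE ttLet [preim _ _ _]/=.
rewrite (@ev_Rd _ _ (k + n + 2)); try lia; last first.
  by apply: ev_Add; rewrite ?ev_C //; [apply: ev_Add => //; rewrite ?ev_len //; lia | lia].
rewrite mG // !rcE ttIte !ttLt tt1 (ev_Add (x := sa q) (y := l)) //; last by lia.
by rewrite !evV negb_and -!ltnNge; case: (_ < _).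
Qed.

Lemma check4E : tt [::] check4 = good4.
Proof.
rewrite /check4 ttAll ev_len; apply: eq_allI => a an; rewrite !rcE.
rewrite ttAll ev_len; apply: eq_allI => b bn; rewrite !rcE.
rewrite ttIte ttLt !evV; case: ltnP => //= ab; first by rewrite tt1.
rewrite ttLet ev_call2 // !rcE !evV -amE.
rewrite !ttIte !ttLt !evV tt0.
case: ltnP => //= _; case: ltnP => //= _.
rewrite ttAll ev_len; apply: eq_allI => z zn; rewrite !rcE.
rewrite !ttIte !ttLt !tt1 tt0 !ev_DD !evV.
by case: (ltnP z a) => //= _; case: (ltnP b z) => //= _; case: ltnP.
Qed.

Lemma checkE : tt [::] check = good.
Proof.
rewrite /check /good !ttIte tt0 check2E; case g2 : good2 => //=.
by rewrite check1E // check3E // check4E; case: good1 => //; case: good3.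
Qed.

End Check.

(* The suffix of rank q, cut at length l, covers an element of G iff distG q < l. *)
Definition distG (S G : seq nat) q := find (fun t => (suf S q).+1 + t \in G) (iota 0 (size S)).

Lemma distG_lt S G q l : l < size S ->
  (distG S G q < l.+1) = has (fun k => (suf S q).+1 <= k <= (suf S q).+1 + l) G.
Proof.
move=> ln; apply/idP/idP => [lt|/hasP[k kG kq]].
  have := find_iotaT (leq_trans lt ln); rewrite -/(distG S G q) => h.
  by apply/hasP; eexists; [exact: h | lia].
rewrite ltnNge; apply/negP => h.
have := @find_iotaF _ _ (k - (suf S q).+1) (leq_trans _ h).
by rewrite subnKC ?kG; [move=> H; have := H _; lia | lia].
Qed.

Lemma ideal_good (n : nat) S G lf rg sa dd am :
  size S = n ->
  (forall i l, i + l < n -> lf i l = lft S i l.+1 /\ rg i l = rgt S i l.+1) ->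
  (forall q, q < n -> sa q = (suf S q).+1) -> (forall q, q < n -> dd q = distG S G q) ->
  (forall a b, a <= b -> b < n -> is_am (distG S G) a b (am a b)) ->
  good n S G lf rg sa dd am.
Proof.
move=> sS h1 h2 h3 h4; apply/and4P; split.
- apply/allP => q; rewrite mem_iota => /andP[_ qn]; have qS : q < size S by rewrite sS.
  rewrite h2 //; have := suf_lt qS; rewrite sS => sn; rewrite [0 < _]/= [_ < n.+1]sn [true && true]/=.
  apply/allP => q'; rewrite mem_iota => /andP[_ qn']; rewrite h2 //.
  by apply/implyP => /eqP[e]; apply/eqP; apply: (suf_inj qS) e; rewrite sS.
- apply/allP => i; rewrite mem_iota => /andP[_ i_n].
  apply/allP => l; rewrite mem_iota => /andP[_ ln].
  case: ltnP => //= il; have iln : i + l < n by lia.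
  have [-> ->] := h1 _ _ iln.
  have rn := rgt_le S i l.+1.
  rewrite ltnS -{1}sS rn /=.
  have c0 : 0 < cnt S i l.+1.
    rewrite /cnt -has_count; apply/hasP; exists i; first by rewrite mem_iota sS.
    by rewrite same_refl // sS addnS.
  rewrite /rgt -[X in X < _]addn0 ltn_add2l c0; apply/allP => q; rewrite mem_iota => /andP[_ qn].
  rewrite h2 // -/(rgt S i l.+1) -same_suf ?sS // /same sS addnS iln /=; apply/eqP.
  by rewrite /occurs addSn -addnS; congr (_ && _).
- apply/allP => q; rewrite mem_iota => /andP[_ qn].
  apply/allP => l; rewrite mem_iota => /andP[_ ln].
  rewrite h2 // h3 // distG_lt ?sS //; apply/implyP => _; exact/eqP.
- apply/allP => a; rewrite mem_iota => /andP[_ an].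
  apply/allP => b; rewrite mem_iota => /andP[_ bn].
  apply/implyP => ab; have [/andP[b1 b2] b3] := h4 _ _ ab bn.
  rewrite b1 b2; apply/allP => z; rewrite mem_iota => /andP[_ zn].
  by apply/implyP => hz; rewrite !h3 ?b3 //; apply: leq_ltn_trans bn.
Qed.

(** * Consequences of a passed check *)

Section Good.
Variables (n : nat) (S G : seq nat) (lf rg : nat -> nat -> nat) (sa dd : nat -> nat) (am : nat -> nat -> nat).
Hypotheses (sS : size S = n) (H : good n S G lf rg sa dd am).

Lemma good_sa q : q < n -> 0 < sa q <= n.
Proof. by move=> qn; case/and4P: H => /good2_lt h _ _ _; apply: h. Qed.

Lemma good_inj q q' : q < n -> q' < n -> sa q = sa q' -> q = q'.
Proof.
move=> qn qn' e; case/and4P: H => /allP/(_ q); rewrite mem_iota qn => /(_ isT)/andP[_].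
by move=> /allP/(_ q'); rewrite mem_iota qn' e eqxx => /(_ isT)/eqP.
Qed.

(** An injection of [n] ranks into [n] positions is onto. *)
Lemma good_perm : perm_eq (map sa (iota 0 n)) (iota 1 n).
Proof.
have us : uniq (map sa (iota 0 n)).
  rewrite map_inj_in_uniq ?iota_uniq // => x y; rewrite !mem_iota => /andP[_ xn] /andP[_ yn].
  exact: good_inj.
apply: uniq_perm; rewrite ?iota_uniq //.
have sub : {subset map sa (iota 0 n) <= iota 1 n}.
  by move=> x /mapP[q]; rewrite mem_iota => /andP[_ /good_sa h] ->; rewrite mem_iota; lia.
have [] := uniq_min_size us sub; first by rewrite size_map !size_iota.
by [].
Qed.

Lemma good_am a b : a <= b -> b < n ->
  a <= am a b <= b /\ forall z, a <= z <= b -> dd (am a b) <= dd z.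
Proof.
move=> ab bn; case/and4P: H => _ _ _ /allP/(_ a); rewrite mem_iota (leq_ltn_trans ab bn) => /(_ isT).
move=> /allP/(_ b); rewrite mem_iota bn ab => /(_ isT)/and3P[-> -> /allP h].
by split=> // z hz; have := h z; rewrite mem_iota hz; apply; lia.
Qed.

Lemma substr_eq (i j q : nat) : 0 < i <= j -> j <= n -> 0 < q -> q + (j - i) <= n ->
  (substr S q (q + (j - i)) == substr S i j) =
  all (fun t => nth 0 S (i.-1 + t) == nth 0 S (q.-1 + t)) (iota 0 (j - i).+1).
Proof.
move=> ij jn q0 qn; rewrite /substr.
have -> : (q + (j - i)).+1 - q = (j - i).+1 by lia.
have -> : j.+1 - i = (j - i).+1 by lia.
set l := (j - i).+1.
have s1 : size (take l (drop q.-1 S)) = l by rewrite size_takel // size_drop sS /l; lia.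
have s2 : size (take l (drop i.-1 S)) = l by rewrite size_takel // size_drop sS /l; lia.
apply/eqP/allP => [e t|h].
  rewrite mem_iota => /andP[_ tl]; have := congr1 (fun s => nth 0 s t) e.
  by rewrite !nth_take // !nth_drop => ->.
apply: (@eq_from_nth _ 0); rewrite s1 ?s2 // => t tl.
rewrite !nth_take // !nth_drop; apply/esym/eqP; apply: h.
by rewrite mem_iota.
Qed.

Lemma good_hit (i j : nat) : 0 < i <= j -> j <= n -> let l := j - i in
  lf i.-1 l < rg i.-1 l <= n /\
  forall q, q < n -> hit S G i j (sa q) = (lf i.-1 l <= q < rg i.-1 l) && (dd q < l.+1).
Proof.
move=> ij jn l; case/and4P: H => g2 g1 g3 _.
have i_n : i.-1 < n by lia.
have := allP g1 i.-1; rewrite mem_iota add0n i_n => /(_ isT).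
move=> /allP/(_ l); rewrite mem_iota (_ : 0 <= l < 0 + n); last by rewrite /l; lia.
move=> /(_ isT); rewrite ltnNge (_ : i.-1 + l + 1 <= n); last by rewrite /l; lia.
move=> /= /and3P[r1 r2 /allP r3]; split; first by rewrite r2.
move=> q qn; have := r3 q; rewrite mem_iota qn => /(_ isT)/eqP ->.
have /andP[s0 sn] := good_sa qn.
rewrite /hit /occurs s0 sS -/l [true && _]/= -andbA; case: (leqP (sa q + l) n) => // sl; rewrite !andTb.
rewrite substr_eq // -/l; congr (_ && _).
have := allP g3 q; rewrite mem_iota qn => /(_ isT)/allP/(_ l).
rewrite mem_iota (_ : 0 <= l < 0 + n) ?sl; last by rewrite /l; lia.
by move=> /(_ isT)/eqP ->.
Qed.

Lemma good_count (i j : nat) : 0 < i <= j -> j <= n -> let l := j - i in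
  count (hit S G i j) (iota 1 n) =
  count (fun q => dd q < l.+1) (iota (lf i.-1 l) (rg i.-1 l - lf i.-1 l)).
Proof.
move=> ij jn l; have [/andP[ab bn] hh] := good_hit ij jn.
rewrite -(permP good_perm) count_map.
set a := lf _ _ in ab hh *; set b := rg _ _ in ab bn hh *.
have -> : iota 0 n = iota 0 a ++ (iota a (b - a) ++ iota b (n - b)).
  have {1}-> : n = a + ((b - a) + (n - b)) by lia.
  by rewrite !iotaD add0n subnKC // ltnW.
rewrite !count_cat.
have -> : count (preim sa (hit S G i j)) (iota 0 a) = 0.
  apply/eqP; rewrite -leqn0 leqNgt -has_count; apply/hasPn => q; rewrite mem_iota => hq /=.
  by rewrite hh; lia.
have -> : count (preim sa (hit S G i j)) (iota b (n - b)) = 0.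
  apply/eqP; rewrite -leqn0 leqNgt -has_count; apply/hasPn => q; rewrite mem_iota => hq /=.
  by rewrite hh; lia.
rewrite add0n addn0; apply: eq_in_count => q; rewrite mem_iota => hq /=.
rewrite hh; last by lia.
by rewrite -/l (_ : a <= q < b) //; lia.
Qed.

End Good.

(** * The query program *)

(* [g] is the number of steps since the last report. *)
Fixpoint gapok c g (t : trace) :=
  match t with
  | [::] => g <= c
  | None :: t' => gapok c g.+1 t'
  | Some _ :: t' => (g <= c) && gapok c 0 t'
  end.

Lemma gapok_le c g g' t : g' <= g -> gapok c g t -> gapok c g' t.
Proof.
elim: t g g' => [|[r|] t IH] g g' h /=; first exact: leq_trans.
  by case/andP=> h1 ->; rewrite andbT; apply: leq_trans h1.
by apply: IH.
Qed.

Lemma gapok_g c g t : gapok c g t -> g <= c.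
Proof.
elim: t g => [|[r|] t IH] g //=; first by case/andP.
by move/IH/ltnW.
Qed.

Lemma gapok_silent c g u t : silent u -> gapok c g (u ++ t) = gapok c (g + size u) t.
Proof.
elim: u g => [|[r|] u IH] g //= su; first by rewrite addn0.
by rewrite IH // addnS.
Qed.

Lemma gapok_drop c g t1 t : gapok c g (t1 ++ t) -> gapok c 0 t.
Proof.
elim: t1 g => [|[r|] t1 IH] g /=; first exact: gapok_le.
  by case/andP=> _; apply: IH.
exact: IH.
Qed.

Lemma gapok_constant_delay c t : gapok c 0 t -> constant_delay c t.
Proof.
move=> h t1 t2 t3 e s2; rewrite {}e in h; move/gapok_drop in h.
by rewrite gapok_silent // in h; apply: gapok_g h.
Qed.

Lemma reports_silent u : silent u -> reports u = [::].
Proof. by elim: u => [|[r|] u IH] //= /IH. Qed.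

Lemma reports_cat t u : reports (t ++ u) = reports t ++ reports u.
Proof. exact: pmap_cat. Qed.

Lemma eval_sub w a b c : a = b + c -> a < 2 ^ w -> eval_op w Defs.Sub a b = c.
Proof.
move=> -> lt; rewrite /eval_op -(_ : c + 2 ^ w = b + c + (2 ^ w - b)); last by lia.
by rewrite modnDr modn_small //; lia.
Qed.

Section Query.
Variables (eL eR eA : exp) (C : nat).

Definition condE : exp := (Ite (#0 < #1) (DDx (call2 3 (#0) (#1 - $1) eA) < #2) $0)%X.
Definition argE : exp := call2 2 (#0)%X (#1 - $1)%X eA.
Definition goE : exp := (Ite (#0) (#2 < #1) $0)%X.

(* Ranges [x, y) of ranks, all containing a hit, are kept on a stack: the argument of
   the minimal distance is reported, and the two remaining parts are pushed if they
   contain a hit. *)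
Definition trypush x y := Seq (comp [:: x; y; 5] 14 condE)
  (If 14 (Seq (Write 8 x) (Seq (Const 14 1) (Seq (Op Add 8 8 14) (Seq (Write 8 y) (Op Add 8 8 14))))) Skip).

(** Registers: 2 the number of reports left, 3 the size [D], 5 the length, 8 the stack pointer, 9
    whether to go on, 10 and 11 the popped range, 12 the rank of its minimum, 13 the position to
    report and afterwards the rank after the minimum. *)
Definition before := Seq (Const 14 1) (Seq (Op Defs.Sub 8 8 14) (Seq (Read 11 8)
  (Seq (Op Defs.Sub 8 8 14) (Seq (Read 10 8) (Seq (comp [:: 10; 11] 12 argE)
  (comp [:: 12] 13 (SAx (#0)%X))))))).
Definition after := Seq (Const 14 1) (Seq (Op Defs.Sub 2 2 14) (Seq (Op Add 13 12 14)
  (Seq (trypush 10 12) (Seq (trypush 13 11) (comp [:: 2; 8; 3] 9 goE))))).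
Definition loop := While 9 (Seq before (Seq (Report 13) after)).

Definition setup := Seq (Const 3 0) (Seq (Read 3 3) (Seq (Const 4 (4 + C)) (Seq (Op Mul 3 3 4)
  (Seq (Const 6 1) (Seq (Op Defs.Sub 4 0 6) (Seq (Op Defs.Sub 5 1 0) (Seq (Op Add 5 5 6)
  (Seq (comp [:: 4; 5] 6 eL) (Seq (comp [:: 4; 5] 7 eR)
  (Seq (Const 8 0) (Seq (Op Add 8 8 3) (Seq (trypush 6 7) (comp [:: 2; 8; 3] 9 goE))))))))))))).

Definition query := Seq setup loop.

(** This covers the way to the first report, through [setup], the test of the loop and [before], and
    the way between two reports, through [after], the test and [before]. *)
Definition cquery := steps setup + steps after + steps before + 1.

Variables (w L n : nat) (m : nat -> nat) (S G : seq nat).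
Hypotheses (fL : flat eL) (fR : flat eR) (fA : flat eA).
Variable D : nat.
Hypotheses (n0 : 0 < n) (nD42 : 4 * n + 42 < D) (LD : D + n.*2 < L) (Lw : L <= 2 ^ w).
Hypothesis (m0 : m 0 = n).
Hypothesis (sS : size S = n).
Notation ev := (eval w D m).
Definition lfv i l := ev [:: i; l.+1] eL.
Definition rgv i l := ev [:: i; l.+1] eR.
Definition sav q := ev [:: q] (SAx (#0)%X).
Definition ddv q := ev [:: q] (DDx (#0)%X).
Definition amv a b := ev [:: a; b] eA.
Hypothesis H : good n S G lfv rgv sav ddv amv.

Let D0 : 0 < D. Proof. lia. Qed.
Let DL : D <= L. Proof. lia. Qed.
Let Dw : D < 2 ^ w. Proof. lia. Qed.
Let nD : 4 * n < D. Proof. lia. Qed.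

Lemma straight_setup : straight setup.
Proof. by rewrite /= !straight_comp //= ?fA. Qed.
Lemma straight_before : straight before.
Proof. by rewrite /= !straight_comp //= ?fA. Qed.
Lemma straight_after : straight after.
Proof. by rewrite /= !straight_comp //= ?fA. Qed.

Section Loop.
Variable l : nat.
Definition act q := ddv q < l.
Definition rng (p : nat * nat) := iota p.1 (p.2 - p.1).
Definition Rs (stk : seq (nat * nat)) := flatten (map rng stk).
Definition okr (p : nat * nat) := (p.2 <= n) && has act (rng p).

Definition stored s (stk : seq (nat * nat)) :=
  [/\ word_state w s, reg s 3 = D, reg s 5 = l, (forall a, a < D -> memory s a = m a) &
   reg s 8 = D + (size stk).*2 /\ forall i, i < size stk ->
     memory s (D + i.*2) = (nth (0, 0) stk i).1 /\ memory s (D + i.*2 + 1) = (nth (0, 0) stk i).2].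

Lemma keeps_stored t s s' stk : 8 < t -> keeps w t s s' -> stored s stk -> stored s' stk.
Proof.
move=> t8 [km kr kw] [h1 h2 h3 h4 [h5 h6]]; split; rewrite ?km ?kr //; lia.
Qed.

Lemma eq_ev s stk e vs : stored s stk -> eval w D (memory s) vs e = ev vs e.
Proof. by move=> [_ _ _ h _]; apply: eq_eval. Qed.

Lemma evDD vs e : ev vs (DDx e) = ddv (ev vs e). Proof. by rewrite /ddv /=. Qed.

Lemma condP x y : y <= n -> has act (iota x (y - x)) = (x < y) && act (amv x y.-1).
Proof.
move=> yn; case: ltnP => xy /=; last by rewrite (_ : y - x = 0) //; lia.
have [xy1 y1n] : x <= y.-1 /\ y.-1 < n by lia.
have [h1 h2] := good_am sS H xy1 y1n.
apply/idP/idP => [/hasP[q]|h]; last apply/hasP.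
  by rewrite mem_iota => hq; rewrite /act; apply: leq_ltn_trans; apply: h2; lia.
by exists (amv x y.-1); rewrite // mem_iota; lia.
Qed.

Lemma condE_ok x y : x <= n -> y <= n -> ev [:: x; y; l] condE = has act (iota x (y - x)) :> nat.
Proof.
move=> xn yn; rewrite condP //; apply: (evIte (b := x < y)).
- exact: (evLt n0 m0 nD Dw).
- move=> xy; rewrite xy andTb; apply: (evLt n0 m0 nD Dw (a := ddv (amv x y.-1)) (b := l)) => //.
  rewrite evDD; congr ddv; apply: (evcall2 (a := x) (b := y.-1)) => //.
  by apply: (evSub n0 m0 nD Dw (a := y) (b := 1)); rewrite ?subn1 //; [apply: evC; lia | lia | lia].
by move=> /negbTE ->; apply: evC; lia.
Qed.

Lemma trypush_ok x y s stk : stored s stk -> (x < 14) && (y < 14) -> (x != 8) && (y != 8) ->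
  reg s x <= n -> reg s y <= n -> (size stk).*2 < n.*2 ->
  exists s', [/\ runs w L (trypush x y) s s',
    stored s' (if has act (rng (reg s x, reg s y)) then rcons stk (reg s x, reg s y) else stk)
    & forall z, z < 14 -> z != 8 -> reg s' z = reg s z].
Proof.
move=> st /andP[x14 y14] /andP[x8 y8] xn yn sz.
have [ws s3 s5 sm [s8 sk]] := st.
have rt : all (gtn 14) [:: x; y; 5] by rewrite /= x14 y14.
have [s1 [e1 v1 k1]] := @comp_ok w L D D0 DL Dw condE _ 14 s isT rt ws s3.
have st1 := keeps_stored (isT : 8 < 14) k1 st.
rewrite (eq_ev _ _ st) [map _ _]/= s5 condE_ok // in v1.
have [km kr kw] := k1.
have r1 z : z < 14 -> reg s1 z = reg s z by move/kr.
case: (boolP (has _ _)) => hh; rewrite /rng /= in hh *; last first.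
  exists s1; split=> //; last by move=> z /r1.
  apply: runs_seq e1 _; apply: runs_if0; first by rewrite v1 (negbTE hh).
  by exists [::]; apply: ExecSkip.
set s2 := set_mem s1 (D + (size stk).*2) (reg s x).
set s3' := set_reg s2 14 1.
set s4 := set_reg s3' 8 (D + (size stk).*2 + 1).
set s5' := set_mem s4 (D + (size stk).*2 + 1) (reg s y).
set s6 := set_reg s5' 8 (D + (size stk).*2 + 1 + 1).
have nw : n < 2 ^ w by clear - nD42 Dw; lia.
have [xw yw] : reg s x < 2 ^ w /\ reg s y < 2 ^ w by rewrite !(leq_ltn_trans _ nw).
have w1 : 1 < 2 ^ w by clear - nD42 Dw; lia.
have szD : D + (size stk).*2 + 1 < L by clear - sz LD; lia.
have szD' : D + (size stk).*2 + 1 + 1 < 2 ^ w by clear - sz LD Lw; lia.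
exists s6; split.
- apply: runs_seq e1 _; apply: runs_if; first by rewrite v1 hh.
  apply: runs_seq (_ : runs _ _ _ _ s2) _.
    by apply: runs_write; rewrite ?r1 ?s8 //; apply: leq_ltn_trans szD; apply: leq_addr.
  apply: runs_seq (_ : runs _ _ _ _ s3') _; first exact: runs_const.
  apply: runs_seq (_ : runs _ _ _ _ s4) _.
    by apply: runs_op; rewrite !reg_set /= r1 // s8 /eval_op modn_small //; clear - szD'; lia.
  apply: runs_seq (_ : runs _ _ _ _ s5') _.
    by apply: runs_write; rewrite // !reg_set /= (negbTE y8) (ltn_eqF y14) r1.
  by apply: runs_op; rewrite !reg_set /= /eval_op modn_small.
- split.
  + apply: word_set_reg => //; apply: word_set_mem => //.
    apply: word_set_reg; last by clear - szD'; lia.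
    by apply: word_set_reg => //; apply: word_set_mem.
  + by rewrite /s6 !reg_set /= r1.
  + by rewrite /s6 !reg_set /= r1.
  + move=> a aD; rewrite /s6 /= !ltn_eqF ?km ?sm //; clear - aD; lia.
  split; first by rewrite /s6 reg_set /= size_rcons; clear; lia.
  move=> i; rewrite size_rcons ltnS nth_rcons leq_eqVlt => /orP[/eqP ->|lt].
    rewrite ltnn eqxx /= ifF; last by clear; lia.
    by rewrite !eqxx.
  rewrite lt /= !ifF; try by clear - lt; lia.
  by rewrite km; apply: sk.
move=> z z14 z8; rewrite /s6 !reg_set /= (negbTE z8) ltn_eqF // r1 //.
Qed.

Lemma goE_ok s stk k : stored s stk -> reg s 2 = k -> (size stk).*2 <= n.*2 ->
  exists s', [/\ runs w L (comp [:: 2; 8; 3] 9 goE) s s', stored s' stk, reg s' 2 = k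
    & reg s' 9 = (k != 0) && (stk != [::])].
Proof.
move=> st s2 sz; have [ws s3 s5 sm [s8 sk]] := st.
have [s1 [e1 v1 k1]] := @comp_ok w L D D0 DL Dw goE [:: 2; 8; 3] 9 s isT isT ws s3.
exists s1; split=> //; first exact: (keeps_stored (isT : 8 < 9) k1).
  by case: k1 => _ -> //.
rewrite v1 (eq_ev _ _ st) [map _ _]/= s8 s3 s2.
case: (eqVneq k 0) => [->|k0] /=; first by rewrite mod0n.
rewrite k0 /eval_op /= -[X in X < _]addn0 ltn_add2l -size_eq0 double_gt0 lt0n.
by rewrite modn_small //; case: eqP => _; lia.
Qed.

Lemma iota_split x y q : x <= q < y -> iota x (y - x) = iota x (q - x) ++ q :: iota q.+1 (y - q.+1).
Proof.
move=> h; rewrite (_ : y - x = (q - x) + (y - q.+1).+1); last by lia.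
by rewrite iotaD subnKC //; lia.
Qed.

Lemma filter_Rs_rcons stk p : filter act (Rs (rcons stk p)) = filter act (Rs stk) ++ filter act (rng p).
Proof. by rewrite /Rs map_rcons flatten_rcons filter_cat. Qed.

Lemma filter_Rs_if stk p : filter act (Rs (if has act (rng p) then rcons stk p else stk)) =
  filter act (Rs stk) ++ filter act (rng p).
Proof.
case: ifP => [_|/negbT]; first exact: filter_Rs_rcons.
by rewrite has_filter negbK => /eqP ->; rewrite cats0.
Qed.

(** Each range contributes at least one hit to the concatenation; this keeps the stack within [2n]
    words. *)
Lemma size_Rs stk : all okr stk -> size stk <= size (filter act (Rs stk)).
Proof.
elim/last_ind: stk => // stk p IH; rewrite all_rcons => /andP[/andP[_ hp] /IH h].
rewrite filter_Rs_rcons size_cat size_rcons -addn1 leq_add //.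
by rewrite lt0n size_eq0 -has_filter.
Qed.

Lemma okr_if stk p : p.2 <= n -> all okr stk -> all okr (if has act (rng p) then rcons stk p else stk).
Proof. by move=> h1 h2; case: ifP => // h3; rewrite all_rcons /okr h1 h3. Qed.

Lemma before_ok stk x y s : stored s (rcons stk (x, y)) -> x < y <= n -> size stk < n ->
  exists s', [/\ runs w L before s s', stored s' stk, reg s' 2 = reg s 2,
    reg s' 10 = x /\ reg s' 11 = y & reg s' 12 = amv x y.-1 /\ reg s' 13 = sav (amv x y.-1)].
Proof.
move=> st /andP[xy yn] szn; have [ws s3 s5 sm [s8 sk]] := st.
rewrite size_rcons in s8 sk.
have [sk1 sk2] := sk _ (ltnSn _); rewrite nth_rcons ltnn eqxx /= in sk1 sk2.
set t1 := set_reg s 14 1.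
set t2 := set_reg t1 8 (D + (size stk).*2 + 1).
set t3 := set_reg t2 11 y.
set t4 := set_reg t3 8 (D + (size stk).*2).
set t5 := set_reg t4 10 x.
have D2 : D + (size stk).*2.+2 < 2 ^ w by clear - szn LD Lw; lia.
have w1 : 1 < 2 ^ w by clear - D2; lia.
have DL1 : D + (size stk).*2 + 1 < L by clear - szn LD; lia.
have D21 : D + (size stk).*2 + 1 < 2 ^ w by clear - D2; lia.
have yw : y < 2 ^ w by clear - yn nD42 Dw; lia.
have st5 : stored t5 stk.
  split=> //.
  - do 5 (apply: word_set_reg; last by rewrite //; clear - D2 xy yw; lia).
    by [].
  - by split=> // i lt; have := sk i; rewrite nth_rcons lt; apply; rewrite ltnW.
have st5w : word_state w t5 by case: st5.
have [t6 [e6 v6 k6]] := @comp_ok w L D D0 DL Dw argE [:: 10; 11] 12 t5 isT isT st5w s3.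
have st6 := keeps_stored (isT : 8 < 12) k6 st5.
rewrite (eq_ev _ _ st5) in v6.
have {}v6 : reg t6 12 = amv x y.-1.
  rewrite v6; apply: (evcall2 (a := x) (b := y.-1)) => //.
  by apply: (evSub n0 m0 nD Dw (a := y) (b := 1)); rewrite ?subn1 //; [exact: evC | clear - xy; lia].
have [w6 t63 _ _ _] := st6.
have [t7 [e7 v7 k7]] := @comp_ok w L D D0 DL Dw (SAx (#0)%X) [:: 12] 13 t6 isT isT w6 t63.
have st7 := keeps_stored (isT : 8 < 13) k7 st6.
have [_ r6 _] := k6; have [_ r7 _] := k7.
exists t7; split=> //.
- apply: runs_seq (_ : runs _ _ _ _ t1) _.
    exact: runs_const.
  apply: runs_seq (_ : runs _ _ _ _ t2) _.
    apply: (@runs_op _ _ _ _ _ _ _ (D + (size stk).*2 + 1)); rewrite /t1 !reg_set /= s8.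
    by apply: eval_sub; clear - D2; lia.
  apply: runs_seq (_ : runs _ _ _ _ t3) _.
    by apply: (@runs_read _ _ _ _ _ (D + (size stk).*2 + 1)).
  apply: runs_seq (_ : runs _ _ _ _ t4) _.
    apply: (@runs_op _ _ _ _ _ _ _ (D + (size stk).*2)); rewrite /t3 !reg_set /=.
    by apply: eval_sub; clear - D2; lia.
  apply: runs_seq (_ : runs _ _ _ _ t5) _.
    by apply: (@runs_read _ _ _ _ _ (D + (size stk).*2)) => //; clear - DL1; lia.
  exact: runs_seq e6 e7.
- by rewrite r7 // r6.
- by rewrite !r7 // !r6.
- by split; [rewrite r7 | rewrite v7 (eq_ev _ _ st6) [map _ _]/= v6].
Qed.

Lemma after_ok stk x y q k s : stored s stk -> x <= q < y -> y <= n -> size stk < n ->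
  k != 0 -> reg s 2 = k -> k < 2 ^ w ->
  reg s 10 = x -> reg s 11 = y -> reg s 12 = q ->
  let stk1 := if has act (rng (x, q)) then rcons stk (x, q) else stk in
  let stk2 := if has act (rng (q.+1, y)) then rcons stk1 (q.+1, y) else stk1 in
  size stk1 < n -> size stk2 <= n ->
  exists s', [/\ runs w L after s s', stored s' stk2, reg s' 2 = k.-1
    & reg s' 9 = (k.-1 != 0) && (stk2 != [::])].
Proof.
move=> st qxy yn sz k0 s2 kw sx sy sq stk1 stk2 sz1 sz2.
have [ws s3 s5 sm [s8 sk]] := st.
have w1 : 1 < 2 ^ w by clear - nD42 Dw; lia.
have [qn q1] : q < n /\ q.+1 < 2 ^ w by clear - qxy yn nD42 Dw; lia.
set t1 := set_reg s 14 1; set t2 := set_reg t1 2 k.-1; set t3 := set_reg t2 13 q.+1.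
have st3 : stored t3 stk.
  split=> //; do 3 (apply: word_set_reg; last by clear - kw q1 w1; lia); exact: ws.
have xn : x <= n by clear - qxy yn; lia.
have [|||||t4 [e4 st4 r4]] := trypush_ok (x := 10) (y := 12) st3; rewrite ?reg_set //= ?sx ?sq ?ltn_double ?(ltnW qn) //.
rewrite -[reg t3 10]/(reg s 10) -[reg t3 12]/(reg s 12) sx sq -/stk1 in st4.
have t413 : reg t4 13 = q.+1 by rewrite r4 // reg_set.
have t411 : reg t4 11 = y by rewrite r4 // -sy.
have [|||||t5 [e5 st5 r5]] := trypush_ok (x := 13) (y := 11) st4; rewrite ?t413 ?t411 ?ltn_double //.
rewrite t413 t411 -/stk2 in st5.
have t52 : reg t5 2 = k.-1 by rewrite r5 // r4.
have [|t6 [e6 st6 t62 t69]] := goE_ok st5 t52; first by rewrite leq_double.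
exists t6; split=> //.
apply: runs_seq (_ : runs _ _ _ _ t1) _; first exact: runs_const.
apply: runs_seq (_ : runs _ _ _ _ t2) _.
  by apply: runs_op; rewrite !reg_set /= s2; apply: eval_sub; clear - kw k0; lia.
apply: runs_seq (_ : runs _ _ _ _ t3) _.
  by apply: runs_op; rewrite !reg_set /= sq /eval_op addn1 modn_small.
apply: runs_seq e4 _; exact: runs_seq e5 e6.
Qed.

(** Each pass reports the rank of the minimum of the popped range, which removes exactly one hit
    from the stack; it cannot fail, as only ranges with a hit are pushed. The list [rest] holds the
    hits left over when [k] runs out. *)
Lemma loop_ok N : forall stk k s, stored s stk -> all okr stk -> reg s 2 = k -> k < 2 ^ w ->
  reg s 9 = (k != 0) && (stk != [::]) -> size (filter act (Rs stk)) < N -> N <= n.+1 ->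
  exists tr s' rs rest,
    [/\ exec w L loop s tr s', (forall a, a < D -> memory s' a = m a),
        (forall c g, steps after + steps before + 1 <= c -> g + steps before < c -> gapok c g tr),
        reports tr = map sav rs
      & perm_eq (filter act (Rs stk)) (rs ++ rest) /\ size rs = minn k (size (filter act (Rs stk)))].
Proof.
elim: N => // N IH stk k s st ok s2 kw s9 szN Nn.
have [ws s3 s5 sm [s8 sk]] := st.
have sz := size_Rs ok.
case: (boolP ((k != 0) && (stk != [::]))) s9 => [|ks] s9; last first.
  exists [:: None], s, [::], (filter act (Rs stk)); split=> //.
  - exact: ExecWhileFalse.
  - by move=> c g h1 h2 /=; lia.
  - split=> //; move: ks; rewrite negb_and !negbK => /orP[/eqP ->|/eqP ->]; first by rewrite min0n.
    by rewrite minn0.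
case/andP: s9 => k0; case/lastP: stk st ok szN s8 sk sz => // stk [x y] st ok szN s8 sk sz _ s9.
move: ok; rewrite all_rcons => /andP[/andP[/= yn hxy] ok].
rewrite filter_Rs_rcons in szN sz *.
have /andP[xy aq] : (x < y) && act (amv x y.-1) by rewrite -condP.
have [xy1 y1n] : x <= y.-1 /\ y.-1 < n by lia.
have [hq mq] := good_am sS H xy1 y1n.
have xyn : x < y <= n by rewrite xy.
rewrite size_rcons in sz; have {}sz : size stk < n by lia.
have [t1 [e1 st1 t12 [t1a t1b] [t1m t1s]]] := before_ok st xyn sz.
move: aq hq mq t1m t1s; set q := amv x y.-1 => aq hq mq t1m t1s.
have qxy : x <= q < y by lia.
set stk1 := if has act (rng (x, q)) then rcons stk (x, q) else stk.
set stk2 := if has act (rng (q.+1, y)) then rcons stk1 (q.+1, y) else stk1.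
have ok1 : all okr stk1 by apply: okr_if => //=; lia.
have ok2 : all okr stk2 by apply: okr_if.
have fE : perm_eq (filter act (Rs stk) ++ filter act (rng (x, y))) (q :: filter act (Rs stk2)).
  rewrite /stk2 filter_Rs_if /stk1 filter_Rs_if /rng /= (iota_split qxy) filter_cat /= aq.
  by apply/permP => p; rewrite /= !count_cat /= !addnA; congr (_ + _); rewrite addnC addnA.
have fs := perm_size fE; rewrite /= in fs.
have f1 : size stk1 <= size (filter act (Rs stk1)) := size_Rs ok1.
have f12 : size (filter act (Rs stk1)) <= size (filter act (Rs stk2)).
  by rewrite /stk2 filter_Rs_if size_cat leq_addr.
have f2 := size_Rs ok2.
rewrite fs ltnS in szN.
have b1 : size stk1 < n by apply: leq_ltn_trans f1 (leq_ltn_trans f12 (leq_trans szN _)).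
have b2 : size stk2 <= n by apply: leq_trans f2 (ltnW (leq_trans szN _)).
have [t2 [e2 st2 t22 t29]] := after_ok st1 qxy yn sz k0 (etrans t12 s2) kw t1a t1b t1m b1 b2.
have kw' : k.-1 < 2 ^ w by apply: leq_ltn_trans kw; apply: leq_pred.
have [tr [s' [rs [rest [h1 h2 h3 h4 [h5 h6]]]]]] := IH stk2 k.-1 t2 st2 ok2 t22 kw' t29 szN (ltnW Nn).
have [[u1 x1] [u2 x2]] := (e1, e2).
have [[l1 c1] [l2 c2]] := (straight_exec x1 straight_before, straight_exec x2 straight_after).
exists (None :: (u1 ++ [:: Some (reg t1 13)] ++ u2) ++ tr), s', (q :: rs), rest; split=> //.
- apply: ExecWhileTrue h1; first by rewrite s9.
  apply: ExecSeq x1 _; apply: ExecSeq x2; exact: ExecReport.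
- move=> c g h h'; rewrite /= -catA gapok_silent //= (gapok_silent _ _ _ l2).
  move: h h' c1 c2 {h1 e1 e2} (h3 c); move: (steps before) (steps after) => cb ca h h' c1 c2 {}h3.
  rewrite h3 // ?andbT; [clear - h' c1 | clear - h c2]; lia.
- by rewrite -(cat1s None) !reports_cat (reports_silent l1) (reports_silent l2) h4 /= t1s.
split; first by rewrite (perm_trans fE) //= perm_cons.
by rewrite /= h6 (perm_size fE) /= -minnSS prednK // lt0n.
Qed.
End Loop.

Hypotheses (DE : D = (4 + C) * n) (Cw : 4 + C < 2 ^ w).

Lemma setup_ok i j k s : 0 < i <= j -> j <= n -> k < 2 ^ w -> word_state w s ->
  (forall a, a < D -> memory s a = m a) -> reg s 0 = i -> reg s 1 = j -> reg s 2 = k ->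
  let p := (lfv i.-1 (j - i), rgv i.-1 (j - i)) in let l := (j - i).+1 in
  let stk := if has (act l) (rng p) then [:: p] else [::] in
  exists s', [/\ runs w L setup s s', stored l s' stk, reg s' 2 = k
    & reg s' 9 = (k != 0) && (stk != [::])].
Proof.
move=> ij jn kw ws sm s0 s1 s2 p l stk.
have [/andP[pp pn] _] := good_hit sS H ij jn.
have nw : n.+1 < 2 ^ w by clear - nD42 Dw; lia.
have w1 : 1 < 2 ^ w by clear - nw n0; lia.
have [iw jw lw] : [/\ i < 2 ^ w, j < 2 ^ w & l < 2 ^ w] by rewrite /l; split; clear - ij jn nw; lia.
have iE : i = 1 + i.-1 by clear - ij; lia.
have i1 : i.-1 < 2 ^ w by clear - iw; lia.
set t1 := set_reg s 3 0; set t2 := set_reg t1 3 n; set t3 := set_reg t2 4 (4 + C).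
set t4 := set_reg t3 3 D; set t5 := set_reg t4 6 1; set t6 := set_reg t5 4 i.-1.
set t7 := set_reg t6 5 (j - i); set t8 := set_reg t7 5 l.
have w8 : word_state w t8.
  do 8 (apply: word_set_reg; last by clear - Dw Cw w1 i1 nw lw jw; lia); exact: ws.
have [t9 [e9 v9 k9]] := @comp_ok w L D D0 DL Dw eL [:: 4; 5] 6 t8 isT isT w8 (erefl _).
have [m9 r9 w9] := k9.
have [t10 [e10 v10 k10]] := @comp_ok w L D D0 DL Dw eR [:: 4; 5] 7 t9 isT isT w9 (r9 3 isT).
have [m10 r10 w10] := k10.
have evE e vs : eval w D (memory s) vs e = ev vs e by apply: eq_eval.
rewrite -[memory t8]/(memory s) evE -[map _ _]/[:: i.-1; l] in v9.
rewrite m9 -[memory t8]/(memory s) evE [map _ _]/= !r9 // -[reg t8 4]/(i.-1) -[reg t8 5]/l in v10.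
set t11 := set_reg t10 8 0; set t12 := set_reg t11 8 D.
have st12 : stored l t12 [::].
  split=> //; first by do 2 (apply: word_set_reg; last by rewrite //; clear - Dw; lia).
  - by rewrite /t12 !reg_set /= r10 // r9.
  - by rewrite /t12 !reg_set /= r10 // r9.
  - by move=> a aD; rewrite /= m10 m9 sm.
  - by rewrite /t12 reg_set eqxx addn0.
have v6 : reg t12 6 = p.1 by rewrite /t12 !reg_set /= r10.
have v7 : reg t12 7 = p.2 by rewrite /t12 !reg_set.
have [|||||t13 [e13 st13 r13]] := trypush_ok (x := 6) (y := 7) st12; rewrite ?v6 ?v7 ?double_gt0 //.
  by apply: leq_trans pn; apply: ltnW.
rewrite v6 v7 -[(p.1, p.2)]/p -/stk in st13.
have t132 : reg t13 2 = k by rewrite r13 // /t12 !reg_set /= r10 // r9.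
have [|t14 [e14 st14 t142 t149]] := goE_ok st13 t132.
  by rewrite /stk; case: ifP => //= _; clear - n0; lia.
exists t14; split=> //; rewrite /setup.
apply: runs_seq (_ : runs _ _ _ _ t1) _; first exact: runs_const (ltnW w1).
apply: runs_seq (_ : runs _ _ _ _ t2) _.
  apply: (@runs_read _ _ _ _ _ 0) => //; first by clear - D0 DL; lia.
  by rewrite /= sm.
apply: runs_seq (_ : runs _ _ _ _ t3) _; first exact: runs_const.
apply: runs_seq (_ : runs _ _ _ _ t4) _.
  by apply: runs_op; rewrite -[LHS]/((n * (4 + C)) %% 2 ^ w) mulnC -DE modn_small.
apply: runs_seq (_ : runs _ _ _ _ t5) _; first exact: runs_const.
apply: runs_seq (_ : runs _ _ _ _ t6) _.
  by apply: runs_op; rewrite !reg_set /= s0; apply: eval_sub.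
apply: runs_seq (_ : runs _ _ _ _ t7) _.
  by apply: runs_op; rewrite !reg_set /= s0 s1; apply: eval_sub => //; clear - ij; lia.
apply: runs_seq (_ : runs _ _ _ _ t8) _.
  by apply: runs_op; rewrite !reg_set /= /eval_op addn1 modn_small.
apply: runs_seq e9 _; apply: runs_seq e10 _.
apply: runs_seq (_ : runs _ _ _ _ t11) _; first exact: runs_const (ltnW w1).
apply: runs_seq (_ : runs _ _ _ _ t12) _.
  by apply: runs_op; rewrite !reg_set /= r10 // r9 // /eval_op add0n modn_small.
exact: runs_seq e13 e14.
Qed.

Lemma query_ok c : cquery <= c -> supports w L c query S G (mkseq m D).
Proof.
move=> hc i j k s ij jn kw ws hold s0 s1 s2; rewrite sS in jn.
have sm a : a < D -> memory s a = m a.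
  by move=> aD; rewrite hold ?size_mkseq // nth_mkseq.
have [t [e st t2 t9]] := setup_ok ij jn kw ws sm s0 s1 s2.
have [/andP[pp pn] hh] := good_hit sS H ij jn.
have cE := good_count sS H ij jn; rewrite -sS in cE.
move: st t9 pp pn hh cE => /=.
set a := lfv _ _; set b := rgv _ _; set l := (j - i).+1; set p := (a, b); set stk := if _ then _ else _.
move=> st t9 pp pn hh cE.
have fE : filter (act l) (Rs stk) = filter (act l) (rng p).
  have := @filter_Rs_if l [::] p; rewrite /= => <-.
  by rewrite /stk; case: ifP.
have sN : size (filter (act l) (Rs stk)) < n.+1.
  rewrite fE ltnS size_filter; apply: leq_trans (count_size _ _) _.
  by rewrite size_iota /=; clear - pn; lia.
have ok : all (okr l) stk by rewrite /stk; case: ifP => //= h; rewrite /okr h pn.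
have [tr [s' [rs [rest [h1 h2 h3 h4 [h5 h6]]]]]] := loop_ok st ok t2 kw t9 sN (leqnn _).
have [u x1] := e; have [l1 c1] := straight_exec x1 straight_setup.
have sub : {subset rs <= filter (act l) (rng p)}.
  by move=> q hq; rewrite -fE (perm_mem h5) mem_cat hq.
have rsn q : q \in rs -> q < n /\ hit S G i j (sav q).
  move=> /sub; rewrite mem_filter mem_iota /= => /andP[aq hq].
  have qn : q < n by clear - hq pn; lia.
  split=> //; rewrite hh //; apply/andP; split; [clear - hq; lia | exact: aq].
exists (u ++ tr), s'; rewrite reports_cat (reports_silent l1) h4; split.
- exact: ExecSeq x1 h1.
- by move=> x; rewrite size_mkseq => xD; rewrite h2 // nth_mkseq.
- apply: gapok_constant_delay; rewrite gapok_silent // add0n.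
  move: hc c1 (h3 c); rewrite /cquery; move: (steps setup) (steps after) (steps before) => cs ca cb hc c1 {}h3.
  by apply: h3; clear - hc c1; lia.
split.
- rewrite map_inj_in_uniq.
    have : uniq (filter (act l) (Rs stk)) by rewrite fE filter_uniq // iota_uniq.
    by rewrite (perm_uniq h5) cat_uniq => /and3P[].
  move=> x y /rsn[xn _] /rsn[yn _]; exact: (good_inj H).
- by apply/allP => x /mapP[q /rsn[_ hq] ->].
- rewrite size_map h6 fE size_filter cE; reflexivity.
Qed.
End Query.

(** * The building program *)

Section Odometer.
Variable b : nat.

Fixpoint val (m : nat -> nat) p r := if r is r'.+1 then m p + b * val m p.+1 r' else 0.

Lemma eq_val m m' p r : (forall a, p <= a < p + r -> m a = m' a) -> val m p r = val m' p r.
Proof.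
elim: r p => //= r IH p h; rewrite h ?(IH p.+1) // => [a ha|]; last by lia.
by apply: h; lia.
Qed.

Lemma val_inj m m' p r : (forall a, m a < b) -> (forall a, p <= a < p + r -> m' a < b) ->
  val m p r = val m' p r -> forall a, p <= a < p + r -> m a = m' a.
Proof.
move=> hm; elim: r p => [|r IH] p h' /=; first by lia.
have hp := hm p; have hp' : m' p < b by apply: h'; lia.
have b0 : 0 < b by lia.
move=> e a; have e1 : m p = m' p.
  by have := congr1 (modn^~ b) e; rewrite ![_ + b * _]addnC ![b * _]mulnC !modnMDl !modn_small.
have e2 : val m p.+1 r = val m' p.+1 r.
  by move/eqP: e; rewrite e1 eqn_add2l eqn_pmul2l // => /eqP.
case: (ltngtP a p) => [|pa|-> //]; first by lia.
move=> ha; apply: (IH p.+1) => //; last by lia.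
by move=> c hc; apply: h'; lia.
Qed.

Lemma val_lt m p r : 0 < b -> (forall a, p <= a < p + r -> m a < b) -> val m p r < b ^ r.
Proof.
move=> b0; elim: r p => [|r IH] p h /=; first by rewrite expn0.
have lt : val m p.+1 r < b ^ r by apply: IH => a ha; apply: h; lia.
have hp : m p < b by apply: h; lia.
have : b * (val m p.+1 r).+1 <= b * b ^ r by rewrite leq_mul2l lt orbT.
by rewrite expnS mulnS; lia.
Qed.

Lemma val0 m p r : (forall a, p <= a < p + r -> m a = 0) -> val m p r = 0.
Proof.
elim: r p => //= r IH p h; rewrite h ?IH ?muln0 //; last by lia.
by move=> a ha; apply: h; lia.
Qed.
End Odometer.

Section Build.
Variables (check : exp) (C : nat).

(* The contents of the region [4n, D) are enumerated in the order of the numbers they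
   represent in base 2^w, until one passes the check. *)
Definition zero := While 6 (Seq (Write 5 7) (Seq (Op Add 5 5 8) (Op Lt 6 5 3))).
Definition incr := While 7 (Seq (Read 11 6) (Seq (Op Add 11 11 8) (Seq (Write 6 11)
  (Seq (Const 12 0) (Seq (Op Eq 7 11 12) (Op Add 6 6 8)))))).
Definition test := Seq (comp [::] 9 check) (Seq (Const 10 0) (Op Eq 10 9 10)).
Definition search := While 10 (Seq (Const 6 0) (Seq (Op Add 6 6 4) (Seq (Const 7 1)
  (Seq (Const 8 1) (Seq incr test))))).
Definition build := Seq (Const 3 0) (Seq (Read 3 3) (Seq (Const 4 4) (Seq (Op Mul 4 4 3)
  (Seq (Const 5 (4 + C)) (Seq (Op Mul 3 3 5)
  (Seq (Const 5 0) (Seq (Op Add 5 5 4) (Seq (Op Lt 6 5 3) (Seq (Const 7 0) (Seq (Const 8 1)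
  (Seq zero (Seq test search)))))))))))).

Variables (w L D A : nat).
Hypotheses (A0 : 0 < A) (AD : A < D) (DL : D <= L) (Dw : D < 2 ^ w).
Let b := 2 ^ w.

Definition same_regs (rs : seq nat) s s' := forall x, x \in rs -> reg s' x = reg s x.

Lemma bool_modn (x : bool) : (x : nat) %% 2 ^ w = x.
Proof. by rewrite modn_small //; case: x; lia. Qed.

Lemma zero_ok r : forall s, word_state w s -> reg s 3 = D -> reg s 5 + r = D -> A <= reg s 5 ->
  reg s 6 = (0 < r) -> reg s 7 = 0 -> reg s 8 = 1 ->
  exists s', [/\ runs w L zero s s', word_state w s', same_regs [:: 3; 4] s s' &
    forall a, memory s' a = if reg s 5 <= a < D then 0 else memory s a].
Proof.
elim: r => [|r IH] s ws s3 s5 sA s6 s7 s8.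
  exists s; split=> //; first exact: runs_while0.
  by move=> a; case: ifP => //; lia.
set p := reg s 5 in s5 sA *.
set s1 := set_mem s p 0; set s2 := set_reg s1 5 p.+1; set s3' := set_reg s2 6 (0 < r).
have [|||||||s' [h1 h2 h3 h4]] := IH s3' => //.
- do 2 (apply: word_set_reg; last by clear -s5 Dw; lia); apply: word_set_mem => //; lia.
- by rewrite /s3' !reg_set /=; lia.
- by rewrite /s3' !reg_set /=; lia.
exists s'; split=> //.
- apply: runs_while h1; first by rewrite s6.
  apply: runs_seq (_ : runs _ _ _ _ s1) _; first by apply: runs_write; rewrite ?s7 //; lia.
  apply: runs_seq (_ : runs _ _ _ _ s2) _.
    by apply: runs_op; rewrite /= s8 /eval_op addn1 modn_small //; lia.
  by apply: runs_op; rewrite /= s3 /eval_op bool_modn; congr nat_of_bool; lia.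
- by move=> x hx; rewrite h3 //; move: hx; rewrite !inE => /orP[] /eqP ->.
move=> a; rewrite h4 /s3' !reg_set /=; case: (eqVneq a p) => [->|ne].
  by rewrite ltnn /= (_ : p <= p < D) //; lia.
by congr (if _ then _ else _); lia.
Qed.

(** Register 7 is the carry: it survives just when a digit wraps around to 0. As the successor is
    below [b ^ r], the carry dies inside the region. *)
Lemma incr_ok r : forall s, word_state w s -> reg s 6 + r = D -> A <= reg s 6 ->
  reg s 7 = 1 -> reg s 8 = 1 -> (val b (memory s) (reg s 6) r).+1 < b ^ r ->
  exists s', [/\ runs w L incr s s', word_state w s', same_regs [:: 3; 4] s s',
    (forall a, (reg s 6 <= a < D) = false -> memory s' a = memory s a) &
    val b (memory s') (reg s 6) r = (val b (memory s) (reg s 6) r).+1].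
Proof.
elim: r => [|r IH] s ws s6 sA s7 s8; first by rewrite expn0.
set p := reg s 6 in s6 sA *; rewrite [val _ _ _ _]/= => hv.
have dw : memory s p < b by case: ws.
set d := memory s p in dw hv *; set v := val b (memory s) p.+1 r in hv *.
have b1 : 1 < b by rewrite /b; lia.
set d' := d.+1 %% b.
set t1 := set_reg s 11 d; set t2 := set_reg t1 11 d'; set t3 := set_mem t2 p d'.
set t4 := set_reg t3 12 0; set t5 := set_reg t4 7 (d' == 0); set t6 := set_reg t5 6 p.+1.
have d'w : d' < b by rewrite ltn_mod; lia.
have w6 : word_state w t6.
  apply: word_set_reg; last by lia.
  apply: word_set_reg; last by case: (d' == 0); lia.
  apply: word_set_reg; last by lia.
  by apply: word_set_mem => //; do 2 apply: word_set_reg => //.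
have body : runs w L (Seq (Read 11 6) (Seq (Op Add 11 11 8) (Seq (Write 6 11)
  (Seq (Const 12 0) (Seq (Op Eq 7 11 12) (Op Add 6 6 8)))))) s t6.
  apply: runs_seq (_ : runs _ _ _ _ t1) _; first by apply: runs_read; rewrite //; lia.
  apply: runs_seq (_ : runs _ _ _ _ t2) _; first by apply: runs_op; rewrite /= s8 /eval_op addn1.
  apply: runs_seq (_ : runs _ _ _ _ t3) _; first by apply: runs_write; rewrite //=; lia.
  apply: runs_seq (_ : runs _ _ _ _ t4) _; first by apply: runs_const; lia.
  apply: runs_seq (_ : runs _ _ _ _ t5) _; first by apply: runs_op; rewrite /= /eval_op bool_modn.
  by apply: runs_op; rewrite /= s8 /eval_op addn1 modn_small //; lia.
have vE : val b (memory t6) p.+1 r = v.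
  by apply: eq_val => a ha /=; rewrite ifF //; lia.
case: (eqVneq d.+1 b) => [e|ne].
  have d0 : d' = 0 by rewrite /d' e modnn.
  have hv' : v.+1 < b ^ r.
    move: hv; rewrite expnS -e addnC -addnS e -mulnSr ltn_mul2l; lia.
  have [|||||s' [h1 h2 h3 h4 h5]] := IH t6 w6; rewrite ?reg_set //=; try lia.
  + by rewrite vE.
  rewrite /= vE in h4 h5.
  exists s'; split=> //.
  - by apply: runs_while body h1; rewrite s7.
  - by move=> x hx; rewrite h3 //; move: hx; rewrite !inE => /orP[] /eqP ->.
  - move=> a ha; rewrite h4 /=; last by lia.
    by rewrite ifF //; lia.
  rewrite /= h5 h4 /= ?eqxx ?d0; last by lia.
  by rewrite add0n mulnS -e; lia.
have d'E : d' = d.+1 by rewrite /d' modn_small // ltn_neqAle ne.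
exists t6; split=> //.
- apply: runs_while body _; first by rewrite s7.
  by apply: runs_while0; rewrite /= d'E.
- by move=> x; rewrite !inE => /orP[] /eqP ->.
- by move=> a ha /=; rewrite ifF //; lia.
by rewrite [val _ _ _ _]/= vE /= eqxx d'E addSn.
Qed.

Lemma test_ok s : word_state w s -> reg s 3 = D -> exists s', [/\ runs w L test s s',
  word_state w s', same_regs [:: 3; 4] s s', memory s' = memory s &
  reg s' 10 = (eval w D (memory s) [::] check == 0)].
Proof.
move=> ws s3; have D0 : 0 < D by lia.
have [s1 [h1 h3 [h4 h5 h6]]] := comp_ok D0 DL Dw check (isT : 3 < 9) (isT : all (gtn 9) [::]) ws s3.
exists (set_reg (set_reg s1 10 0) 10 (eval w D (memory s) [::] check == 0)); split=> //.
- apply: runs_seq h1 _.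
  apply: runs_seq; first by apply: runs_const; lia.
  by apply: runs_op; rewrite /= h3 /eval_op bool_modn.
- apply: word_set_reg; last by case: (_ == _); lia.
  by apply: word_set_reg => //; lia.
- by move=> x; rewrite !inE => /orP[] /eqP ->; rewrite /= h5.
Qed.

Variable mI : nat -> nat.
Hypotheses (mIw : forall a, A <= a < D -> mI a < b) (mIc : eval w D mI [::] check != 0).

(** Induction on the distance [k] to the number of the intended content [mI], which passes the
    check. At distance 0 the contents agree; before that, either the check already passes or the
    enumeration advances by one. *)
Lemma search_ok k : forall s, word_state w s -> reg s 3 = D -> reg s 4 = A ->
  (forall a, a < A -> memory s a = mI a) ->
  reg s 10 = (eval w D (memory s) [::] check == 0) ->
  val b (memory s) A (D - A) + k = val b mI A (D - A) ->
  exists s', [/\ runs w L search s s', (forall a, a < A -> memory s' a = mI a) &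
    eval w D (memory s') [::] check != 0].
Proof.
elim: k => [|k IH] s ws s3 s4 sm s10 hv.
  have e : eval w D (memory s) [::] check = eval w D mI [::] check.
    apply: eq_eval; first by lia.
    move=> a aD; case: (ltnP a A) => [/sm //|Aa].
    apply: (@val_inj b _ _ A (D - A)); last by lia.
    - by case: ws.
    - by move=> c hc; apply: mIw; lia.
    by lia.
  rewrite e (negbTE mIc) in s10; exists s; split=> //; last by rewrite e.
  exact: runs_while0.
case: (eqVneq (eval w D (memory s) [::] check) 0) => [e|ne]; last first.
  by exists s; split=> //; apply: runs_while0; rewrite s10 (negbTE ne).
set t1 := set_reg s 6 0; set t2 := set_reg t1 6 A; set t3 := set_reg t2 7 1; set t4 := set_reg t3 8 1.
have b0 : 0 < b by rewrite /b; lia.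
have lt : (val b (memory s) A (D - A)).+1 < b ^ (D - A).
  apply: leq_trans (val_lt b0 (_ : forall a, A <= a < A + (D - A) -> mI a < b)); first by lia.
  by move=> a ha; apply: mIw; lia.
have w4 : word_state w t4 by do 4 (apply: word_set_reg; last by lia).
have [|||||t5 [h1 h2 h3 h4 h5]] := incr_ok w4 (_ : reg t4 6 + (D - A) = D); rewrite ?reg_set //=; try lia.
have t53 : reg t5 3 = D by rewrite h3.
rewrite /= in h4 h5.
have [t6 [g1 g2 g3 g4 g5]] := test_ok h2 t53.
have [|||||s' [f1 f2 f3]] := IH t6 g2; rewrite ?g4 //.
- by rewrite g3.
- by rewrite g3 // h3.
- by move=> a aA; rewrite h4 ?sm //; lia.
- by rewrite h5; lia.
exists s'; split=> //; apply: runs_while f1; first by rewrite s10 e.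
apply: runs_seq (_ : runs _ _ _ _ t1) _; first by apply: runs_const; lia.
apply: runs_seq (_ : runs _ _ _ _ t2) _.
  by apply: runs_op; rewrite /= s4 /eval_op add0n modn_small //; lia.
apply: runs_seq (_ : runs _ _ _ _ t3) _; first by apply: runs_const; lia.
apply: runs_seq (_ : runs _ _ _ _ t4) _; first by apply: runs_const; lia.
exact: runs_seq h1 g1.
Qed.

Variable n : nat.
Hypotheses (AE : A = 4 * n) (DE : D = (4 + C) * n) (Cw : 4 + C < 2 ^ w).

Lemma build_ok s : word_state w s -> memory s 0 = n -> (forall a, a < A -> memory s a = mI a) ->
  exists s', [/\ runs w L build s s', (forall a, a < A -> memory s' a = mI a) &
    eval w D (memory s') [::] check != 0].
Proof.
move=> ws s0 sm.
have nw : n < 2 ^ w by lia.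
set t1 := set_reg s 3 0; set t2 := set_reg t1 3 n; set t3 := set_reg t2 4 4; set t4 := set_reg t3 4 A.
set t5 := set_reg t4 5 (4 + C); set t6 := set_reg t5 3 D; set t7 := set_reg t6 5 0.
set t8 := set_reg t7 5 A; set t9 := set_reg t8 6 1; set t10 := set_reg t9 7 0; set t11 := set_reg t10 8 1.
have w4 : 4 < 2 ^ w by lia.
have w11 : word_state w t11 by do 11 (apply: word_set_reg; last by rewrite //; clear - w4 nw AD Dw Cw; lia).
have [|||||t12 [h1 h2 h3 h4]] := @zero_ok (D - A) t11 w11 (erefl _); rewrite ?reg_set //=.
- by lia.
- by rewrite subn_gt0 AD.
rewrite /= in h4.
have t123 : reg t12 3 = D by rewrite h3.
have [t13 [g1 g2 g3 g4 g5]] := test_ok h2 t123.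
have m13 a : a < A -> memory t13 a = mI a by move=> aA; rewrite g4 h4 ifF ?sm //; lia.
have v13 : val b (memory t13) A (D - A) = 0.
  by apply: val0 => a ha; rewrite g4 h4 ifT //; lia.
have t133 : reg t13 3 = D by rewrite g3.
have t134 : reg t13 4 = A by rewrite g3 // h3.
rewrite -g4 in g5; have v13k : val b (memory t13) A (D - A) + val b mI A (D - A) = val b mI A (D - A) by rewrite v13.
have [s' [f1 f2 f3]] := search_ok g2 t133 t134 m13 g5 v13k.
exists s'; split=> //.
apply: runs_seq (_ : runs _ _ _ _ t1) _; first by apply: runs_const; lia.
apply: runs_seq (_ : runs _ _ _ _ t2) _; first by apply: runs_read; rewrite //=; lia.
apply: runs_seq (_ : runs _ _ _ _ t3) _; first by apply: runs_const.
apply: runs_seq (_ : runs _ _ _ _ t4) _.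
  by apply: runs_op; rewrite -[LHS]/((4 * n) %% 2 ^ w) -AE modn_small //; lia.
apply: runs_seq (_ : runs _ _ _ _ t5) _; first exact: runs_const.
apply: runs_seq (_ : runs _ _ _ _ t6) _.
  by apply: runs_op; rewrite -[LHS]/((n * (4 + C)) %% 2 ^ w) mulnC -DE modn_small.
apply: runs_seq (_ : runs _ _ _ _ t7) _; first by apply: runs_const; lia.
apply: runs_seq (_ : runs _ _ _ _ t8) _.
  by apply: runs_op; rewrite -[LHS]/((0 + A) %% 2 ^ w) modn_small //; lia.
apply: runs_seq (_ : runs _ _ _ _ t9) _.
  by apply: runs_op; rewrite -[LHS]/((A < D : nat) %% 2 ^ w) bool_modn AD.
apply: runs_seq (_ : runs _ _ _ _ t10) _; first by apply: runs_const; lia.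
apply: runs_seq (_ : runs _ _ _ _ t11) _; first by apply: runs_const; lia.
apply: runs_seq h1 _; exact: runs_seq g1 f1.
Qed.
End Build.

(** * Layout and size of the tables *)

Section Layout.
Variables (n : nat) (m0 : nat -> nat) (specs : seq ((nat -> nat) * nat)).

Definition tables := [seq mkseq p.1 p.2 | p <- specs].
Definition total := sumn [seq p.2 | p <- specs].
Definition offs t := 4 * n + size specs + sumn (take t (shape tables)).
Definition region := mkseq offs (size specs) ++ flatten tables.
Definition layout a := if a < 4 * n then m0 a else nth 0 region (a - 4 * n).

Lemma shape_tables : shape tables = [seq p.2 | p <- specs].
Proof. by rewrite /shape -map_comp; apply: eq_map => p /=; rewrite size_mkseq. Qed.

Lemma layout_tab D t F N : 4 * n + size specs + total < D -> t < size specs ->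
  nth (F, N) specs t = (F, N) -> tab D n layout t F N.
Proof.
move=> hD ts E.
have st : t < size tables by rewrite size_map.
have hdr : layout (4 * n + t) = offs t.
  by rewrite /layout ltnNge leq_addr /= addKn nth_cat size_mkseq ts nth_mkseq.
split; first by lia.
move=> a aN; rewrite hdr.
have tE : nth [::] tables t = mkseq F N by rewrite (nth_map (F, N)) // E.
have aS : a < size (nth [::] tables t) by rewrite tE size_mkseq.
have lt := flatten_off_lt st aS.
have sz : size (flatten tables) = total by rewrite size_flatten shape_tables.
split; first by rewrite /offs; lia.
rewrite /layout /offs ifF; last by lia.
rewrite (_ : _ - _ = size specs + (sumn (take t (shape tables)) + a)); last by lia.
rewrite nth_cat size_mkseq ltnNge leq_addr /= addKn nth_flatten_off // tE nth_mkseq //.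
Qed.

Lemma layout_lt b a : 4 * n + size specs + total < b ->
  (forall t x, t < size specs -> let p := nth (id, 0) specs t in x < p.2 -> p.1 x < b) ->
  4 * n <= a -> layout a < b.
Proof.
move=> hb hs ha; rewrite /layout ifF; last by lia.
case: (ltnP (a - 4 * n) (size region)) => h; last by rewrite nth_default //; lia.
have := mem_nth 0 h; set v := nth _ _ _; rewrite mem_cat => /orP[/mapP[t]|].
  rewrite mem_iota => /andP[_ ts] ->; rewrite /offs shape_tables.
  suff : sumn (take t [seq p.2 | p <- specs]) <= total by lia.
  by rewrite /total -{2}(cat_take_drop t [seq p.2 | p <- specs]) sumn_cat leq_addr.
case/flattenP => s /(nthP [::])[t]; rewrite size_map => ts <-.
rewrite (nth_map (id, 0)) // => /mapP[x]; rewrite mem_iota => /andP[_ xN] ->.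
exact: hs.
Qed.
End Layout.

Lemma leq_expl a b k : a <= b -> a ^ k <= b ^ k.
Proof. by case: k => // k h; rewrite leq_exp2r. Qed.

Lemma expn_le2 d k : d ^ k <= 2 ^ (d * k).
Proof. by rewrite expnM; apply/leq_expl/ltnW/ltn_expl. Qed.

(** * The choice of the parameters *)

Section Params.
Variables (e n : nat).
Hypotheses (n0 : 0 < n) (e256 : 256 <= e).

Definition lamv := trunc_log 2 n.
(** The summand [e], at least 256 = 2^8, makes [dv] at least 2 for every n, at the price of the
    factor [2 ^ e] in [M]. *)
Definition mu := lamv + e.
(* The degree d is about the eighth root of log n, so that the tables indexed by
   d^2 small numbers have size O(n); then g = d^32 exceeds (log n)^2, and 34
   levels of a tree of degree d see beyond g. *)
Definition dv := find (fun d => mu < d.+1 ^ 8) (iota 0 mu.+1).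
Definition gv := dv ^ 32.
(** A word of [bev.*2] bits holds [2n + 1], while there are only about the square root of 8n half
    words, so that a table over two of them has O(n) entries. *)
Definition bev := lamv.+3./2.
(** The stacks of a block are subsets of it; with blocks of half the logarithm there are only about
    the square root of n of them. *)
Definition sv := (lamv./2).+1.
Definition M := 2 ^ e * n.

Lemma lam_le : 2 ^ lamv <= n. Proof. exact: trunc_logP. Qed.
Lemma lam_lt : n < 2 ^ lamv.+1. Proof. exact: trunc_log_ltn. Qed.

Lemma P_le : 2 ^ mu <= M.
Proof. by rewrite /mu expnD mulnC leq_mul2l lam_le orbT. Qed.

Lemma n_le : n <= M. Proof. by rewrite leq_pmull // expn_gt0. Qed.

Lemma dv_bounds : dv ^ 8 <= mu < dv.+1 ^ 8.
Proof.
have lt : dv < mu.+1.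
  rewrite /dv -[X in _ < X](size_iota 0 mu.+1) -has_find; apply/hasP; exists mu; first by rewrite mem_iota add0n ltnSn.
  by have := @leq_pexp2l mu.+1 1 8 isT isT; rewrite expn1.
rewrite (find_iotaT lt) andbT; case E : dv => [|k]; first by rewrite exp0n.
have : k < dv by rewrite E.
by move/find_iotaF; rewrite -leqNgt.
Qed.

Lemma dv2 : 2 <= dv.
Proof.
have /andP[_] := dv_bounds; apply: contraTT; rewrite -!leqNgt => h.
apply: leq_trans (_ : 2 ^ 8 <= _); first by rewrite leq_exp2r.
by rewrite (_ : 2 ^ 8 = 256) // /mu; lia.
Qed.

Lemma mu_d16 : mu < dv ^ 16.
Proof.
have /andP[_ h] := dv_bounds; apply: leq_trans h _.
rewrite (_ : 16 = 2 * 8) // expnM leq_exp2r // expnS expn1.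
by have := dv2; nia.
Qed.

(** The room for the tables: by [mu_2] a bit position takes at most [2 ^ (16 * dv)] values, so that
    families of [dv ^ 2] of them number at most [2 ^ (16 * dv ^ 3)]. This uses at most half of the
    exponent [mu] and leaves the rest to the half word. *)
Lemma d3_mu : 32 * dv ^ 3 <= mu.
Proof.
have /andP[h _] := dv_bounds; apply: leq_trans h.
rewrite (_ : 8 = 5 + 3) // expnD leq_mul2r (_ : 32 = 2 ^ 5) // leq_exp2r // dv2 orbT //.
Qed.

Lemma d_le_d3 : dv <= dv ^ 3.
Proof. by rewrite -{1}(expn1 dv) leq_pexp2l //; have := dv2; lia. Qed.
Lemma d2_le_d3 : 2 * dv ^ 2 <= dv ^ 3.
Proof. by rewrite [dv ^ 3]expnS leq_mul2r dv2 orbT. Qed.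
Lemma d_le_d2 : 2 * dv <= dv ^ 2.
Proof. by rewrite expnS expn1 leq_mul2r dv2 orbT. Qed.

Lemma mu_2 : mu < 2 ^ (16 * dv).
Proof. by apply: leq_trans mu_d16 _; rewrite mulnC expn_le2. Qed.

Lemma exp_M k : k <= mu -> 2 ^ k <= M.
Proof. by move=> h; apply: leq_trans P_le; rewrite leq_pexp2l. Qed.

Lemma g_M : gv <= M.
Proof.
apply: leq_trans (expn_le2 _ _) _; apply: exp_M; apply: leq_trans d3_mu.
by rewrite mulnC leq_mul2l d_le_d3 orbT.
Qed.

Lemma mu2_g : mu * mu <= gv.
Proof.
have h := ltnW mu_d16; apply: leq_trans (leq_mul h h) _.
by rewrite -expnD.
Qed.

Lemma mu_M : mu <= M. Proof. by apply: leq_trans (exp_M (leqnn _)); apply: ltnW; apply: ltn_expl. Qed.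
Lemma mu_g : mu <= gv.
Proof. by apply: leq_trans mu2_g; rewrite leq_pmulr //; rewrite /mu; lia. Qed.
Lemma d_g : dv <= gv. Proof. by rewrite /gv -{1}(expn1 dv) leq_pexp2l //; have := dv2; lia. Qed.
Lemma g_pos : 0 < gv. Proof. by rewrite expn_gt0; have := dv2; lia. Qed.

Lemma be_lam : lamv.+2 <= bev.*2 <= lamv.+3.
Proof. by rewrite /bev; lia. Qed.

Lemma nW_ok : n.*2.+1 < 2 ^ W bev.
Proof.
apply: leq_trans (_ : 2 ^ lamv.+2 <= _); first by rewrite expnS; have := lam_lt; lia.
by rewrite leq_pexp2l // /W; case/andP: be_lam.
Qed.

Lemma win_g : gv.*2.+1 < dv ^ 34.
Proof.
rewrite (_ : 34 = 2 + 32) // expnD -/gv.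
have : 4 <= dv ^ 2 by rewrite (_ : 4 = 2 ^ 2) // leq_exp2r // dv2.
by have := g_pos; nia.
Qed.

Lemma Hn_win : Hn lamv <= dv ^ 34.
Proof.
apply: leq_trans (ltnW win_g); have := mu_g; rewrite /mu /Hn; lia.
Qed.

Lemma card_BitT : Sg dv = 2 ^ dv ^ 2.
Proof. by rewrite /Sg card_ffun card_prod card_bool card_ord expnS expn1. Qed.

Lemma card_PosT_lt : #|PosT dv bev| * B bev <= M.
Proof.
rewrite /PosT card_ffun card_prod !card_ord /B.
apply: leq_trans (_ : (2 ^ (16 * dv)) ^ (dv * dv) * 2 ^ bev <= _).
  rewrite leq_mul2r; apply/orP; right; apply: leq_expl; apply: leq_trans (ltnW mu_2).
  by have := be_lam; rewrite /mu; lia.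
rewrite -expnM -expnD; apply: exp_M.
have := d3_mu; have := be_lam; rewrite (_ : 16 * dv * (dv * dv) = 16 * dv ^ 3); last by rewrite !expnS; lia.
by rewrite /mu; lia.
Qed.

Lemma BB_M : B bev * B bev <= M.
Proof. by rewrite /B -expnD addnn; apply: exp_M; have := be_lam; rewrite /mu; lia. Qed.

Lemma Sg3_M : Sg dv * Sg dv * Sg dv <= M.
Proof.
rewrite card_BitT -!expnD; apply: exp_M; apply: leq_trans d3_mu; have := d2_le_d3; lia.
Qed.

Lemma LevT_M : #|LevT dv bev| * (W bev).+1 * 2 * dv <= M.
Proof.
rewrite /LevT card_ffun card_prod card_bool !card_ord.
have h : (W bev).+1 * 2 <= 2 ^ (16 * dv).+1.
  by rewrite expnS mulnC leq_mul2l; have := mu_2; have := be_lam; rewrite /W /mu; lia.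
rewrite -(mulnA _ (W bev).+1 2) -expnSr.
apply: leq_trans (_ : (2 ^ (16 * dv).+1) ^ dv.+1 * 2 ^ dv <= _).
  by apply: leq_mul; [rewrite leq_exp2r | apply: ltnW; apply: ltn_expl].
rewrite -expnM -expnD; apply: exp_M; apply: leq_trans d3_mu.
have := d_le_d3; have := d2_le_d3; have := d_le_d2; have := dv2.
rewrite (_ : (16 * dv).+1 * dv.+1 + dv = 16 * dv ^ 2 + 18 * dv + 1); last by rewrite !expnS; lia.
lia.
Qed.

Lemma stk_M : 2 ^ sv * sv <= M.
Proof.
apply: leq_trans (_ : 2 ^ sv * 2 ^ sv <= _).
  by rewrite leq_mul2l ltnW ?orbT // ltn_expl.
by rewrite -expnD; apply: exp_M; rewrite /mu /sv; lia.
Qed.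

Lemma div_g k : k <= gv -> n %/ gv * k <= n.
Proof. by move=> h; apply: leq_trans (leq_divM n gv); rewrite leq_mul2l h orbT. Qed.
End Params.

Section Sizes.
Variables (e : nat) (T : seq nat).
Let n := size T.
Hypotheses (n0 : 0 < n) (e256 : 256 <= e).
Notation lam := (lamv n).
Notation g := (gv e n).
Notation d := (dv e n).
Notation M := (M e n).
Let g0 : 0 < g := g_pos n0 e256.
Let lamlt : n < 2 ^ lam.+1 := lam_lt n.

Lemma lam_mu : lam.+2 <= mu e n. Proof. by rewrite /mu; lia. Qed.

Lemma sum_const_seq (A : Type) (s : seq A) c : \sum_(x <- s) c = size s * c.
Proof. by rewrite big_const_seq count_predT iter_addn_0 mulnC. Qed.

(** On level [h] there are at most 2n / 2^h rows, each with at most (3 * 2^h / g) * (lam + 1)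
    entries. As there are at most lam + 1 levels, a factor (lam + 1)^2 remains, which is at most
    [g]. *)
Lemma size_T2s : size (flatten (T2s T lam g)) <= 6 * n.
Proof.
pose F h := ((2 ^ h).*2 %/ g).+1 * lam.+1.
have -> : size (flatten (T2s T lam g)) = \sum_(h <- hs lam g) (n %/ 2 ^ h).+1 * F h.
  rewrite size_flatten sumnE /T2s /shape /mkseq !big_map.
  under eq_bigr => r _ do rewrite size_map size_iota -/(F (hr T lam g r)).
  transitivity (\sum_(p <- rws T lam g) F p.1).
    rewrite -[in RHS](mkseq_nth (0, 0) (rws T lam g)) big_map.
    by apply: eq_bigr.
  rewrite big_allpairs_dep; apply: eq_bigr => h _.
  by rewrite (eq_bigr (fun=> F h)) // sum_const_seq size_iota.
rewrite -(@leq_pmul2r g) //.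
apply: leq_trans (_ : \sum_(h <- hs lam g) 6 * n * lam.+1 <= _).
  rewrite big_distrl /= ![\sum_(_ <- _) _]big_seq; apply: leq_sum => h.
  rewrite mem_filter mem_iota /= add0n ltnS => /andP[gh hl].
  have pn : 2 ^ h <= n by apply: leq_trans (lam_le n0); rewrite leq_pexp2l.
  rewrite /F; set p := 2 ^ h in gh pn *.
  have a1 : (n %/ p).+1 * p <= 2 * n by rewrite mulSn; have := leq_divM n p; lia.
  have q1 : (p.*2 %/ g).+1 * g <= 3 * p by rewrite mulSn; have := leq_divM p.*2 g; lia.
  rewrite mulnA -(mulnAC _ g) leq_mul2r; apply/orP; right.
  rewrite -mulnA; apply: leq_trans (leq_mul (leqnn _) q1) _.
  by rewrite mulnCA -[6 * n]/(3 * 2 * n) -mulnA leq_mul2l.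
rewrite sum_const_seq mulnC -mulnA leq_mul2l; apply/orP; right.
apply: leq_trans (mu2_g n0 e256); apply: leq_mul; first by have := lam_mu; lia.
rewrite /hs size_filter; apply: leq_trans (count_size _ _) _.
by rewrite size_iota; have := lam_mu; lia.
Qed.

Lemma size_KKs_le : size (flatten (KKs T lam g)) <= 6 * n.
Proof.
apply: leq_trans size_T2s; rewrite !size_flatten !sumnE /T2s /KKs /shape /mkseq !big_map.
apply: leq_sum => r _; rewrite size_rcons size_map size_iota.
apply: leq_trans (_ : ((2 ^ hr T lam g r).*2 %/ g).+1 <= _); first by exact: (size_keys n0 g0 lamlt).
by rewrite leq_pmulr.
Qed.

Lemma size_rws_le : size (rws T lam g) <= 6 * n.
Proof.
apply: leq_trans size_KKs_le; rewrite size_flatten sumnE /KKs /shape /mkseq !big_map.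
have {1}-> : size (rws T lam g) = \sum_(r <- iota 0 (size (rws T lam g))) 1.
  by rewrite sum_const_seq size_iota muln1.
by apply: leq_sum => r _; rewrite size_rcons.
Qed.

Lemma NRHn_le : NR T g * Hn lam <= 2 * M.
Proof.
rewrite /NR mulSn -/n; have h : Hn lam <= g by apply: leq_trans (mu_g n0 e256); exact: lam_mu.
have := div_g h; have := n_le e n; have := mu_M e n0; have := lam_mu; rewrite /Hn; lia.
Qed.

Lemma size_VV_le : size (VV T lam g) <= 12 * M.
Proof.
have d0 : 0 < d by have := dv2 n0 e256; lia.
rewrite (size_VV n0 g0 lamlt d0) /KK0 /LA0; have := size_KKs_le; have := NRHn_le.
by have := n_le e n; rewrite -/n; lia.
Qed.

Lemma X_le_M : lam.+1 * EB T g <= 3 * M.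
Proof.
rewrite /EB mulnDr mulnC -/n; have h : lam.+1 <= g by have := mu_g n0 e256; have := lam_mu; lia.
have := div_g h; have := n_le e n; have := mu_M e n0; have := lam_mu; lia.
Qed.

Lemma T1_le_M : lam.+1 * K lam * EB T g * 2 <= 6 * M.
Proof.
rewrite /EB /K; have h : lam.+1 * lam.+1 <= g.
  by apply: leq_trans (mu2_g n0 e256); apply: leq_mul; have := lam_mu; lia.
have := div_g h; have := n_le e n; have := g_M n0 e256; rewrite -/n => h1 h2 h3.
rewrite mulnDr mulnC [lam.+1 * lam.+1 * (_ %/ _)]mulnC; lia.
Qed.

Lemma SP_le_M : lam.+1 * NBs (sv n) n <= 3 * M.
Proof.
rewrite /NBs; have h : lam.+1 <= 2 * sv n by rewrite /sv; lia.
have := leq_divM n (sv n); have := n_le e n; have := mu_M e n0; have := lam_mu.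
have := leq_mul h (leqnn (n %/ sv n)); lia.
Qed.

Definition NBv := (size (VV T lam g) %/ d).+1.

Lemma NBv_le : NBv * d <= 13 * M.
Proof.
rewrite /NBv mulSn; have := leq_divM (size (VV T lam g)) d; have := size_VV_le.
by have := d_g n0 e256; have := g_M n0 e256; lia.
Qed.

Lemma NBv_VV : size (VV T lam g) <= NBv * d.
Proof. by apply: ltnW; apply: ltn_ceil; have := dv2 n0 e256; lia. Qed.

Lemma T2s_entry v : v \in flatten (T2s T lam g) -> v <= 12 * M.
Proof.
move=> /flattenP[s /mapP[r]]; rewrite mem_iota => /andP[_ hr] -> /mapP[c _ ->].
have d0 : 0 < d by have := dv2 n0 e256; lia.
apply: leq_trans size_VV_le; rewrite (size_VV n0 g0 lamlt d0) -addnA leq_add2l; apply: ltnW; apply: leq_ltn_trans (offK_lt hr (leqnn _)).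
rewrite leq_add2l; apply: leq_trans (leq_subr _ _) _; exact: count_size.
Qed.
End Sizes.

(** The values are bounded along with the sizes, because they have to fit into words. *)
Definition okspec U (p : (nat -> nat) * nat) := p.2 <= U /\ forall x, x < p.2 -> p.1 x <= U.
Fixpoint allok U specs := if specs is p :: ps then okspec U p /\ allok U ps else True.

Lemma allok_total U specs : allok U specs -> total specs <= size specs * U.
Proof. by elim: specs => //= p ps IH [[h _] /IH]; rewrite mulSn; apply: leq_add. Qed.

Lemma allok_nth U specs t : allok U specs -> t < size specs -> okspec U (nth (id, 0) specs t).
Proof. by elim: specs t => //= p ps IH [|t] [h1 h2] //; apply: IH. Qed.

Lemma okspec1 U v : 0 < U -> v <= U -> okspec U (fun=> v, 1).
Proof. by []. Qed.

Lemma sumn_take_le t s : sumn (take t s) <= sumn s.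
Proof. by rewrite -{2}(cat_take_drop t s) sumn_cat leq_addr. Qed.

Section Specs.
Variables (e : nat) (S G : seq nat).
Let n := size S.
Notation lam := (lamv n).
Notation g := (gv e n).
Notation d := (dv e n).
Notation be := (bev n).
Notation s := (sv n).
Notation NB := (NBv e S).
Notation V := (V S lam g d).
Notation DD := (distG S G).
Notation La := 34.

(* The k-th entry is the function stored in table k and the size of this table. *)
Definition specs : seq ((nat -> nat) * nat) := [::
  (fun=> B be, 1); (fun=> Sg d, 1); (fun=> d, 1); (fun=> be, 1); (fun=> (W be).+1, 1);
  (fun=> NB, 1); (fun=> g, 1); (fun=> Hn lam, 1); (fun=> EB S g, 1); (fun=> K lam, 1);
  (fun=> LA0 S, 1); (fun=> KK0 S lam g, 1); (fun=> s, 1); (fun=> NBs s n, 1);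
  (px d be, #|PosT d be| * B be); (lvt be, B be * B be); (u1 d, Sg d * Sg d * Sg d);
  (u2 d be, #|LevT d be| * (W be).+1 * 2 * d);
  (perb d NB V (cc1 d be), La * NB); (perb d NB V (cc2 d be), La * NB); (perb d NB V (@occ d), La * NB);
  (perbd d NB V id, La * NB * d); (perbd d NB V (qcc d be), La * NB * d);
  (nth 0 (VV S lam g), size (VV S lam g)); (fun i => index i (sa S), n);
  (rowix S lam g, NR S g * Hn lam); (ir S lam g, size (rws S lam g)); (id, 0);
  (offT S lam g, size (rws S lam g));
  (fun c => xmax S (2 ^ (c %/ EB S g)) (c %% EB S g * g), lam.+1 * EB S g);
  (trunc_log 2, n.+1);
  (fun c => T1 S g (2 ^ (c %/ 2 %/ EB S g %/ K lam)) (c %/ 2 %/ EB S g %% K lam)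
            (c %/ 2 %% EB S g * g) (c %% 2), lam.+1 * K lam * EB S g * 2);
  (nth 0 (flatten (T2s S lam g)), size (flatten (T2s S lam g)));
  (nth 0 (flatten (KLs S lam g (lft S))), size (flatten (KKs S lam g)));
  (nth 0 (flatten (KLs S lam g (rgt S))), size (flatten (KKs S lam g)));
  (fun q => (suf S q).+1, n); (DD, n); (RMf s, #|StkT s| * s); (fun b => enc (stk DD s b), n);
  (fun a => am DD a (a %/ s * s + s.-1), n); (fun b => am DD (b %/ s * s) b, n);
  (SPf DD s n, lam.+1 * NBs s n)].

Hypotheses (n0 : 0 < n) (e256 : 256 <= e).
Notation M := (M e n).
(** The largest tables have [34 * NB * d] entries, at most [34 * 13 * M], and 500 exceeds 442. *)
Notation U := (500 * M).
Let g0 : 0 < g := g_pos n0 e256.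
Let lamlt : n < 2 ^ lam.+1 := lam_lt n.
Let d2 : 1 < d := dv2 n0 e256.
Let d0 : 0 < d := ltnW d2.
Let M0 : 0 < M. Proof. by apply: leq_trans (n_le e n). Qed.

Lemma suf_le q : suf S q <= n.
Proof.
case: (ltnP q n) => h; first exact: ltnW (suf_lt h).
by rewrite /suf nth_default // size_sa.
Qed.

Lemma KLs_entry fn x : (forall i l, fn i l <= n) -> nth 0 (flatten (KLs S lam g fn)) x <= n.
Proof.
move=> h; case: (ltnP x (size (flatten (KLs S lam g fn)))) => hx; last by rewrite nth_default.
have /flattenP[t /mapP[r _ ->] /mapP[c _ ->]] := mem_nth 0 hx; exact: h.
Qed.

Lemma am_le (f : nat -> nat) a b : a <= b -> am f a b <= b.
Proof. by move=> h; case: (am_ok f h) => /andP[]. Qed.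

Lemma allok_specs : allok U specs.
Proof.
have M0' := M0; have nM : n <= M := n_le e n; have muM : mu e n <= M := mu_M e n0.
have lmu : lam.+2 <= mu e n := lam_mu n0 e256; have gM : g <= M := g_M n0 e256; have dg : d <= g := d_g n0 e256.
have PM := card_PosT_lt n0 e256; have BM := BB_M n0 e256; have SM := Sg3_M n0 e256.
have LM := LevT_M n0 e256; have kM := stk_M n0 e256.
have B0 : 0 < B be by rewrite expn_gt0.
have S0 : 0 < Sg d by apply: leq_ltn_trans (enc_lt (bit0 d)).
have SgM : Sg d <= M by apply: leq_trans SM; rewrite -mulnA leq_pmulr // muln_gt0 S0.
have PosM : #|PosT d be| <= M by apply: leq_trans PM; rewrite leq_pmulr.
have LevM : #|LevT d be| <= M.
  by apply: leq_trans LM; rewrite -!mulnA leq_pmulr // !muln_gt0.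
have BeM : B be <= M by apply: leq_trans BM; rewrite leq_pmulr.
have sE : s <= M by rewrite /sv; clear - lmu muM; lia.
have StM : #|StkT s| <= M by rewrite card_ffun card_bool card_ord; apply: leq_trans kM; rewrite leq_pmulr.
have beM : (W be).+1 <= M by have := be_lam n0 e256; rewrite /W /mu in lmu muM *; clear - muM e256; lia.
have NBM : NB * d <= 13 * M := NBv_le n0 e256.
have NBM' : NB <= 13 * M by apply: leq_trans NBM; rewrite leq_pmulr.
have VVM := size_VV_le n0 e256; have NRM := NRHn_le n0 e256.
have KKM := size_KKs_le n0 e256; have rM := size_rws_le n0 e256; have tM := size_T2s n0 e256.
have XM := X_le_M n0 e256; have T1M := T1_le_M n0 e256; have SPM := SP_le_M n0 e256.
have KK0M : KK0 S lam g <= 12 * M.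
  by apply: leq_trans VVM; rewrite (size_VV n0 g0 lamlt d0) leq_addr.
have sizes : [/\ [/\ 0 < U, n.*2.+2 <= U, M <= U & 13 * M <= U], [/\ La * NB <= U, La * NB * d <= U & 12 * M <= U],
   [/\ n.+1 <= U, 6 * n <= U, 3 * M <= U & 6 * M <= U] & [/\ 2 * M <= U & n <= U]].
  clear - M0' nM NBM NBM'; split; split; try lia.
case: sizes => -[U0 Un2 UM U13] [UNB UNBd U12] [Un1 U6n U3 U6] [U2 Un].
have le_M x : x <= M -> x <= U by move/leq_trans; apply.
split; first by apply: okspec1 => //; apply: le_M.
split; first by apply: okspec1 => //; apply: le_M.
split; first by apply: okspec1 => //; apply: le_M; apply: leq_trans dg gM.
split; first by apply: okspec1 => //; apply: le_M; move: beM; rewrite /W; clear; lia.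
split; first by apply: okspec1 => //; apply: le_M.
split; first by apply: okspec1 => //; apply: leq_trans NBM' U13.
split; first by apply: okspec1 => //; apply: le_M.
split; first by apply: okspec1 => //; apply: le_M; apply: leq_trans muM.
split; first by apply: okspec1 => //; apply: leq_trans U3; apply: leq_trans XM; rewrite leq_pmull.
split; first by apply: okspec1 => //; apply: le_M; apply: leq_trans muM; apply: ltnW.
split; first exact: okspec1.
split; first by apply: okspec1 => //; apply: leq_trans KK0M U12.
split; first by apply: okspec1 => //; apply: le_M.
split; first by apply: okspec1 => //; apply: leq_trans U3; apply: leq_trans SPM; rewrite leq_pmull.
split; first by split=> [|x _]; apply: le_M => //; apply: leq_trans SgM; apply: ltnW; apply: enc_lt.
split; first by split=> [|x _]; apply: le_M => //; apply: leq_trans (lev_le be _ _) _; move: beM; rewrite /W; clear; lia.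
split.
  split=> [|x _]; apply: le_M => //; rewrite /= /u1; case: pickP => // a _.
  by apply: leq_trans (ltnW (ltn_ord a)) (leq_trans dg gM).
split.
  split=> [|x _]; apply: le_M => //; apply: leq_trans (find_size _ _) _.
  by rewrite size_enum_ord; apply: leq_trans dg gM.
split; first by split=> // x _; apply: le_M; apply: leq_trans PosM; apply: ltnW; apply: enc_lt.
split; first by split=> // x _; apply: le_M; apply: leq_trans PosM; apply: ltnW; apply: enc_lt.
split; first by split=> // x _; apply: le_M; apply: leq_trans SgM; apply: ltnW; apply: enc_lt.
split.
  split=> // x _; apply: leq_trans Un2; rewrite /= /perbd /perb /ykey /= ltnW // ltnS ltnS leq_double.
  exact: V_le.
split; first by split=> // x _; apply: le_M; apply: leq_trans LevM; apply: ltnW; apply: enc_lt.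
split.
  split=> [|x xs]; first by apply: leq_trans VVM U12.
  by apply: leq_trans Un; apply: VV_le n0 g0 lamlt _ (mem_nth 0 xs).
split; first by split=> // x _; apply: leq_trans Un; rewrite -[X in _ <= X](size_sa S); apply: index_size.
split.
  split=> [|x _]; first by apply: leq_trans NRM U2.
  by apply: leq_trans U6n; apply: leq_trans rM; apply: index_size.
split.
  split=> [|x _]; first by apply: leq_trans rM U6n.
  by apply: leq_trans Un; apply: suf_le.
split=> //.
split.
  split=> [|x _]; first by apply: leq_trans rM U6n.
  apply: leq_trans U6n; apply: leq_trans tM; rewrite size_flatten; exact: sumn_take_le.
split.
  split=> [|x _]; first by apply: leq_trans XM U3.
  apply: leq_trans Un; apply/bigmax_leqP => i _; apply: ltnW; apply: leq_trans (ltn_ord i) _; exact: geq_minr.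
split.
  split=> [|x]; first exact: Un1.
  rewrite ltnS => xn; apply: leq_trans Un; apply: leq_trans xn; rewrite /=; case: x => // x.
  by apply: ltnW; apply: leq_trans (ltn_expl _ (isT : 1 < 2)) (trunc_logP _ _).
split.
  split=> [|x _]; first by apply: leq_trans T1M U6.
  by apply: leq_trans Un; apply: leq_trans (leq_div _ _) _; apply: cnt_n.
split.
  split=> [|x xs]; first by apply: leq_trans tM U6n.
  by apply: leq_trans U12; apply: T2s_entry n0 e256 _ (mem_nth 0 xs).
split.
  split=> [|x _]; first by apply: leq_trans KKM U6n.
  by apply: leq_trans Un; apply: KLs_entry => i l; apply: find_iota_le.
split.
  split=> [|x _]; first by apply: leq_trans KKM U6n.
  by apply: leq_trans Un; apply: KLs_entry => i l; apply: rgt_le.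
split; first by split=> // x _; apply: leq_trans Un1; rewrite ltnS suf_le.
split; first by split=> // x _; apply: leq_trans Un; apply: find_iota_le.
split.
  split=> [|x _]; first by apply: le_M; move: kM; rewrite card_ffun card_bool card_ord.
  by apply: le_M; apply: leq_trans sE; apply: leq_trans (find_size _ _) _; rewrite size_enum_ord.
split; first by split=> // x _; apply: le_M; apply: leq_trans StM; apply: ltnW; apply: enc_lt.
split.
  split=> // x xn; apply: leq_trans U2; apply: leq_trans (am_le _ _) _.
    by rewrite {1}(divn_eq x s) leq_add2l -ltnS prednK // ltn_mod.
  rewrite mul2n -addnn; apply: leq_add; last exact: leq_trans (leq_pred _) sE.
  exact: leq_trans (leq_divM x s) (leq_trans (ltnW xn) nM).
split; first by split=> // x xn; apply: leq_trans Un; apply: leq_trans (am_le _ (leq_divM _ _)) (ltnW xn).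
split=> //; split=> [|x _]; first by apply: leq_trans SPM U3.
by apply: leq_trans Un; apply: geq_minl.
Qed.
End Specs.

(** * The data structure *)

Definition eL := LocE 34 false.
Definition eR := LocE 34 true.

Section Ideal.
Variables (e w : nat) (S G : seq nat) (m0 : nat -> nat).
Let n := size S.
(** There are 42 tables of at most [500 * 2 ^ e * n] words each; the remaining [43 * n] words leave
    room for the header with their 42 addresses. *)
Definition Cv := 43 + 42 * (500 * 2 ^ e).
Notation D := ((4 + Cv) * n).
Hypotheses (n0 : 0 < n) (e256 : 256 <= e) (Dw : D < 2 ^ w).
Hypotheses (sG : size G <= n) (Gn : all (leq^~ n) G)
  (m00 : m0 0 = n) (m01 : m0 1 = size G)
  (mS : forall x, x < n -> m0 (x + 2) = nth 0 S x)
  (mG : forall k, k < size G -> m0 (k + n + 2) = nth 0 G k).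

Definition ideal := layout n m0 (specs e S G).
Notation lam := (lamv n).
Notation g := (gv e n).
Notation d := (dv e n).
Notation ev := (eval w D ideal).

Lemma D_big : 4 * n + size (specs e S G) + total (specs e S G) < D /\ 500 * M e n < D.
Proof.
have := allok_total (allok_specs G n0 e256).
rewrite -/n /M /Cv mulnDl -[size (specs e S G)]/42.
have -> : (43 + 42 * (500 * 2 ^ e)) * n = 43 * n + 42 * (500 * (2 ^ e * n)) by rewrite mulnDl -!mulnA.
move: (2 ^ e * n) (total _) n0 => k t; clear; lia.
Qed.

Let D1 := proj1 D_big.
Lemma nD42 : 4 * n + 42 < D. Proof. by apply: leq_ltn_trans D1; rewrite leq_addr. Qed.
Let nD : 4 * n < D. Proof. by apply: leq_ltn_trans nD42; rewrite leq_addr. Qed.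

Lemma ideal_low a : a < 4 * n -> ideal a = m0 a.
Proof. by rewrite /ideal /layout => ->. Qed.

Lemma ideal_word a : 4 * n <= a -> ideal a < 2 ^ w.
Proof.
apply: layout_lt; first exact: ltn_trans D1 Dw.
move=> t x ts p xp; have [_ h] := allok_nth (allok_specs G n0 e256) ts.
by apply: leq_ltn_trans (h _ xp) (ltn_trans (proj2 D_big) Dw).
Qed.

Let low k : k <= n.*2 -> k < 4 * n. Proof. by move: n0; clear; lia. Qed.
Let i0 : ideal 0 = n. Proof. by rewrite ideal_low // low. Qed.

Let tabs t F N : t < 42 -> nth (F, N) (specs e S G) t = (F, N) -> tab D n ideal t F N.
Proof. by move=> ht; apply: layout_tab. Qed.

Lemma ideal_LocE right i l : i < n -> 0 < l -> i + l <= n ->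
  ev [:: i; l] (LocE 34 right) = if right then rgt S i l else lft S i l.
Proof.
move=> i_n l0 il.
have gM := g_M n0 e256; have nM := n_le e n; have lamM := lam_le n0.
have [_ D2] := D_big.
apply: (@LocE_ok 34 w D ideal S n0 i0 nD Dw lam g d (bev n) (NBv e S)); try exact: tabs.
- exact: dv2 n0 e256.
- by [].
- exact: g_pos n0 e256.
- exact: lam_lt.
- exact: nW_ok n0 e256.
- exact: NBv_VV n0 e256.
- exact: win_g n0 e256.
- exact: Hn_win n0 e256.
- by [].
- by move: D2 gM nM n0; clear; lia.
- by move: D2 gM nM n0 lamM; clear; lia.
- by [].
- by [].
- by [].
Qed.

Lemma ideal_AME a b : a <= b -> b < n -> is_am (distG S G) a b (ev [:: a; b] AME).
Proof.
by apply: (@AME_ok (distG S G) (sv n) n lam isT w D ideal n0 i0 nD Dw (lam_lt n)); exact: tabs.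
Qed.

Lemma ideal_check_gen xL xR xA :
  (forall i l, i < n -> 0 < l -> i + l <= n -> ev [:: i; l] xL = lft S i l) ->
  (forall i l, i < n -> 0 < l -> i + l <= n -> ev [:: i; l] xR = rgt S i l) ->
  (forall a b, a <= b -> b < n -> is_am (distG S G) a b (ev [:: a; b] xA)) ->
  ev [::] (check xL xR xA) != 0.
Proof.
move=> hL hR hA.
have iS x : x < n -> ideal (x + 2) = nth 0 S x.
  by move=> xn; rewrite ideal_low ?mS //; move: xn; clear; lia.
have iG k : k < size G -> ideal (k + n + 2) = nth 0 G k.
  by move=> kG; rewrite ideal_low ?mG //; move: kG sG n0; clear; lia.
have i1 : ideal 1 = size G by rewrite ideal_low // low // double_gt0.
rewrite -/(tt w D ideal [::] (check xL xR xA)).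
rewrite (@checkE xL xR xA n S G (lfv xL w ideal D) (rgv xR w ideal D) (sav w ideal D) (ddv w ideal D)
  (amv xA w ideal D) w D ideal n0 nD42 Dw (erefl _) sG Gn i0 i1 iS iG
  (fun _ _ => erefl) (fun _ _ => erefl) (fun _ => erefl) (fun _ => erefl) (fun _ _ => erefl)).
apply: ideal_good => //.
- move=> i l il; have i_n : i < n by apply: leq_ltn_trans il; apply: leq_addr.
  by split; [apply: hL | apply: hR]; rewrite ?addnS.
- by move=> q qn; apply: (evT (F := fun q => (suf S q).+1) (N := n) n0 i0 nD Dw); first exact: tabs.
- by move=> q qn; apply: (evT (F := distG S G) (N := n) n0 i0 nD Dw); first exact: tabs.
Qed.

Lemma ideal_check : ev [::] (check eL eR AME) != 0.
Proof.
by apply: ideal_check_gen;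
  [exact: (@ideal_LocE false) | exact: (@ideal_LocE true) | exact: ideal_AME].
Qed.
End Ideal.

(** This holds for any content that passes the check, whether or not it is the intended one. *)
Lemma supports_of_check xL xR xA C w L n m (S G : seq nat) c (D := (4 + C) * n) :
  flat xL -> flat xR -> flat xA -> 0 < n -> 4 * n + 42 < D -> D + n.*2 < L -> L <= 2 ^ w ->
  4 + C < 2 ^ w -> size S = n -> size G <= n -> all (leq^~ n) G -> m 0 = n -> m 1 = size G ->
  (forall x, x < n -> m (x + 2) = nth 0 S x) ->
  (forall k, k < size G -> m (k + n + 2) = nth 0 G k) ->
  eval w D m [::] (check xL xR xA) != 0 -> cquery xL xR xA C <= c ->
  supports w L c (query xL xR xA C) S G (mkseq m D).
Proof.
move=> fL fR fA n0 nD DL Lw Cw sS sG Gn m0 m1 mS mG chk.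
have Dw : D < 2 ^ w by apply: leq_trans Lw; apply: leq_ltn_trans DL; apply: leq_addr.
apply: (query_ok fL fR fA n0 nD DL Lw m0 sS _ (erefl _) Cw).
rewrite -(@checkE xL xR xA n S G (lfv xL w m D) (rgv xR w m D) (sav w m D) (ddv w m D)
  (amv xA w m D) w D m n0 nD Dw sS sG Gn m0 m1 mS mG
  (fun _ _ => erefl) (fun _ _ => erefl) (fun _ => erefl) (fun _ => erefl) (fun _ _ => erefl)).
exact: chk.
Qed.

(* The word length w is Theta(log n): large enough to address the c * n words
   of memory, and at most b times the bit length of c * n. *)
Theorem theorem23 (b : nat) :
  exists (build query : cmd) (c : nat),
  forall (n sigma w : nat) (S : n.-tuple nat) (G : seq nat),
    0 < n ->
    c * n <= 2 ^ w ->
    w <= b * (trunc_log 2 (c * n)).+1 ->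
    sigma < 2 ^ w ->
    all (fun x => 1 <= x <= sigma) S ->
    uniq G ->
    attractor S G ->
    forall s : state, word_state w s -> holds (memory s) (input S G) ->
    exists (t : trace) (s' : state) (D : seq nat),
      [/\ exec w (c * n) build s t s',
          size D <= c * n,
          holds (memory s') D
        & supports w (c * n) c query S G D].
Proof.
(* [e] and [C] are kept abstract, so that the unary number [2 ^ 256] is never unfolded. *)
have [e e256] : exists e, 256 <= e by exists 256.
have [C CE] : exists C, C = Cv e by exists (Cv e).
(* [c] pays for the delay and for the space: [(4 + C) * n] words hold the input and the tables,
   [2 * n] words the stack, and one further [n] makes the bound strict. *)
have [c [cq cC]] : exists c, cquery eL eR AME C <= c /\ C + 7 <= c.
  by exists (cquery eL eR AME C + (C + 7)); rewrite leq_addr leq_addl.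
exists (build (check eL eR AME) C), (query eL eR AME C), c.
move=> n sigma w S G n0 cw _ _ _ uG [aG _] s ws hold.
have sS : size S = n := size_tuple S.
have sG : size G <= n.
  rewrite -(size_iota 1 n); apply: uniq_leq_size => // x /(allP aG); rewrite sS mem_iota; clear; lia.
have Gn : all (leq^~ n) G by apply: sub_all aG => x; rewrite sS => /andP[].
have rd a : a < n + size G + 2 -> memory s a = nth 0 (input S G) a.
  by move=> h; apply: hold; rewrite /= size_cat sS; move: h; clear; lia.
have m0 : memory s 0 = n by rewrite rd // addnC.
have m1 : memory s 1 = size G by rewrite rd // addnC.
have mS x : x < n -> memory s (x + 2) = nth 0 S x.
  by move=> xn; rewrite rd; [rewrite addn2 /= nth_cat sS xn | move: xn; clear; lia].
have mG k : k < size G -> memory s (k + n + 2) = nth 0 G k.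
  move=> kG; rewrite rd; last by move: kG; clear; lia.
  by rewrite addn2 /= nth_cat sS ltnNge leq_addl /= addnK.
have cn : (4 + C) * n + n.*2 < c * n.
  by apply: leq_trans (_ : (C + 7) * n <= _); rewrite ?leq_mul2r ?cC ?orbT //; move: n0; clear; lia.
have Dw : (4 + C) * n < 2 ^ w by apply: leq_trans cw; apply: leq_ltn_trans cn; apply: leq_addr.
have Cw : 4 + C < 2 ^ w by apply: leq_ltn_trans Dw; rewrite leq_pmulr.
have nD42' : 4 * n + 42 < (4 + C) * n by rewrite -sS CE; apply: nD42; rewrite ?sS.
have nD : 4 * n < (4 + C) * n by apply: leq_ltn_trans nD42'; apply: leq_addr.
have DL : (4 + C) * n <= c * n by apply: ltnW; apply: leq_ltn_trans cn; apply: leq_addr.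
pose mI := ideal e S G (memory s).
(* The input takes at most [2 * n + 2 <= 4 * n] words, all below the region that the building
   program rewrites. *)
have mIlow a : a < 4 * n -> memory s a = mI a by rewrite -{1}sS => h; rewrite /mI ideal_low.
have mIc : eval w ((4 + C) * n) mI [::] (check eL eR AME) != 0.
  by rewrite -{1}sS CE; apply: ideal_check; rewrite ?sS // -CE.
have mIw a : 4 * n <= a < (4 + C) * n -> mI a < 2 ^ w.
  by move=> /andP[h _]; apply: ideal_word; rewrite ?sS // -CE.
have n4 : 0 < 4 * n by rewrite muln_gt0.
have [s' [[t ex] low chk]] := build_ok n4 nD DL Dw mIw mIc (erefl _) (erefl _) Cw ws m0 mIlow.
have agree a : a < 4 * n -> memory s' a = memory s a by move=> h; rewrite low ?mIlow.
exists t, s', (mkseq (memory s') ((4 + C) * n)); split=> //.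
- by rewrite size_mkseq.
- by move=> a; rewrite size_mkseq => h; rewrite nth_mkseq.
apply: supports_of_check chk cq; rewrite ?sS //.
- by rewrite agree.
- by rewrite agree //; move: n0; clear; lia.
- by move=> x xn; rewrite agree ?mS //; move: xn; clear; lia.
- by move=> k kG; rewrite agree ?mG //; move: kG sG n0; clear; lia.
Qed.
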